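(* Let $n,d\ge 1$ be integers and $v$ an indeterminate. The $q$-Schur algebra $\mathbf{S}(n,d)$ over $\mathbb{Q}(v)$ is the associative $\mathbb{Q}(v)$-algebra (with $1$) given by generators $1_\lambda$ ($\lambda\in\Lambda(n,d)$), $E_i$, $F_i$ ($i\in\{1,\dots,n-1\}$) subject to the relations: (S1$'$) $1_\lambda1_\mu=\delta_{\lambda,\mu}1_\lambda$ for $\lambda,\mu\in\Lambda(n,d)$, and $\sum_{\lambda\in\Lambda(n,d)}1_\lambda=1$; (S2$'$) for all $i\in\{1,\dots,n-1\}$ and $\lambda\in\Lambda(n,d)$: $E_i1_\lambda=1_{\lambda+\alpha_i}E_i$ if $\lambda+\alpha_i\in\Lambda(n,d)$, and $E_i1_\lambda=0$ otherwise; $F_i1_\lambda=1_{\lambda-\alpha_i}F_i$ if $\lambda-\alpha_i\in\Lambda(n,d)$, and $F_i1_\lambda=0$ otherwise; $1_\lambda E_i=E_i1_{\lambda-\alpha_i}$ if $\lambda-\alpha_i\in\Lambda(n,d)$, and $1_\lambda E_i=0$ otherwise; $1_\lambda F_i=F_i1_{\lambda+\alpha_i}$ if $\lambda+\alpha_i\in\Lambda(n,d)$, and $1_\lambda F_i=0$ otherwise; (S3$'$) $E_iF_j-F_jE_i=\delta_{ij}\sum_{\lambda\in\Lambda(n,d)}[\lambda_j-\lambda_{j+1}]\,1_\lambda$ for $i,j\in\{1,\dots,n-1\}$; along with the $q$-Serre relations, for $i,j\in\{1,\dots,n-1\}$: (Q4) $E_i^2E_j-(v+v^{-1})E_iE_jE_i+E_jE_i^2=0$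 if $|i-j|=1$, and $E_iE_j-E_jE_i=0$ otherwise; (Q5) $F_i^2F_j-(v+v^{-1})F_iF_jF_i+F_jF_i^2=0$ if $|i-j|=1$, and $F_iF_j-F_jF_i=0$ otherwise.
   Context: $\{\varepsilon_1,\dots,\varepsilon_n\}$ is the standard basis of $\mathbb{Z}^n$ and $\alpha_i=\varepsilon_i-\varepsilon_{i+1}$ for $1\le i\le n-1$. $\Lambda(n,d)$ is the set of $\lambda\in\mathbb{N}^n$ with $\lambda_1+\cdots+\lambda_n=d$ ($\mathbb{N}$ includes $0$). $[m]=(v^m-v^{-m})/(v-v^{-1})$ for $m\in\mathbb{Z}$. The $q$-Schur algebra is $\mathbf{S}(n,d)=\operatorname{End}_{\mathbf{H}}(V^{\otimes d})$, where $V$ is the $\mathbb{Q}(v)$-vector space with basis $v_1,\dots,v_n$ and $\mathbf{H}=\mathbf{H}(\Sigma_d)$ is the Hecke algebra of $\Sigma_d$ over $\mathbb{Q}(v)$ generated by $T_1,\dots,T_{d-1}$ with the braid relations and $(T_r-v)(T_r+v^{-1})=0$; $T_r$ acts on tensor places $r,r+1$ by $v_a\otimes v_a\mapsto v\,v_a\otimes v_a$; $v_a\otimes v_b\mapsto v_b\otimes v_a$ if $a<b$; $v_a\otimes v_b\mapsto v_b\otimes v_a+(v-v^{-1})v_a\otimes v_b$ if $a>b$. In $\mathbf{S}(n,d)$ the generators correspond to the following elements. The quantized enveloping algebra $\mathbf{U}_v(\mathfrak{gl}_n)$, with its standard generators $E_i,F_i,K_i^{\pm1}$, acts on $V$ by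 $E_iv_b=\delta_{b,i+1}v_i$, $F_iv_b=\delta_{b,i}v_{i+1}$, $K_iv_b=v^{\delta_{ib}}v_b$, and on $V^{\otimes d}$ (commuting with $\mathbf{H}$) via the coproduct $\Delta(K_i)=K_i\otimes K_i$, $\Delta(E_i)=E_i\otimes K_iK_{i+1}^{-1}+1\otimes E_i$, $\Delta(F_i)=F_i\otimes1+K_i^{-1}K_{i+1}\otimes F_i$. Then $E_i,F_i$ denote the resulting operators on $V^{\otimes d}$, and $1_\lambda=\prod_{j=1}^n\begin{bmatrix}K_j\\\lambda_j\end{bmatrix}$, where $\begin{bmatrix}X\\t\end{bmatrix}=\prod_{s=1}^t\frac{Xv^{-s+1}-X^{-1}v^{s-1}}{v^s-v^{-s}}$. *)

(* Defs.v *)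
From HB Require Import structures.
From mathcomp Require Import all_boot all_order all_fingroup all_algebra.
From mathcomp Require Import zify ring finmap.
From mathcomp.multinomials Require Import monalg.

Set Implicit Arguments.
Unset Strict Implicit.
Unset Printing Implicit Defensive.

Import GRing.Theory.
Local Open Scope ring_scope.

(* Indices 1 <= i <= n - 1 are encoded as i : 'I_n.-1 (shifted by one);
   [pos i] and [nxt i] are the positions i and i + 1 among the n. *)
Lemma nxt_subproof n (i : 'I_n.-1) : (i.+1 < n)%N.
Proof. by rewrite -ltn_predRL. Qed.

Definition pos n (i : 'I_n.-1) : 'I_n := widen_ord (leq_pred n) i.
Definition nxt n (i : 'I_n.-1) : 'I_n := Ordinal (nxt_subproof i).

Lemma pos_neq_nxt n (i : 'I_n.-1) : (pos i == nxt i) = false.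
Proof. by rewrite -val_eqE /= ltn_eqF. Qed.

Definition adjacent m (i j : 'I_m) : bool :=
  (i == j.+1 :> nat) || (j == i.+1 :> nat).

(* The constructions are made over an arbitrary field K and scalar v; see
   [Qv] and [v_ind] below for Q(v) and its indeterminate. *)
Section QSchur.
Variables (K : fieldType) (v : K).

Definition qint (m : int) : K := (v ^ m - v ^ (- m)) / (v - v^-1).

Section LinearMaps.
Variables (S T : finType).

(* The K-vector space with basis T. *)
Definition span_on (T : finType) : vectType K := {ffun T -> K^o}.

Definition bvec (T : finType) (t : T) : span_on T := [ffun s => (s == t)%:R].

Definition lin_map (f : S -> span_on T) (w : span_on S) : span_on T :=
  \sum_s w s *: f s.

Lemma lin_map_is_linear f : linear (lin_map f).
Proof.
move=> a u w; rewrite /lin_map scaler_sumr -big_split /=.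
by apply: eq_bigr => s _; rewrite !ffunE scalerA scalerDl.
Qed.

HB.instance Definition _ f :=
  GRing.isLinear.Build K (span_on S) (span_on T) *:%R (lin_map f)
    (lin_map_is_linear f).

(* The linear map sending the basis vector s to f s. *)
Definition lin_ext (f : S -> span_on T) : 'Hom(span_on S, span_on T) :=
  linfun (lin_map f).

Lemma lin_extE f s : lin_ext f (bvec s) = f s.
Proof.
rewrite lfunE /= /lin_map (bigD1 s) //= !ffunE eqxx scale1r big1 ?addr0 //.
by move=> r /negPf rs; rewrite !ffunE rs scale0r.
Qed.

Lemma hom_bvecP (V : vectType K) (f g : 'Hom(span_on S, V)) :
  (forall s, f (bvec s) = g (bvec s)) -> f = g.
Proof.
move=> fg; apply/lfunP => w.
have -> : w = \sum_s w s *: bvec s.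
  apply/ffunP => r; rewrite sum_ffunE (bigD1 r) //= !ffunE eqxx big1 ?addr0.
    by rewrite [_ *: _]mulr1.
  by move=> s /negPf sr; rewrite !ffunE eq_sym sr [_ *: _]mulr0.
by rewrite !linear_sum; apply: eq_bigr => s _; rewrite !linearZ /= fg.
Qed.

End LinearMaps.

(* The free associative unital algebra on X is the
   monoid algebra of the free monoid on X. *)
Definition free_alg (X : choiceType) : lalgType K := {malg K[{fmonom X}]}.

Definition fgen (X : choiceType) (x : X) : free_alg X := << fmu x >>.

(* Evaluation of noncommutative polynomials at operators, products of
   generators being sent to composites. *)
Definition eval (X : choiceType) (V : vectType K) (g : X -> 'End(V))
    (p : free_alg X) : 'End(V) :=
  \sum_(m <- msupp p) p@_m *: \big[@comp_lfun _ _ _ _/ \1%VF]_(x <- (m : seq X)) g x.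

Section EvalMorphism.
Local Open Scope fset_scope.
Variables (X : choiceType) (V : vectType K) (g : X -> 'End(V)).

Local Notation mon m := (\big[@comp_lfun _ _ _ _/ \1%VF]_(x <- m) g x).

Lemma evalEw (D : {fset {fmonom X}}) (p : free_alg X) : msupp p `<=` D ->
  eval g p = \sum_(m <- D) p@_m *: mon (m : seq X).
Proof.
move=> le; rewrite [LHS](big_fset_incl _ le) // => m _ /mcoeff_outdom ->.
by rewrite scale0r.
Qed.

Lemma eval_is_linear : linear (eval g).
Proof.
move=> c p q; pose D := msupp p `|` msupp q `|` msupp (c *: p + q).
rewrite !(@evalEw D) ?/D ?fsubsetUr //.
- rewrite scaler_sumr -big_split /=; apply: eq_bigr => m _.
  by rewrite mcoeffD mcoeffZ scalerDl scalerA.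
- by rewrite -fsetUA fsetUCA fsubsetUl.
- by rewrite -fsetUA fsubsetUl.
Qed.

HB.instance Definition _ :=
  GRing.isLinear.Build K (free_alg X) 'End(V) *:%R (eval g) eval_is_linear.

Lemma evalU c (m : {fmonom X}) :
  eval g << c *g m >> = c *: mon (m : seq X).
Proof. by rewrite (evalEw msuppU_le) big_seq_fset1 mcoeffUU. Qed.

Lemma eval_gen x : eval g (fgen x) = g x.
Proof. by rewrite evalU scale1r fmuE big_cons big_nil comp_lfun1r. Qed.

Lemma eval1 : eval g 1 = \1%VF.
Proof. by rewrite [LHS]evalU scale1r [mone](fmoneE X) big_nil. Qed.

Lemma evalM (p q : free_alg X) : eval g (p * q) = (eval g p \o eval g q)%VF.
Proof.
have mon_cat s t : mon (s ++ t) = (mon s \o mon t)%VF.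
  elim: s => [|x s IHs]; first by rewrite big_nil comp_lfun1l.
  by rewrite /= !big_cons IHs comp_lfunA.
have -> : (eval g p \o eval g q = \sum_(m <- msupp p) \sum_(m' <- msupp q)
    ((p@_m *: mon (m : seq X)) \o (q@_m' *: mon (m' : seq X))))%VF.
  rewrite (big_morph (fun f => f \o eval g q)%VF
    (fun f1 f2 => comp_lfunDl f1 f2 _) (comp_lfun0l _ _)).
  apply: eq_bigr => m _.
  by rewrite (big_morph _ (comp_lfunDr _) (comp_lfun0r _ _)).
rewrite [p * q]malgME raddf_sum; apply: eq_bigr => m _.
rewrite raddf_sum; apply: eq_bigr => m' _.
by rewrite /= evalU [mmul _ _]fmmulE mon_cat -comp_lfunZl -comp_lfunZr scalerA.
Qed.

End EvalMorphism.

(* The two-sided ideal generated by the differences p - q, R p q. *)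
Inductive rel_ideal (X : choiceType) (R : free_alg X -> free_alg X -> Prop) :
    free_alg X -> Prop :=
| Ideal_rel p q : R p q -> rel_ideal R (p - q)
| Ideal_0 : rel_ideal R 0
| Ideal_add p q : rel_ideal R p -> rel_ideal R q -> rel_ideal R (p + q)
| Ideal_mull p q : rel_ideal R q -> rel_ideal R (p * q)
| Ideal_mulr p q : rel_ideal R p -> rel_ideal R (p * q).

(* The algebra A of operators is presented by the generators X, standing for
   the operators g x, and the relations p = q, R p q: evaluation at g induces
   an isomorphism from the free algebra modulo [rel_ideal R] onto A. *)
Definition presented_by (X : choiceType) (V : vectType K)
    (A : 'End(V) -> Prop) (g : X -> 'End(V))
    (R : free_alg X -> free_alg X -> Prop) : Prop :=
  (forall f, A f <-> exists p, eval g p = f) /\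
  (forall p, eval g p = 0 <-> rel_ideal R p).

(* The d-th tensor power of V, with the pure tensors of the v_b as basis. *)
Definition nat_mod (n : nat) : vectType K := span_on 'I_n.
Definition tpower (n d : nat) : vectType K := span_on (d.-tuple 'I_n).

Definition tensv n d (u : nat_mod n) (w : tpower n d) : tpower n d.+1 :=
  [ffun t : d.+1.-tuple 'I_n => u (thead t) * w [tuple of behead t]].

Definition tensop n d (f : 'End(nat_mod n)) (g : 'End(tpower n d)) :
    'End(tpower n d.+1) :=
  lin_ext (fun t : d.+1.-tuple 'I_n =>
    tensv (f (bvec (thead t))) (g (bvec [tuple of behead t]))).

Definition swap_places n d (r : 'I_d.-1) (t : d.-tuple 'I_n) : d.-tuple 'I_n :=
  [tuple tnth t (tperm (pos r) (nxt r) k) | k < d].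

Definition T_op n d (r : 'I_d.-1) : 'End(tpower n d) :=
  lin_ext (fun t : d.-tuple 'I_n =>
    let a := tnth t (pos r) in
    let b := tnth t (nxt r) in
    if a == b then v *: bvec t
    else if (a < b)%N then bvec (swap_places r t)
    else bvec (swap_places r t) + (v - v^-1) *: bvec t).

Inductive hecke_rel d : free_alg 'I_d.-1 -> free_alg 'I_d.-1 -> Prop :=
| Hecke_braid r s : adjacent r s ->
    hecke_rel (fgen r * fgen s * fgen r) (fgen s * fgen r * fgen s)
| Hecke_comm r s : ~~ adjacent r s ->
    hecke_rel (fgen r * fgen s) (fgen s * fgen r)
| Hecke_quad r : hecke_rel ((fgen r - v *: 1) * (fgen r + v^-1 *: 1)) 0.

Section HeckeAction.
Hypothesis v_neq0 : v != 0.
Variables (n d : nat).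
Implicit Types (r s : 'I_d.-1) (t : d.-tuple 'I_n).

Local Notation T := (@T_op n d).
Local Notation sw := (@swap_places n d).
Local Notation z := (v - v^-1).

Let T_opE r t (a := tnth t (pos r)) (b := tnth t (nxt r)) :
  T r (bvec t) = if a == b :> nat then v *: bvec t
                 else if (a < b)%N then bvec (sw r t)
                 else bvec (sw r t) + z *: bvec t.
Proof. exact: lin_extE. Qed.

Let tnth_sw r t k : tnth (sw r t) k = tnth t (tperm (pos r) (nxt r) k).
Proof. by rewrite tnth_mktuple. Qed.

Let sw_invol r t : sw r (sw r t) = t.
Proof. by apply: eq_from_tnth => k; rewrite !tnth_sw tpermK. Qed.

Let scale_o (a : K) (b : K^o) : a *: b = a * b :> K.
Proof. by []. Qed.

Lemma T_quad r :
  ((T r - v *: \1) \o (T r + v^-1 *: \1))%VF = 0 :> 'End(tpower n d).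
Proof.
apply: hom_bvecP => t.
rewrite comp_lfunE !(add_lfunE, opp_lfunE, scale_lfunE, id_lfunE) !linearD.
rewrite !linearZ /= !T_opE zero_lfunE.
case: ltngtP => ab; rewrite ?(linearD, linearZ) /= !T_opE ?tnth_sw
  ?tpermL ?tpermR ?sw_invol ?ab ?(ltn_eqF ab) ?(gtn_eqF ab) ?eqxx
  1?ltnNge ?(ltnW ab) /=;
  by apply/ffunP => k; rewrite !ffunE !scale_o; field.
Qed.

Lemma T_comm r s : ~~ adjacent r s -> (T r \o T s = T s \o T r)%VF.
Proof.
have [-> //|rs] := eqVneq r s; move=> nadj.
have ne : [/\ pos r != pos s, pos r != nxt s, nxt r != pos s & nxt r != nxt s].
  move: rs nadj; rewrite /adjacent -!val_eqE /= eqSS => rs /norP[h1 h2].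
  by split => //; rewrite eq_sym.
case: ne => pp pn np nn.
have dr k : k = pos r \/ k = nxt r -> tperm (pos s) (nxt s) k = k.
  by case=> ->; rewrite tpermD // eq_sym.
have ds k : k = pos s \/ k = nxt s -> tperm (pos r) (nxt r) k = k.
  by case=> ->; rewrite tpermD.
have swC t : sw r (sw s t) = sw s (sw r t).
  apply: eq_from_tnth => k; rewrite !tnth_sw; congr (tnth t _).
  have [kr|kr] := boolP (k \in pred2 (pos r) (nxt r)).
    rewrite (dr k); last by case/orP: kr => /eqP; [left|right].
    by case/orP: kr => /eqP->; rewrite ?tpermL ?tpermR dr; auto.
  move: kr; rewrite inE negb_or => /andP[k1 k2].
  have fixk : tperm (pos r) (nxt r) k = k by rewrite tpermD // eq_sym.
  rewrite fixk; case: (tpermP (pos s) (nxt s) k) => [_|_|_ _];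
    by rewrite ?fixk // ds; auto.
apply: hom_bvecP => t; rewrite !comp_lfunE !T_opE.
case: (ltngtP (tnth t (pos r)) (tnth t (nxt r))) => ab;
case: (ltngtP (tnth t (pos s)) (tnth t (nxt s))) => cd;
  rewrite ?(linearD, linearZ) /= !T_opE ?tnth_sw ?(dr (pos r)) ?(dr (nxt r))
    ?(ds (pos s)) ?(ds (nxt s)); auto;
  rewrite ?ab ?cd ?(ltn_eqF ab) ?(gtn_eqF ab) ?(ltn_eqF cd) ?(gtn_eqF cd) ?eqxx
    ?(ltnNge (tnth t (pos r))) ?(ltnNge (tnth t (pos s))) ?(ltnW ab) ?(ltnW cd)
    /= ?swC //;
  by apply/ffunP => k; rewrite !ffunE !scale_o; field.
Qed.

Lemma T_braid_succ r s : nxt r = pos s ->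
  (T r \o (T s \o T r) = T s \o (T r \o T s))%VF.
Proof.
move=> rs; apply: hom_bvecP => t.
pose tup (a b c : 'I_n) : d.-tuple 'I_n :=
  [tuple if k == pos r then a else if k == pos s then b
         else if k == nxt s then c else tnth t k | k < d].
have ru : (nxt s == pos r) = false.
  by apply/eqP => /(congr1 val) /=; move: rs => /(congr1 val) /= <-; lia.
have qu : (nxt s == pos s) = false by rewrite eq_sym pos_neq_nxt.
have qr : (pos s == pos r) = false by rewrite -rs eq_sym pos_neq_nxt.
have tp a b c : tnth (tup a b c) (pos r) = a by rewrite tnth_mktuple eqxx.
have tq a b c : tnth (tup a b c) (pos s) = b by rewrite tnth_mktuple qr eqxx.
have tu a b c : tnth (tup a b c) (nxt s) = c.
  by rewrite tnth_mktuple ru qu eqxx.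
have swr a b c : sw r (tup a b c) = tup b a c.
  apply: eq_from_tnth => k; rewrite tnth_sw rs !tnth_mktuple.
  case: tpermP => [->|->|/eqP/negPf k1 /eqP/negPf k2].
  - by rewrite qr !eqxx.
  - by rewrite qr !eqxx.
  - by rewrite k1 k2.
have sws a b c : sw s (tup a b c) = tup a c b.
  apply: eq_from_tnth => k; rewrite tnth_sw !tnth_mktuple.
  case: tpermP => [->|->|/eqP/negPf k1 /eqP/negPf k2].
  - by rewrite ru qu qr !eqxx.
  - by rewrite ru qu qr !eqxx.
  - by rewrite k1 k2.
have -> : t = tup (tnth t (pos r)) (tnth t (pos s)) (tnth t (nxt s)).
  apply: eq_from_tnth => k; rewrite tnth_mktuple.
  by do 3![case: eqP => [-> //|_]].
move: (tnth t (pos r)) (tnth t (pos s)) (tnth t (nxt s)) => a b c.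
have Tr x y w : T r (bvec (tup x y w)) =
    if x == y :> nat then v *: bvec (tup x y w)
    else if (x < y)%N then bvec (tup y x w)
    else bvec (tup y x w) + z *: bvec (tup x y w).
  by rewrite T_opE rs tp tq swr.
have Ts x y w : T s (bvec (tup x y w)) =
    if y == w :> nat then v *: bvec (tup x y w)
    else if (y < w)%N then bvec (tup x w y)
    else bvec (tup x w y) + z *: bvec (tup x y w).
  by rewrite T_opE tq tu sws.
have Treq x w : T r (bvec (tup x x w)) = v *: bvec (tup x x w).
  by rewrite Tr eqxx.
have Tseq x w : T s (bvec (tup w x x)) = v *: bvec (tup w x x).
  by rewrite Ts eqxx.
have Trlt (x y : 'I_n) : (x < y)%N -> forall w,
    (T r (bvec (tup x y w)) = bvec (tup y x w)) *
    (T r (bvec (tup y x w)) = bvec (tup x y w) + z *: bvec (tup y x w)).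
  by move=> xy w; rewrite !Tr xy ltn_eqF // gtn_eqF // ltnNge ltnW.
have Tslt (x y : 'I_n) : (x < y)%N -> forall w,
    (T s (bvec (tup w x y)) = bvec (tup w y x)) *
    (T s (bvec (tup w y x)) = bvec (tup w x y) + z *: bvec (tup w y x)).
  by move=> xy w; rewrite !Ts xy ltn_eqF // gtn_eqF // ltnNge ltnW.
have TrD x y : T r (x + y) = T r x + T r y by exact: linearD.
have TsD x y : T s (x + y) = T s x + T s y by exact: linearD.
have TrZ k x : T r (k *: x) = k *: T r x by exact: linearZ.
have TsZ k x : T s (k *: x) = k *: T s x by exact: linearZ.
rewrite !comp_lfunE; clear Tr Ts swr sws tp tq tu.
clearbody tup; move: (T r) (T s) TrD TsD TrZ TsZ Treq Tseq Trlt Tslt.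
move=> f g fD gD fZ gZ feq geq flt glt.
case: (ltngtP a b) => ab; case: (ltngtP b c) => bc; case: (ltngtP a c) => ac;
  try (exfalso; lia);
  try move/val_inj: ab => ab; try move/val_inj: bc => bc;
  try move/val_inj: ac => ac; subst.
all: repeat first
  [ rewrite fD | rewrite gD | rewrite fZ | rewrite gZ | rewrite feq | rewrite geq
  | match goal with H : is_true (leq (S _) _) |- _ =>
      first [rewrite !(flt _ _ H) | rewrite !(glt _ _ H)] end].
all: by apply/ffunP => k; rewrite !ffunE ?scale_o; field.
Qed.

Lemma T_braid r s : adjacent r s ->
  (T r \o (T s \o T r) = T s \o (T r \o T s))%VF.
Proof.
by case/orP => /eqP rs; [apply/esym|]; apply: T_braid_succ; apply: val_inj.
Qed.

(* The action of H, which is the free algebra on the T_r modulo the Hecke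
   relations, is well defined. *)
Lemma hecke_action (h : free_alg 'I_d.-1) :
  rel_ideal (@hecke_rel d) h -> eval T h = 0.
Proof.
have E2 r s : eval T (fgen r * fgen s) = (T r \o T s)%VF.
  by rewrite (evalM T (fgen r)) (eval_gen T r) (eval_gen T s).
have E3 r s u : eval T (fgen r * fgen s * fgen u) = (T r \o (T s \o T u))%VF.
  by rewrite (evalM T (fgen r * fgen s)) E2 (eval_gen T u) comp_lfunA.
elim=> [p q pq||p q _ p0 _ q0|p q _ q0|p q _ p0].
- apply/eqP; rewrite linearB subr_eq0 /=; apply/eqP.
  case: pq => {p q} [r s adj|r s nadj|r].
  + exact: etrans (E3 r s r) (etrans (T_braid adj) (esym (E3 s r s))).
  + exact: etrans (E2 r s) (etrans (T_comm nadj) (esym (E2 s r))).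
  + rewrite evalM linear0 -[RHS](T_quad r) !(linearB, linearD, linearZ) /=.
    by rewrite !eval1 !eval_gen.
- exact: linear0.
- by rewrite linearD /= p0 q0 addr0.
- by rewrite evalM q0 comp_lfun0r.
- by rewrite evalM p0 comp_lfun0l.
Qed.

End HeckeAction.

(* S(n,d) = End_H(V^{(x) d}): the operators commuting with the action of every
   element of H. *)
Definition q_schur n d (f : 'End(tpower n d)) : Prop :=
  forall h, (f \o eval (@T_op n d) h)%VF = (eval (@T_op n d) h \o f)%VF.

(* Action of the quantized enveloping algebra on V; [Kv i z] is K_i^z. *)
Definition Kv n (i : 'I_n) (z : int) : 'End(nat_mod n) :=
  lin_ext (fun b => (if b == i then v ^ z else 1) *: bvec b).
Definition Ev n (i : 'I_n.-1) : 'End(nat_mod n) :=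
  lin_ext (fun b => (b == nxt i)%:R *: bvec (pos i)).
Definition Fv n (i : 'I_n.-1) : 'End(nat_mod n) :=
  lin_ext (fun b => (b == pos i)%:R *: bvec (nxt i)).

(* Action on the tensor powers, by Delta^(d+1) = (id (x) Delta^(d)) Delta,
   Delta^(0) being the counit. *)
Fixpoint K_op n d (i : 'I_n) (z : int) : 'End(tpower n d) :=
  if d is d'.+1 then tensop (Kv i z) (K_op d' i z) else \1%VF.

Fixpoint E_op n d (i : 'I_n.-1) : 'End(tpower n d) :=
  if d is d'.+1 then
    tensop (Ev i) (K_op d' (pos i) 1 \o K_op d' (nxt i) (-1))%VF
    + tensop \1%VF (E_op d' i)
  else 0.

Fixpoint F_op n d (i : 'I_n.-1) : 'End(tpower n d) :=
  if d is d'.+1 then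
    tensop (Fv i) \1%VF
    + tensop (Kv (pos i) (-1) \o Kv (nxt i) 1)%VF (F_op d' i)
  else 0.

(* The q-binomial [X; t], with Y standing for X^-1. *)
Definition q_binom (V : vectType K) (X Y : 'End(V)) (t : nat) : 'End(V) :=
  \big[@comp_lfun _ _ _ _/ \1%VF]_(1 <= s < t.+1)
    ((v ^ s%:Z - v ^ (- s%:Z))^-1 *: (v ^ (1 - s%:Z) *: X - v ^ (s%:Z - 1) *: Y)).

(* Lambda(n,d), whose elements have entries at most d. *)
Definition Lambda n d : finType :=
  {l : {ffun 'I_n -> 'I_d.+1} | (\sum_i l i == d)%N}.

Definition weight n d (l : Lambda n d) : {ffun 'I_n -> int} :=
  [ffun j => (val l j : nat)%:Z].

Definition alpha n (i : 'I_n.-1) : {ffun 'I_n -> int} :=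
  [ffun j => (j == pos i)%:Z - (j == nxt i)%:Z].

(* The element of Lambda(n,d) with given entries, if there is one. *)
Definition to_Lambda n d (w : {ffun 'I_n -> int}) : option (Lambda n d) :=
  [pick m : Lambda n d | weight m == w].

Definition idem_op n d (l : Lambda n d) : 'End(tpower n d) :=
  \big[@comp_lfun _ _ _ _/ \1%VF]_(j < n)
    q_binom (K_op d j 1) (K_op d j (-1)) (val l j).

(* The generators: 1_l, E_i and F_i, in this order. *)
Definition schur_idx n d : choiceType := (Lambda n d + ('I_n.-1 + 'I_n.-1))%type.

Definition schur_op n d (x : schur_idx n d) : 'End(tpower n d) :=
  match x with
  | inl l => idem_op l
  | inr (inl i) => E_op d i
  | inr (inr i) => F_op d i
  end.

Section Relations.
Variables n d : nat.

Definition gen_one (l : Lambda n d) : free_alg (schur_idx n d) := fgen (inl l).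
Definition gen_E (i : 'I_n.-1) : free_alg (schur_idx n d) := fgen (inr (inl i)).
Definition gen_F (i : 'I_n.-1) : free_alg (schur_idx n d) := fgen (inr (inr i)).

Local Notation one_ := gen_one.
Local Notation E := gen_E.
Local Notation F := gen_F.

Inductive schur_rel :
    free_alg (schur_idx n d) -> free_alg (schur_idx n d) -> Prop :=
| Rel_orth l m : schur_rel (one_ l * one_ m) (if l == m then one_ l else 0)
| Rel_sum : schur_rel (\sum_l one_ l) 1
| Rel_E_one i l :
    schur_rel (E i * one_ l)
      (if to_Lambda d (weight l + alpha i) is Some m then one_ m * E i else 0)
| Rel_F_one i l :
    schur_rel (F i * one_ l)
      (if to_Lambda d (weight l - alpha i) is Some m then one_ m * F i else 0)
| Rel_one_E i l :
    schur_rel (one_ l * E i)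
      (if to_Lambda d (weight l - alpha i) is Some m then E i * one_ m else 0)
| Rel_one_F i l :
    schur_rel (one_ l * F i)
      (if to_Lambda d (weight l + alpha i) is Some m then F i * one_ m else 0)
| Rel_EF i j :
    schur_rel (E i * F j - F j * E i)
      (if i == j then
         \sum_l qint (weight l (pos j) - weight l (nxt j)) *: one_ l
       else 0)
| Rel_serre_E i j : adjacent i j ->
    schur_rel
      (E i ^+ 2 * E j - (v + v^-1) *: (E i * E j * E i) + E j * E i ^+ 2) 0
| Rel_comm_E i j : ~~ adjacent i j -> schur_rel (E i * E j - E j * E i) 0
| Rel_serre_F i j : adjacent i j ->
    schur_rel
      (F i ^+ 2 * F j - (v + v^-1) *: (F i * F j * F i) + F j * F i ^+ 2) 0
| Rel_comm_F i j : ~~ adjacent i j -> schur_rel (F i * F j - F j * F i) 0.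

End Relations.

End QSchur.

Definition Qv : fieldType := {fraction {poly rat}}.
Definition v_ind : Qv := tofrac 'X.

(* Main.v *)
(** Let A be the algebra defined by the presentation, acting on the d-th tensor
    power of V.

    Injectivity. The iterated q-commutators of the E_i (L-operators) and those
    of the F_i give a central Casimir element of A, which acts on singular
    vectors of weight l by the sum of the v^(2i - 2 l_i); for dominant l this
    scalar determines l. Filter A by the two-sided ideals J_r generated by the
    1_l of rank at least r, for a ranking of the weights which increases along
    the simple roots. Let x be in J_r but not in J_(r+1), with l of rank r.
    Modulo J_(r+1), some nonzero 1_m a x is killed by all E_i; an sl_2-argument
    shows that m is dominant and the Casimir element that m = l. Likewise on the
    right, so that some 1_l a x b 1_l is a nonzero multiple of 1_l modulo
    J_(r+1). Since the tensor power contains a singular vector of weight l (a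
    product of quantum exterior products), x does not act by 0.

    Surjectivity. If d further letters are available, the tensor v_t with those
    d distinct letters generates the tensor power over A, and its weight space
    over the Hecke algebra; hence an endomorphism h commuting with the Hecke
    algebra agrees with an element of A on that weight space, and, 1_l lying in
    A 1_omega A for the relevant weights l, everywhere. In general, extend
    f by 0 to the tensor power with n + d letters, and write the extension as a
    combination of products (F_i ... ) (E_j ... ) 1_l: the compression of such
    a product to the first n letters is either 0 or of the same form. *)
Require Import Defs.
From HB Require Import structures.
From mathcomp Require Import all_boot all_fingroup all_algebra.
From mathcomp Require Import zify ring finmap.
From mathcomp.multinomials Require Import monalg.
From mathcomp.classical Require Import boolp.

Set Implicit Arguments.
Unset Strict Implicit.
Unset Printing Implicit Defensive.
Import GRing.Theory.
Local Open Scope ring_scope.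

(** * Identities in noncommutative algebras, by reflection *)

(** The presented algebra comes without a basis or a dimension bound, hence the filtration by ideals
    and a central element that separates dominant weights. This element comes from the R-matrix
    formalism. The L-operators form a triangular matrix L with L Delta(x) = Delta^op(x) L for x =
    E_k, F_k; the mirror construction from the F_i gives M with Delta(x) M = M Delta^op(x). So X = M
    L commutes with Delta(x), and its quantum trace, the sum of the v^(2i) X_ii, is central. On a
    singular vector L reduces to its diagonal, and M_ii L_ii = K_i^(-2) gives the scalars v^(-2
    l_i). For surjectivity, the Hecke operators have to be recovered inside the algebra: on a tensor
    in which the letters i and i + 1 occur once each, in this order and in neighbouring places r, r
    + 1, the element F_i E_i - v^-1 acts as T_r. In the compression the order of the factors
    matters: no E_i leads from the first letters to the additional ones, and what an F_i has moved
    there never comes back under further F_j. *)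

Section NcRing.
Variables (K : fieldType) (A : algType K).

Inductive nc_expr :=
| NcVar of nat
| NcOne
| NcZero
| NcAdd of nc_expr & nc_expr
| NcOpp of nc_expr
| NcMul of nc_expr & nc_expr
| NcScale of K & nc_expr
| NcExp of nc_expr & nat.

Fixpoint nc_eval (env : seq A) e : A :=
  match e with
  | NcVar i => nth 0 env i
  | NcOne => 1
  | NcZero => 0
  | NcAdd e1 e2 => nc_eval env e1 + nc_eval env e2
  | NcOpp e1 => - nc_eval env e1
  | NcMul e1 e2 => nc_eval env e1 * nc_eval env e2
  | NcScale c e1 => c *: nc_eval env e1
  | NcExp e1 n => nc_eval env e1 ^+ n
  end.

Definition nc_poly := seq (K * seq nat).

Definition nc_word (env : seq A) (w : seq nat) : A :=
  foldr (fun i a => nth 0 env i * a) 1 w.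

Definition nc_poly_eval (env : seq A) (p : nc_poly) : A :=
  foldr (fun cw a => cw.1 *: nc_word env cw.2 + a) 0 p.

(** This and the following list operations are private copies, built from [match] and [if] only:
    [cbv] with an explicit list of constants evaluates them and leaves the operations of [K]
    alone. *)
Fixpoint nc_app (T : Type) (s t : seq T) : seq T :=
  match s with [::] => t | x :: s' => x :: nc_app s' t end.

Fixpoint nc_scale (c : K) (p : nc_poly) : nc_poly :=
  match p with [::] => [::] | cw :: p' => (c * cw.1, cw.2) :: nc_scale c p' end.

Fixpoint nc_mul1 (cw : K * seq nat) (p : nc_poly) : nc_poly :=
  match p with
  | [::] => [::]
  | du :: p' => (cw.1 * du.1, nc_app cw.2 du.2) :: nc_mul1 cw p'
  end.

Fixpoint nc_mul (p q : nc_poly) : nc_poly :=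
  match p with [::] => [::] | cw :: p' => nc_app (nc_mul1 cw q) (nc_mul p' q) end.

Fixpoint nc_exp (p : nc_poly) (n : nat) : nc_poly :=
  match n with O => [:: (1, [::])] | S n' => nc_mul p (nc_exp p n') end.

Fixpoint nc_norm e : nc_poly :=
  match e with
  | NcVar i => [:: (1, [:: i])]
  | NcOne => [:: (1, [::])]
  | NcZero => [::]
  | NcAdd e1 e2 => nc_app (nc_norm e1) (nc_norm e2)
  | NcOpp e1 => nc_scale (-1) (nc_norm e1)
  | NcMul e1 e2 => nc_mul (nc_norm e1) (nc_norm e2)
  | NcScale c e1 => nc_scale c (nc_norm e1)
  | NcExp e1 n => nc_exp (nc_norm e1) n
  end.

Fixpoint nc_eqn (m n : nat) : bool :=
  match m, n with
  | O, O => true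
  | S m', S n' => nc_eqn m' n'
  | _, _ => false
  end.

Fixpoint nc_eqw (s t : seq nat) : bool :=
  match s, t with
  | [::], [::] => true
  | x :: s', y :: t' => if nc_eqn x y then nc_eqw s' t' else false
  | _, _ => false
  end.

Fixpoint nc_insert (c : K) (w : seq nat) (p : nc_poly) : nc_poly :=
  match p with
  | [::] => [:: (c, w)]
  | du :: p' => if nc_eqw w du.2 then (c + du.1, w) :: p'
                else du :: nc_insert c w p'
  end.

Fixpoint nc_collect (p : nc_poly) : nc_poly :=
  match p with
  | [::] => [::]
  | cw :: p' => nc_insert cw.1 cw.2 (nc_collect p')
  end.

(** A conjunction of equations in [K], since equality in [K] is left to [ring] and [field]. *)
Fixpoint nc_null (p : nc_poly) : Prop :=
  match p with [::] => True | cw :: p' => cw.1 = 0 /\ nc_null p' end.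

Lemma nc_eqnP m n : nc_eqn m n -> m = n.
Proof. by elim: m n => [|m IHm] [|n] //= /IHm ->. Qed.

Lemma nc_eqwP s t : nc_eqw s t -> s = t.
Proof.
elim: s t => [|x s IHs] [|y t] //=.
by case E: (nc_eqn x y) => // /IHs ->; rewrite (nc_eqnP E).
Qed.

Lemma nc_app_cat T (s t : seq T) : nc_app s t = s ++ t.
Proof. by elim: s => //= x s ->. Qed.

Lemma nc_word_cat env w u : nc_word env (w ++ u) = nc_word env w * nc_word env u.
Proof. by elim: w => [|i w IHw] /=; rewrite ?mul1r // IHw mulrA. Qed.

Lemma nc_poly_eval_cat env p q :
  nc_poly_eval env (p ++ q) = nc_poly_eval env p + nc_poly_eval env q.
Proof. by elim: p => [|cw p IHp] /=; rewrite ?add0r // IHp addrA. Qed.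

Lemma nc_scaleE env c p : nc_poly_eval env (nc_scale c p) = c *: nc_poly_eval env p.
Proof. by elim: p => [|cw p IHp] /=; rewrite ?scaler0 // IHp scalerDr scalerA. Qed.

Lemma nc_mulE env p q :
  nc_poly_eval env (nc_mul p q) = nc_poly_eval env p * nc_poly_eval env q.
Proof.
elim: p => [|[c w] p IHp] /=; first by rewrite mul0r.
rewrite nc_app_cat nc_poly_eval_cat IHp mulrDl; congr (_ + _).
elim: q {IHp} => [|[b u] q IHq] /=; first by rewrite mulr0.
rewrite IHq nc_app_cat nc_word_cat mulrDr; congr (_ + _).
by rewrite -[in RHS]scalerAr -[in RHS]scalerAl scalerA mulrC.
Qed.

Lemma nc_normE env e : nc_poly_eval env (nc_norm e) = nc_eval env e.
Proof.
elim: e => [i|||e1 H1 e2 H2|e H|e1 H1 e2 H2|c e H|e H n] /=.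
- by rewrite scale1r mulr1 addr0.
- by rewrite scale1r addr0.
- by [].
- by rewrite nc_app_cat nc_poly_eval_cat H1 H2.
- by rewrite nc_scaleE scaleN1r H.
- by rewrite nc_mulE H1 H2.
- by rewrite nc_scaleE H.
- elim: n => [|n IHn] /=; first by rewrite scale1r addr0.
  by rewrite nc_mulE IHn H exprS.
Qed.

Lemma nc_collectE env p : nc_poly_eval env (nc_collect p) = nc_poly_eval env p.
Proof.
elim: p => //= -[c w] p <- /=.
elim: (nc_collect p) => //= -[b u] q IHq /=.
case: ifP => [/nc_eqwP -> /=|_ /=]; first by rewrite scalerDl addrA.
by rewrite IHq addrCA.
Qed.

(* A rule (i, j, c) stands for the q-commutation x_i x_j = c x_j x_i. *)
Definition nc_rules := seq (nat * nat * K).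

Fixpoint nc_valid (env : seq A) (rs : nc_rules) : Prop :=
  match rs with
  | [::] => True
  | r :: rs' =>
      nth 0 env r.1.1 * nth 0 env r.1.2 =
        r.2 *: (nth 0 env r.1.2 * nth 0 env r.1.1) /\ nc_valid env rs'
  end.

Fixpoint nc_lookup (rs : nc_rules) (i j : nat) : option K :=
  match rs with
  | [::] => None
  | r :: rs' => if nc_eqn i r.1.1 then
                  if nc_eqn j r.1.2 then Some r.2 else nc_lookup rs' i j
                else nc_lookup rs' i j
  end.

(** The insertion step of a sort: the letter [i] moves to the right as long as a rule applies and
    stops at the first letter without one. Nothing is claimed about normal forms; soundness
    suffices. *)
Fixpoint nc_push (rs : nc_rules) (c : K) (i : nat) (w : seq nat) :
    K * seq nat :=
  match w with
  | [::] => (c, [:: i])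
  | j :: w' => match nc_lookup rs i j with
               | Some d => let: (b, u) := nc_push rs (c * d) i w' in (b, j :: u)
               | None => (c, i :: w)
               end
  end.

Fixpoint nc_sortw (rs : nc_rules) (c : K) (w : seq nat) : K * seq nat :=
  match w with
  | [::] => (c, [::])
  | i :: w' => let: (b, u) := nc_sortw rs c w' in nc_push rs b i u
  end.

Fixpoint nc_sortp (rs : nc_rules) (p : nc_poly) : nc_poly :=
  match p with
  | [::] => [::]
  | cw :: p' => nc_sortw rs cw.1 cw.2 :: nc_sortp rs p'
  end.

Lemma nc_lookupE env rs i j d : nc_valid env rs -> nc_lookup rs i j = Some d ->
  nth 0 env i * nth 0 env j = d *: (nth 0 env j * nth 0 env i).
Proof.
elim: rs => //= -[[a b] c] rs IHrs [/= Hr /IHrs IH].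
case E: (nc_eqn i a) => //; case E': (nc_eqn j b) => // -[<-].
by rewrite (nc_eqnP E) (nc_eqnP E').
Qed.

Lemma nc_pushE env rs c i w : nc_valid env rs ->
  (nc_push rs c i w).1 *: nc_word env (nc_push rs c i w).2 =
    c *: nc_word env (i :: w).
Proof.
move=> Hrs; elim: w c => //= j w IHw c.
case E: (nc_lookup rs i j) => [d|] //=.
have := IHw (c * d); case: (nc_push _ _ _ _) => b u /= Hu.
rewrite scalerAr Hu mulrA (nc_lookupE Hrs E) -!scalerAl -scalerAr.
by rewrite scalerA mulrA.
Qed.

Lemma nc_sortwE env rs c w : nc_valid env rs ->
  (nc_sortw rs c w).1 *: nc_word env (nc_sortw rs c w).2 = c *: nc_word env w.
Proof.
move=> Hrs; elim: w => //= i w; case: (nc_sortw _ _ _) => b u /= Hu.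
by rewrite nc_pushE //= scalerAr Hu -scalerAr.
Qed.

Lemma nc_sortpE env rs p : nc_valid env rs ->
  nc_poly_eval env (nc_sortp rs p) = nc_poly_eval env p.
Proof. by move=> Hrs; elim: p => //= cw p ->; rewrite nc_sortwE. Qed.

Lemma nc_ring_correct env rs e1 e2 : nc_valid env rs ->
  nc_null (nc_collect (nc_sortp rs (nc_norm (NcAdd e1 (NcOpp e2))))) ->
  nc_eval env e1 = nc_eval env e2.
Proof.
move=> Hrs H; apply/eqP; rewrite -subr_eq0.
rewrite -[_ - _]/(nc_eval env (NcAdd e1 (NcOpp e2))) -nc_normE.
rewrite -(nc_sortpE _ Hrs) -nc_collectE.
elim: (nc_collect _) H => [|[c w] p IHp] //= [-> /IHp /eqP ->].
by rewrite scale0r addr0.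
Qed.

End NcRing.

(** * Reification of identities and rules *)

Ltac nc_find x env :=
  lazymatch env with
  | x :: _ => constr:(O)
  | _ :: ?env' => let k := nc_find x env' in constr:(S k)
  end.

Ltac nc_mem x env :=
  match env with
  | x :: _ => constr:(true)
  | _ :: ?env' => nc_mem x env'
  | _ => constr:(false)
  end.

Ltac nc_atoms t env :=
  lazymatch t with
  | (?a + ?b)%R => let env' := nc_atoms a env in nc_atoms b env'
  | (- ?a)%R => nc_atoms a env
  | (?a * ?b)%R => let env' := nc_atoms a env in nc_atoms b env'
  | (_ *: ?a)%R => nc_atoms a env
  | (?a ^+ _)%R => nc_atoms a env
  | 0%R => env
  | 1%R => env
  | _ => lazymatch nc_mem t env with
         | true => env
         | false => constr:(t :: env)
         end
  end.

Ltac nc_reify K t env :=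
  lazymatch t with
  | (?a + ?b)%R => let x := nc_reify K a env in let y := nc_reify K b env in
      constr:(NcAdd x y)
  | (- ?a)%R => let x := nc_reify K a env in constr:(NcOpp x)
  | (?a * ?b)%R => let x := nc_reify K a env in let y := nc_reify K b env in
      constr:(NcMul x y)
  | (?c *: ?a)%R => let x := nc_reify K a env in constr:(@NcScale K c x)
  | (?a ^+ ?n)%R => let x := nc_reify K a env in constr:(@NcExp K x n)
  | 0%R => constr:(NcZero K)
  | 1%R => constr:(NcOne K)
  | _ => let i := nc_find t env in constr:(NcVar K i)
  end.

Ltac nc_rules_atoms hs env :=
  lazymatch hs with
  | (?h, ?hs') =>
      lazymatch type of h with
      | ?l = ?r => let env1 := nc_atoms l env in let env2 := nc_atoms r env1 in
          nc_rules_atoms hs' env2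
      end
  | _ => env
  end.

Ltac nc_reify_rules K hs env :=
  lazymatch hs with
  | (?h, ?hs') =>
      lazymatch type of h with
      | (?x * ?y)%R = (?c *: _)%R =>
          let i := nc_find x env in let j := nc_find y env in
          let rs := nc_reify_rules K hs' env in
          constr:((i, j, c) :: rs)
      end
  | _ => constr:(@nil (nat * nat * GRing.Field.sort K))
  end.

Ltac nc_rules_proof hs :=
  lazymatch hs with
  | (?h, ?hs') => let p := nc_rules_proof hs' in constr:(conj h p)
  | _ => constr:(I)
  end.

(* Reduces an identity of K-algebras, with all products taken to be
   noncommutative, to the vanishing of its coefficients in K; hs is a list
   (h1, (h2, ... tt)) of rules x * y = c *: (y * x) used from left to right. *)
Ltac nc_coefs K A hs :=
  lazymatch goal with
  | |- ?l = ?r =>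
    let env0 := constr:(@nil (GRing.Algebra.sort A)) in
    let env1 := nc_atoms l env0 in
    let env2 := nc_atoms r env1 in
    let env := nc_rules_atoms hs env2 in
    let x := nc_reify K l env in
    let y := nc_reify K r env in
    let rs := nc_reify_rules K hs env in
    let pf := nc_rules_proof hs in
    apply: (@nc_ring_correct K A env rs x y pf);
    cbv beta iota delta [nc_null nc_collect nc_insert nc_eqw nc_eqn nc_norm
      nc_exp nc_mul nc_mul1 nc_scale nc_app nc_sortp nc_sortw nc_push nc_lookup
      fst snd];
    repeat split
  end.
Ltac nc_sort K A hs := nc_coefs K A hs; first [ring | field];
  repeat (apply/andP; split); try done.
Ltac nc_ring K A := nc_sort K A tt.

(** * L-operators *)

Section LOperators.
Variables (K : fieldType) (v : K) (A : algType K) (n : nat).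
Hypotheses (v_neq0 : v != 0) (v_sqr_sub_neq0 : v * v - 1 != 0).
Hypothesis v_sqr_add_neq0 : v * v + 1 != 0.

Lemma v_add_inv_neq0 : v + v^-1 != 0.
Proof.
have -> : v + v^-1 = (v * v + 1) / v by field.
by rewrite mulf_neq0 ?invr_neq0.
Qed.

Lemma v_sub_inv_neq0 : v - v^-1 != 0.
Proof.
have -> : v - v^-1 = (v * v - 1) / v by field.
by rewrite mulf_neq0 ?invr_neq0.
Qed.

(* The eigenvalue of K_i on the k-th basis vector of V. *)
Definition eps_wt (i k : nat) : K := if i == k then v else 1.

(* The eigenvalue of the conjugation by K_i on E_k. *)
Definition root_wt (i k : nat) : K := eps_wt i k / eps_wt i k.+1.

(** The relations of U_v(gl_n), indexed by natural numbers because the L-operators are defined by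
    recursion on an index. Commutations carry an explicit coefficient, even if it is 1: this is the
    form of a rule for [nc_sort]. *)
Record qgl_rels (E F Kp Km : nat -> A) : Prop := QglRels {
  qgl_KpKm : forall i, (i < n)%N -> Kp i * Km i = 1;
  qgl_KmKp : forall i, (i < n)%N -> Km i * Kp i = 1;
  qgl_KmKm : forall i j, (i < n)%N -> (j < n)%N -> Km i * Km j = 1 *: (Km j * Km i);
  qgl_KpKm_comm : forall i j, (i < n)%N -> (j < n)%N -> Kp i * Km j = 1 *: (Km j * Kp i);
  qgl_KpKp : forall i j, (i < n)%N -> (j < n)%N -> Kp i * Kp j = 1 *: (Kp j * Kp i);
  qgl_KpE : forall i k, (i < n)%N -> (k.+1 < n)%N ->
    Kp i * E k = root_wt i k *: (E k * Kp i);
  qgl_KmE : forall i k, (i < n)%N -> (k.+1 < n)%N ->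
    Km i * E k = (root_wt i k)^-1 *: (E k * Km i);
  qgl_KpF : forall i k, (i < n)%N -> (k.+1 < n)%N ->
    Kp i * F k = (root_wt i k)^-1 *: (F k * Kp i);
  qgl_KmF : forall i k, (i < n)%N -> (k.+1 < n)%N ->
    Km i * F k = root_wt i k *: (F k * Km i);
  qgl_EF : forall j k, (j.+1 < n)%N -> (k.+1 < n)%N ->
    E j * F k - F k * E j =
      if j == k then (v - v^-1)^-1 *: (Kp k * Km k.+1 - Km k * Kp k.+1) else 0;
  qgl_EE_far : forall j k, (j.+1 < n)%N -> (k.+1 < n)%N ->
    (j.+1 < k)%N || (k.+1 < j)%N -> E j * E k = 1 *: (E k * E j);
  qgl_FF_far : forall j k, (j.+1 < n)%N -> (k.+1 < n)%N ->
    (j.+1 < k)%N || (k.+1 < j)%N -> F j * F k = 1 *: (F k * F j);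
  qgl_serreE : forall j k, (j.+1 < n)%N -> (k.+1 < n)%N ->
    (j == k.+1) || (k == j.+1) ->
    E j ^+ 2 * E k - (v + v^-1) *: (E j * E k * E j) + E k * E j ^+ 2 = 0;
  qgl_serreF : forall j k, (j.+1 < n)%N -> (k.+1 < n)%N ->
    (j == k.+1) || (k == j.+1) ->
    F j ^+ 2 * F k - (v + v^-1) *: (F j * F k * F j) + F k * F j ^+ 2 = 0
}.

Lemma root_wt_same k : root_wt k k = v.
Proof. by rewrite /root_wt /eps_wt eqxx ltn_eqF // divr1. Qed.

Lemma root_wt_next k : root_wt k.+1 k = v^-1.
Proof. by rewrite /root_wt /eps_wt eqxx gtn_eqF // div1r. Qed.

Lemma root_wt_other i k : i != k -> i != k.+1 -> root_wt i k = 1.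
Proof. by rewrite /root_wt /eps_wt => /negPf-> /negPf->; rewrite divr1. Qed.

Definition root_wtE := (root_wt_same, root_wt_next).

Variables E F Kp Km : nat -> A.
Hypothesis Rel : qgl_rels E F Kp Km.

(** The triangular L-matrix of the R-matrix formalism: K_a^-1 on the diagonal and iterated
    q-commutators below it. Recursion on the row appends one E_a at a time. *)
Fixpoint Lop (a b : nat) : A :=
  if b == a then Km a else
  match a with
  | O => 0
  | a'.+1 => Lop a' b * E a' - v *: (E a' * Lop a' b)
  end.

Lemma Lop_diag a : Lop a a = Km a.
Proof. by case: a => [|a] /=; rewrite ?eqxx. Qed.

Lemma Lop_eq0 a b : (a < b)%N -> Lop a b = 0.
Proof.
elim: a => [|a IHa] /= ab; first by rewrite gtn_eqF.
by rewrite gtn_eqF // IHa ?(ltnW ab) // mul0r mulr0 scaler0 subr0.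
Qed.

Lemma LopS a b : (b <= a)%N -> Lop a.+1 b = Lop a b * E a - v *: (E a * Lop a b).
Proof. by move=> ba /=; rewrite ltn_eqF. Qed.

Lemma Lop_comm_hi a b k : (a < k)%N -> (k.+1 < n)%N -> Lop a b * E k = 1 *: (E k * Lop a b).
Proof.
move=> + kn; elim: a => [|a IHa] ak /=.
  case: eqP => _; last by rewrite mul0r mulr0 scaler0.
  by rewrite (qgl_KmE Rel) ?root_wt_other ?invr1 //; lia.
case: eqP => _.
  by rewrite (qgl_KmE Rel) ?root_wt_other ?invr1 //; lia.
have h1 := IHa (ltnW ak).
have h2 : E a * E k = 1 *: (E k * E a) by apply: (qgl_EE_far Rel); lia.
nc_sort K A (h1, (h2, tt)).
Qed.

Lemma Lop_comm_lo a b k : (k.+1 < b)%N -> (a < n)%N -> Lop a b * E k = 1 *: (E k * Lop a b).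
Proof.
move=> kb; elim: a => [|a IHa] an /=.
  by rewrite gtn_eqF 1?(leq_trans _ kb) // mul0r mulr0 scaler0.
case: eqP => e.
  by rewrite (qgl_KmE Rel) ?root_wt_other ?invr1 //; lia.
case: (ltnP a b) => ab.
  by rewrite Lop_eq0 // mul0r mulr0 scaler0 subr0 mul0r mulr0 scaler0.
have h1 := IHa (ltnW an).
have h2 : E a * E k = 1 *: (E k * E a) by apply: (qgl_EE_far Rel); lia.
nc_sort K A (h1, (h2, tt)).
Qed.

Lemma Lop_next_diag k : (k.+1 < n)%N -> Lop k.+1 k = (v^-1 - v) *: (E k * Km k).
Proof.
move=> kn; rewrite LopS // Lop_diag.
have h : Km k * E k = v^-1 *: (E k * Km k) by rewrite (qgl_KmE Rel) ?root_wtE // ltnW.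
nc_sort K A (h, tt).
Qed.

Lemma Lop_comm_next k b : (k.+1 < n)%N -> (b <= k)%N ->
  Lop k.+1 b * E k = v^-1 *: (E k * Lop k.+1 b).
Proof.
move=> kn bk; have := bk; rewrite leq_eqVlt => /orP[/eqP->|{}bk].
  rewrite Lop_next_diag //.
  have h : Km k * E k = v^-1 *: (E k * Km k) by rewrite (qgl_KmE Rel) ?root_wtE // ltnW.
  nc_sort K A (h, tt).
case: k kn bk => // k kn bk.
rewrite (@LopS k.+1) 1?ltnW // (@LopS k) //.
have h := @Lop_comm_hi k b k.+1 (leqnn _) kn.
have S := @qgl_serreE _ _ _ _ Rel k.+1 k kn (ltnW kn) ltac:(by rewrite eqxx).
move: S; set S := (X in X = 0) => S0.
apply/eqP; rewrite -subr_eq0; apply/eqP.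
(* After two steps of the recursion, the defect is the q-commutator of [Lop k b], which commutes
   with E_(k+1), and the Serre expression [S]. *)
transitivity (Lop k b * S - v *: (S * Lop k b)).
  rewrite /S; move: (Lop k b) (E k) (E k.+1) h => X e f h.
  nc_sort K A (h, tt).
by rewrite S0 mulr0 mul0r scaler0 subr0.
Qed.

(* Serre relations twice: [[X, E_k], E_k+1] with X commuting with E_k+1 and
   satisfying the Serre relation with E_k commutes with E_k. *)
Lemma Lop_comm_base k b : (k.+2 < n)%N -> (b <= k)%N ->
  Lop k.+2 b * E k = 1 *: (E k * Lop k.+2 b).
Proof.
move=> kn bk; have kn' := ltnW kn.
have S1 := @qgl_serreE _ _ _ _ Rel k k.+1 kn' kn ltac:(by rewrite eqxx orbT).
have [hX hS] : Lop k b * E k.+1 = 1 *: (E k.+1 * Lop k b) /\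
    Lop k.+1 b * E k = v^-1 *: (E k * Lop k.+1 b).
  by split; [apply: Lop_comm_hi|apply: Lop_comm_next].
move: hS; rewrite (@LopS k.+1) 1?leqW // (@LopS k) //.
move: S1 hX; set e := E k; set f := E k.+1; set X := Lop k b => S1 h.
set S := (X in X = 0) in S1.
move=> hS; set Y := X * e - v *: (e * X).
set Z := Y * e - v^-1 *: (e * Y).
have Z0 : Z = 0 by rewrite /Z hS subrr.
(* The combination below yields the commutator only up to the factor v + v^-1, which is cancelled in
   advance. *)
apply/eqP; rewrite -subr_eq0; apply/eqP; apply: (scalerI v_add_inv_neq0).
rewrite scaler0.
transitivity (Z * f - v ^+ 2 *: (f * Z) - X * S + v ^+ 2 *: (S * X)); last first.
  by rewrite Z0 S1 !(mulr0, mul0r, scaler0, subr0, addr0).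
rewrite /Z /Y /S; move: X e f h {Y Z Z0 hS S S1} => X e f h.
nc_sort K A (h, tt).
Qed.

Lemma Lop_comm_above a b k : (k.+1 < a)%N -> (a < n)%N -> (b <= k)%N ->
  Lop a b * E k = 1 *: (E k * Lop a b).
Proof.
elim: a => // a IHa; rewrite ltnS leq_eqVlt => /orP[/eqP<-|ka] an bk.
  exact: Lop_comm_base.
have h1 := IHa ka (ltnW an) bk.
have h2 : E a * E k = 1 *: (E k * E a) by apply: (qgl_EE_far Rel); lia.
rewrite LopS; last by lia.
nc_sort K A (h1, (h2, tt)).
Qed.

Local Notation kk k := (Kp k * Km k.+1).
Local Notation kki k := (Km k * Kp k.+1).

(** The column k + 1 of [Lop_E] in the rows below k + 1, the only case there in which an extra term
    appears. *)
Lemma Lop_next_above a k : (k.+1 < a)%N -> (a < n)%N ->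
  Lop a k * kk k + Lop a k.+1 * E k = E k * Lop a k.+1.
Proof.
elim: a => // a IHa; rewrite ltnS leq_eqVlt => /orP[/eqP<-|ka] an.
  have kn := ltnW an; have kn' := ltnW kn.
  rewrite (@LopS k.+1) // Lop_next_diag // Lop_next_diag //.
  have h1 : Km k * E k.+1 = 1 *: (E k.+1 * Km k).
    by rewrite (qgl_KmE Rel) ?root_wt_other ?invr1 //; lia.
  have h2 : Km k.+1 * E k = v *: (E k * Km k.+1).
    by rewrite (qgl_KmE Rel) ?root_wtE ?invrK.
  rewrite mulrA.
  (* The product K_k^-1 K_k is isolated by hand, as the rules of [nc_sort] only permute letters and
     cannot cancel inverses. *)
  transitivity ((v^-1 - v) *: ((E k * E k.+1 - v *: (E k.+1 * E k)) * (Km k * Kp k) * Km k.+1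
     + E k.+1 * Km k.+1 * E k)); first by nc_sort K A (h1, tt).
  rewrite (qgl_KmKp Rel) //.
  nc_sort K A (h2, tt).
have IH := IHa ka (ltnW an).
have h1 : E a * E k = 1 *: (E k * E a) by apply: (qgl_EE_far Rel); lia.
have h2 : Kp k * E a = 1 *: (E a * Kp k).
  by rewrite (qgl_KpE Rel) ?root_wt_other //; lia.
have h3 : Km k.+1 * E a = 1 *: (E a * Km k.+1).
  by rewrite (qgl_KmE Rel) ?root_wt_other ?invr1 //; lia.
rewrite !LopS; try lia.
transitivity ((Lop a k * kk k + Lop a k.+1 * E k) * E a
   - v *: (E a * (Lop a k * kk k + Lop a k.+1 * E k))).
  nc_sort K A (h1, (h2, (h3, tt))).
rewrite IH; nc_sort K A (h1, tt).
Qed.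

(** Entry (a, b) of L Delta(E_k) = Delta^op(E_k) L in End(V) (x) A. The terms with [b == k.+1] and
    [a == k] come from the matrix unit by which E_k acts on V, and [root_wt a k] is the eigenvalue
    of K_k K_(k+1)^-1 on the a-th basis vector. *)
Lemma Lop_E a b k : (a < n)%N -> (k.+1 < n)%N ->
  (b == k.+1)%:R *: (Lop a k * kk k) + Lop a b * E k =
  root_wt a k *: (E k * Lop a b) + (a == k)%:R *: Lop k.+1 b.
Proof.
move=> an kn; have kn' := ltnW kn.
have [ak|ka|->] := ltngtP a k.
- rewrite (@Lop_eq0 a k) // mul0r scaler0 add0r scale0r addr0.
  by rewrite Lop_comm_hi // root_wt_other //; lia.
- rewrite scale0r addr0; have [ea|ne] := eqVneq a k.+1.
    subst a; rewrite root_wt_next.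
    have [bk|bk|->] := ltngtP b k.+1.
    + by rewrite scale0r add0r Lop_comm_next.
    + by rewrite scale0r Lop_eq0 // mul0r mulr0 scaler0 addr0.
    rewrite Lop_diag Lop_next_diag // scale1r mulrA.
    rewrite -!scalerAl -[E k * Km k * Kp k]mulrA (qgl_KmKp Rel) // mulr1.
    have h : Km k.+1 * E k = v *: (E k * Km k.+1).
      by rewrite (qgl_KmE Rel) ?root_wtE ?invrK.
    nc_sort K A (h, tt).
  rewrite root_wt_other; try lia.
  have [bk|bk|->] := ltngtP b k.+1.
  + rewrite scale0r add0r; apply: Lop_comm_above => //; lia.
  + by rewrite scale0r add0r Lop_comm_lo.
  by rewrite !scale1r Lop_next_above //; lia.
rewrite ?eqxx !scale1r root_wt_same.
have [bk|bk|->] := ltngtP b k.+1.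
- by rewrite scale0r add0r LopS // addrC subrK.
- by rewrite scale0r !Lop_eq0 ?(ltnW bk) // mul0r mulr0 scaler0 addr0.
rewrite scale1r !Lop_diag Lop_eq0 // mul0r mulr0 scaler0 addr0 add0r.
by rewrite mulrA (qgl_KmKp Rel) // mul1r.
Qed.

Lemma eps_wt_neq0 i k : eps_wt i k != 0.
Proof. by rewrite /eps_wt; case: ifP; rewrite ?oner_neq0. Qed.

Lemma Lop_Kp i a b : (i < n)%N -> (a < n)%N ->
  Kp i * Lop a b = (eps_wt i b / eps_wt i a) *: (Lop a b * Kp i).
Proof.
move=> iN; elim: a b => [|a IHa] b an.
  case: b => [|b]; last by rewrite Lop_eq0 // mul0r mulr0 scaler0.
  by rewrite Lop_diag divff ?eps_wt_neq0 // (qgl_KpKm_comm Rel).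
have [ab|ba|<-] := ltngtP a.+1 b.
- by rewrite Lop_eq0 // mul0r mulr0 scaler0.
- have h := IHa b (ltnW an).
  have h' := qgl_KpE Rel iN an.
  have -> : eps_wt i b / eps_wt i a.+1 = (eps_wt i b / eps_wt i a) * root_wt i a.
    by rewrite mulrA divfK ?eps_wt_neq0.
  rewrite LopS //; move: (_ / _) (root_wt i a) h h' => c r h h'.
  nc_sort K A (h, (h', tt)).
by rewrite Lop_diag divff ?eps_wt_neq0 // (qgl_KpKm_comm Rel).
Qed.

Lemma Km_swap i x c : (i < n)%N -> c != 0 -> Kp i * x = c *: (x * Kp i) ->
  Km i * x = c^-1 *: (x * Km i).
Proof.
move=> iN c0 h.
have h' : x * Kp i = c^-1 *: (Kp i * x) by rewrite h scalerA mulVf // scale1r.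
have {1}-> : x = x * Kp i * Km i by rewrite -mulrA (qgl_KpKm Rel) // mulr1.
by rewrite h' -scalerAl -scalerAr !mulrA (qgl_KmKp Rel) // mul1r.
Qed.

Lemma Lop_Km i a b : (i < n)%N -> (a < n)%N ->
  Km i * Lop a b = (eps_wt i b / eps_wt i a)^-1 *: (Lop a b * Km i).
Proof.
move=> iN an; apply: Km_swap => //; last exact: Lop_Kp.
by rewrite mulf_neq0 ?invr_neq0 ?eps_wt_neq0.
Qed.

(** Entry (a, b) of L Delta(F_k) = Delta^op(F_k) L. The induction on the row rests on [E_a, F_k] for
    the factor E_a appended last. *)
Lemma Lop_F a b k : (a < n)%N -> (k.+1 < n)%N ->
  (b == k)%:R *: Lop a k.+1 + (root_wt b k)^-1 *: (Lop a b * F k) =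
  F k * Lop a b + (a == k.+1)%:R *: (kki k * Lop k b).
Proof.
elim: a b => [|a IHa] b an kn; have kn' := ltnW kn.
  rewrite Lop_eq0 // scaler0 add0r scale0r addr0.
  case: b => [|b]; last by rewrite Lop_eq0 // mul0r mulr0 scaler0.
  rewrite Lop_diag (qgl_KmF Rel) // scalerA mulVf ?scale1r //.
  by rewrite mulf_neq0 ?invr_neq0 ?eps_wt_neq0.
have [ab|ba|<-] := ltngtP a.+1 b.
- rewrite (@Lop_eq0 a.+1 b) //.
  rewrite mul0r mulr0 scaler0 addr0 add0r.
  have -> : (b == k)%:R *: Lop a.+1 k.+1 = 0.
    have [bk|bk] := eqVneq b k; last by rewrite scale0r.
    by rewrite Lop_eq0 ?scaler0 //; lia.
  have [ak|ak] := eqVneq a.+1 k.+1; last by rewrite scale0r.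
  by rewrite Lop_eq0 ?mulr0 ?scaler0 //; lia.
- have EF := qgl_EF Rel an kn.
  have [ak|nak] := eqVneq a k.
    subst a; rewrite !eqxx scale1r in EF *.
    have [bk|nbk] := eqVneq b k.
      subst b; rewrite scale1r root_wt_same !Lop_diag Lop_next_diag //.
      have h : Km k * F k = v *: (F k * Km k) by rewrite (qgl_KmF Rel) ?root_wtE.
      have {}EF : E k * F k = F k * E k + (v - v^-1)^-1 *: (kk k - kki k).
        by rewrite -EF addrC subrK.
      transitivity (Km k.+1 + (v^-1 - v) *: (E k * F k) * Km k).
        nc_sort K A (h, tt).
      rewrite EF.
      have c1 := qgl_KmKm Rel kn kn'.
      have c2 : Kp k.+1 * Km k = 1 *: (Km k * Kp k.+1) by rewrite (qgl_KpKm_comm Rel).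
      transitivity (Km k.+1 + (v^-1 - v) *: (F k * E k * Km k) - (Kp k * Km k) * Km k.+1 + Km k * Kp k.+1 * Km k).
        nc_sort K A (c1, tt).
      rewrite (qgl_KpKm Rel) //.
      nc_sort K A (c2, tt).
    rewrite scale0r add0r root_wt_other ?invr1 ?scale1r //; last by lia.
    have bk : (b < k)%N by lia.
    have h : Lop k b * F k = 1 *: (F k * Lop k b).
      have := IHa b kn' kn; rewrite (negPf nbk) scale0r add0r root_wt_other //; last by lia.
      by rewrite invr1 !scale1r ltn_eqF // scale0r addr0.
    have h1 : Kp k * Lop k b = v^-1 *: (Lop k b * Kp k).
      by rewrite Lop_Kp // /eps_wt eqxx gtn_eqF // div1r.
    have h2 : Km k.+1 * Lop k b = 1 *: (Lop k b * Km k.+1).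
      by rewrite Lop_Km // /eps_wt !gtn_eqF ?divr1 ?invr1 //; lia.
    have h3 : Km k * Lop k b = v *: (Lop k b * Km k).
      by rewrite Lop_Km // /eps_wt eqxx gtn_eqF // div1r invrK.
    have h4 : Kp k.+1 * Lop k b = 1 *: (Lop k b * Kp k.+1).
      by rewrite Lop_Kp // /eps_wt !gtn_eqF ?divr1 ?invr1 //; lia.
    rewrite (@LopS k) //.
    apply/eqP; rewrite -subr_eq0; apply/eqP.
    (* For b < k the operator [Lop k b] commutes with F_k by induction, so that only [E_k, F_k]
       remains; the torus elements then produce the extra term. *)
    transitivity (Lop k b * (E k * F k - F k * E k) - v *: ((E k * F k - F k * E k) * Lop k b) - kki k * Lop k b).
      nc_sort K A (h, tt).
    rewrite EF; nc_sort K A (h1, (h2, (h3, (h4, tt)))).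
  rewrite (negPf nak) in EF.
  have {}EF : E a * F k = 1 *: (F k * E a).
    by apply/eqP; rewrite scale1r -subr_eq0 EF.
  have IH := IHa b (ltnW an) kn.
  rewrite eqSS (negPf nak) scale0r addr0 (@LopS a b) //.
  set lhs := _ + _ in IH.
  transitivity (lhs * E a - v *: (E a * lhs)).
    rewrite /lhs; have [bk|bk] := eqVneq b k.
      rewrite (@LopS a k.+1); last by lia.
      nc_sort K A (EF, tt).
    rewrite !scale0r; nc_sort K A (EF, tt).
  rewrite IH; have [ak|nak'] := eqVneq a k.+1; last first.
    by rewrite !scale0r; nc_sort K A (EF, tt).
  (* The extra term of row k + 1 has to vanish in row k + 2: it passes E_(k+1) with exactly the
     factor v of the q-commutator. *)
  subst a; have h1 : Kp k.+1 * E k.+1 = v *: (E k.+1 * Kp k.+1).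
    by rewrite (qgl_KpE Rel) ?root_wtE.
  have h2 : Km k * E k.+1 = 1 *: (E k.+1 * Km k).
    by rewrite (qgl_KmE Rel) ?root_wt_other ?invr1 //; lia.
  have h3 : Lop k b * E k.+1 = 1 *: (E k.+1 * Lop k b) by apply: Lop_comm_hi.
  nc_sort K A (EF, (h1, (h2, (h3, tt)))).
rewrite Lop_diag (qgl_KmF Rel) // scalerA mulVf ?scale1r; last first.
  by rewrite mulf_neq0 ?invr_neq0 ?eps_wt_neq0.
have [ak|nak] := eqVneq a.+1 k.
  by rewrite Lop_eq0 ?scaler0 ?add0r ?ltn_eqF ?scale0r ?addr0 //; lia.
rewrite scale0r add0r; have [ak|_] := eqVneq a.+1 k.+1.
  by rewrite Lop_eq0 ?mulr0 ?scaler0 ?addr0 //; lia.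
by rewrite scale0r addr0.
Qed.

End LOperators.

(** * The converse algebra and the Casimir element *)

HB.instance Definition _ (K : fieldType) (A : algType K) :=
  GRing.Lmodule.copy A^c A.
HB.instance Definition _ (K : fieldType) (A : algType K) :=
  GRing.Lmodule_isLalgebra.Build K A^c
    (fun c (x y : A^c) => scalerAr c (y : A) (x : A)).
HB.instance Definition _ (K : fieldType) (A : algType K) :=
  GRing.Lalgebra_isAlgebra.Build K A^c
    (fun c (x y : A^c) => scalerAl c (y : A) (x : A)).

Section Casimir.
Variables (K : fieldType) (v : K) (A : algType K) (n : nat).
Hypotheses (v_neq0 : v != 0) (v_sqr_sub_neq0 : v * v - 1 != 0).
Hypothesis v_sqr_add_neq0 : v * v + 1 != 0.
Variables E F Kp Km : nat -> A.
Hypothesis Rel : qgl_rels v n E F Kp Km.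

Lemma q_comm_inv (c : K) (x y : A) : c != 0 -> x * y = c *: (y * x) ->
  y * x = c^-1 *: (x * y).
Proof. by move=> c0 ->; rewrite scalerA mulVf // scale1r. Qed.

Lemma root_wt_neq0 i k : root_wt v i k != 0.
Proof. by rewrite mulf_neq0 ?invr_neq0 ?eps_wt_neq0. Qed.

(** The relations are invariant under reversing all products and exchanging E with F. So each
    statement about L-operators has a mirror image, which is read off from the converse algebra for
    [Nop]. *)
Lemma qgl_converse : @qgl_rels K v A^c n F E Kp Km.
Proof.
have n0 := root_wt_neq0; have n1 i k : (root_wt v i k)^-1 != 0 by rewrite invr_neq0.
split.
- exact: (qgl_KmKp Rel).
- exact: (qgl_KpKm Rel).
- by move=> i j iN jN; exact: (qgl_KmKm Rel jN iN).
- move=> i j iN jN; have := q_comm_inv (oner_neq0 K) (qgl_KpKm_comm Rel iN jN).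
  by rewrite invr1.
- by move=> i j iN jN; exact: (qgl_KpKp Rel jN iN).
- move=> i k iN kN; have := q_comm_inv (n1 i k) (qgl_KpF Rel iN kN).
  by rewrite invrK.
- move=> i k iN kN; exact: q_comm_inv (n0 i k) (qgl_KmF Rel iN kN).
- move=> i k iN kN; exact: q_comm_inv (n0 i k) (qgl_KpE Rel iN kN).
- move=> i k iN kN; have := q_comm_inv (n1 i k) (qgl_KmE Rel iN kN).
  by rewrite invrK.
- move=> j k jN kN; rewrite -[LHS]/(E k * F j - F j * E k) (qgl_EF Rel) //.
  rewrite eq_sym; case: eqP => // ->; rewrite -[RHS]/(_ *: (Km k.+1 * Kp k - Kp k.+1 * Km k)).
  by rewrite !(qgl_KpKm_comm Rel) ?scale1r // ltnW.
- move=> j k jN kN h; exact: (qgl_FF_far Rel kN jN (ltac:(by rewrite orbC))).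
- move=> j k jN kN h; exact: (qgl_EE_far Rel kN jN (ltac:(by rewrite orbC))).
- move=> j k jN kN h; rewrite -[RHS](qgl_serreF Rel jN kN h).
  rewrite -[LHS]/(F k * F j ^+ 2 - (v + v^-1) *: (F j * (F k * F j)) + F j ^+ 2 * F k).
  nc_ring K A.
- move=> j k jN kN h; rewrite -[RHS](qgl_serreE Rel jN kN h).
  rewrite -[LHS]/(E k * E j ^+ 2 - (v + v^-1) *: (E j * (E k * E j)) + E j ^+ 2 * E k).
  nc_ring K A.
Qed.

Local Notation L := (Lop v E Km).
Definition Nop (a b : nat) : A := @Lop K v A^c F Km a b.
(** The transpose of [Nop], twisted by K_b and K_a^-1: the twist moves the torus factors of the
    mirrored relations to where Delta(x) M = M Delta^op(x) requires them. *)
Definition Mop (b a : nat) : A := Kp b * Nop a b * Km a.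

Local Notation kk k := (Kp k * Km k.+1).
Local Notation kki k := (Km k * Kp k.+1).

Lemma Nop_diag a : Nop a a = Km a. Proof. exact: (@Lop_diag K v A^c). Qed.

Lemma Nop_eq0 a b : (a < b)%N -> Nop a b = 0. Proof. exact: (@Lop_eq0 K v A^c). Qed.

Lemma NopS a b : (b <= a)%N -> Nop a.+1 b = F a * Nop a b - v *: (Nop a b * F a).
Proof. exact: (@LopS K v A^c). Qed.

Lemma Nop_F a b k : (a < n)%N -> (k.+1 < n)%N ->
  (b == k.+1)%:R *: (Km k.+1 * Kp k * Nop a k) + F k * Nop a b =
  root_wt v a k *: (Nop a b * F k) + (a == k)%:R *: Nop k.+1 b.
Proof. exact: (Lop_E v_neq0 v_sqr_sub_neq0 v_sqr_add_neq0 qgl_converse). Qed.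

Lemma Nop_E a b k : (a < n)%N -> (k.+1 < n)%N ->
  (b == k)%:R *: Nop a k.+1 + (root_wt v b k)^-1 *: (E k * Nop a b) =
  Nop a b * E k + (a == k.+1)%:R *: (Nop k b * (Kp k.+1 * Km k)).
Proof. exact: (Lop_F v_neq0 v_sqr_sub_neq0 v_sqr_add_neq0 qgl_converse). Qed.

Lemma Nop_Kp i a b : (i < n)%N -> (a < n)%N ->
  Kp i * Nop a b = (eps_wt v i a / eps_wt v i b) *: (Nop a b * Kp i).
Proof.
move=> iN aN; have := Lop_Kp v_neq0 qgl_converse (i := i) (a := a) b iN aN.
move/q_comm_inv => ->; rewrite ?invf_div //.
by rewrite mulf_neq0 ?invr_neq0 ?eps_wt_neq0.
Qed.

(** Entry (b, a) of Delta(E_k) M = M Delta^op(E_k): M intertwines in the direction opposite to L. *)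
Lemma Mop_E a b k : (a < n)%N -> (b < n)%N -> (k.+1 < n)%N ->
  (b == k)%:R *: (kk k * Mop k.+1 a) + E k * Mop b a =
  root_wt v a k *: (Mop b a * E k) + (a == k.+1)%:R *: Mop b k.
Proof.
move=> aN bN kN; have kN' := ltnW kN.
have h1 := qgl_KpE Rel bN kN; have h2 := qgl_KmE Rel aN kN.
have r0 := root_wt_neq0.
have := congr1 (fun x => Kp b * x * Km a) (Nop_E b aN kN).
rewrite !(mulrDl, mulrDr).
have -> : Kp b * ((root_wt v b k)^-1 *: (E k * Nop a b)) * Km a = E k * Mop b a.
  rewrite /Mop; move: (root_wt v b k) (r0 b k) h1 => r r1 h1; nc_sort K A (h1, tt).
have -> : Kp b * (Nop a b * E k) * Km a = root_wt v a k *: (Mop b a * E k).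
  rewrite /Mop; move: (root_wt v a k) (r0 a k) h2 => r r1 h2; nc_sort K A (h2, tt).
have -> : Kp b * ((b == k)%:R *: Nop a k.+1) * Km a = (b == k)%:R *: (kk k * Mop k.+1 a).
  case: eqP => [->|_]; last by rewrite !(scale0r, mulr0, mul0r).
  rewrite !scale1r /Mop !mulrA -[Kp k * Km k.+1 * Kp k.+1]mulrA.
  by rewrite (qgl_KmKp Rel) // mulr1.
move=> ->; congr (_ + _); case: eqP => [->|_]; last by rewrite !(scale0r, mulr0, mul0r).
rewrite !scale1r /Mop.
have := qgl_KpKm_comm Rel kN kN'; rewrite scale1r => ->.
by rewrite !mulrA -mulrA (qgl_KpKm Rel) // mulr1.
Qed.

Lemma Mop_F a b k : (a < n)%N -> (b < n)%N -> (k.+1 < n)%N ->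
  (b == k.+1)%:R *: Mop k a + (root_wt v b k)^-1 *: (F k * Mop b a) =
  Mop b a * F k + (a == k)%:R *: (Mop b k.+1 * kki k).
Proof.
move=> aN bN kN; have kN' := ltnW kN.
have h1 := qgl_KpF Rel bN kN; have h2 := qgl_KmF Rel aN kN.
have r0 := root_wt_neq0.
have := congr1 (fun x => Kp b * x * Km a) (Nop_F b aN kN).
rewrite !(mulrDl, mulrDr).
have -> : Kp b * (F k * Nop a b) * Km a = (root_wt v b k)^-1 *: (F k * Mop b a).
  rewrite /Mop; move: (root_wt v b k) (r0 b k) h1 => r r1 h1; nc_sort K A (h1, tt).
have -> : Kp b * (root_wt v a k *: (Nop a b * F k)) * Km a = Mop b a * F k.
  rewrite /Mop; move: (root_wt v a k) (r0 a k) h2 => r r1 h2.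
  have h3 : F k * Km a = r^-1 *: (Km a * F k) by apply: q_comm_inv.
  nc_sort K A (h3, tt).
have -> : Kp b * ((b == k.+1)%:R *: (Km k.+1 * Kp k * Nop a k)) * Km a = (b == k.+1)%:R *: Mop k a.
  case: eqP => [->|_]; last by rewrite !(scale0r, mulr0, mul0r).
  by rewrite !scale1r /Mop !mulrA (qgl_KpKm Rel) // mul1r.
move=> ->; congr (_ + _); case: eqP => [->|_]; last by rewrite !(scale0r, mulr0, mul0r).
rewrite !scale1r /Mop.
have := qgl_KmKm Rel kN kN'; rewrite scale1r => c.
rewrite -!mulrA [Km k.+1 * _]mulrA c -mulrA (qgl_KmKp Rel) // mulr1.
by rewrite !mulrA.
Qed.

(** The matrix M L, which commutes with Delta(E_k) and Delta(F_k); [Xop_E] and [Xop_F] state this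
    entry by entry. *)
Definition Xop (b a : nat) : A := \sum_(c < n) Mop b c * L c a.

Lemma sum_delta (V : lmodType K) (f : nat -> V) k : (k < n)%N ->
  \sum_(c < n) (c == k :> nat)%:R *: f c = f k.
Proof.
move=> kn; rewrite (bigD1 (Ordinal kn)) //= eqxx scale1r big1 ?addr0 // => c.
by rewrite -val_eqE /= => /negPf ->; rewrite scale0r.
Qed.

Lemma Xop_E a b k : (a < n)%N -> (b < n)%N -> (k.+1 < n)%N ->
  (b == k)%:R *: (kk k * Xop k.+1 a) + E k * Xop b a =
  (a == k.+1)%:R *: (Xop b k * kk k) + Xop b a * E k.
Proof.
move=> aN bN kN; have kN' := ltnW kN.
rewrite /Xop !mulr_sumr !mulr_suml !scaler_sumr -!big_split /=.
transitivity (\sum_(c < n) ((root_wt v c k *: (Mop b c * E k * L c a)) +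
     (c == k.+1 :> nat)%:R *: (Mop b k * L c a))).
  apply: eq_bigr => c _; have := congr1 (fun x => x * L c a) (Mop_E (ltn_ord c) bN kN).
  rewrite !mulrDl -!scalerAl -!mulrA => <-; by rewrite !mulrA.
(* Both sums contain the product [Mop b k * L k.+1 a]; moving it from the summand k + 1 to the
   summand k makes [Lop_E] applicable term by term. *)
transitivity (\sum_(c < n) ((root_wt v c k *: (Mop b c * E k * L c a)) +
     (c == k :> nat)%:R *: (Mop b c * L k.+1 a))).
  rewrite !big_split /= (sum_delta (fun c => Mop b k * L c a)) //.
  by rewrite (sum_delta (fun c => Mop b c * L k.+1 a)).
apply: eq_bigr => c _.
have := congr1 (fun x => Mop b c * x) (Lop_E v_neq0 v_sqr_sub_neq0 v_sqr_add_neq0 Rel a (ltn_ord c) kN).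
by rewrite !mulrDr -!scalerAr !mulrA => <-.
Qed.

Lemma Xop_F a b k : (a < n)%N -> (b < n)%N -> (k.+1 < n)%N ->
  (b == k.+1)%:R *: Xop k a + (root_wt v b k)^-1 *: (F k * Xop b a) =
  (a == k)%:R *: Xop b k.+1 + (root_wt v a k)^-1 *: (Xop b a * F k).
Proof.
move=> aN bN kN; have kN' := ltnW kN.
rewrite /Xop !mulr_sumr !mulr_suml !scaler_sumr -!big_split /=.
transitivity (\sum_(c < n) (Mop b c * F k * L c a +
     (c == k :> nat)%:R *: (Mop b k.+1 * kki k * L c a))).
  apply: eq_bigr => c _; have := congr1 (fun x => x * L c a) (Mop_F (ltn_ord c) bN kN).
  rewrite !mulrDl -!scalerAl -!mulrA => <-; by rewrite !mulrA.
transitivity (\sum_(c < n) (Mop b c * F k * L c a +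
     (c == k.+1 :> nat)%:R *: (Mop b c * kki k * L k a))).
  rewrite !big_split /= (sum_delta (fun c => Mop b k.+1 * kki k * L c a)) //.
  by rewrite (sum_delta (fun c => Mop b c * kki k * L k a)).
apply: eq_bigr => c _.
have := congr1 (fun x => Mop b c * x) (Lop_F v_neq0 v_sqr_sub_neq0 v_sqr_add_neq0 Rel a (ltn_ord c) kN).
by rewrite !mulrDr -!scalerAr !mulrA => <-.
Qed.

Lemma Xop_Kp i a b : (i < n)%N -> (b < n)%N ->
  Kp i * Xop b a = (eps_wt v i a / eps_wt v i b) *: (Xop b a * Kp i).
Proof.
move=> iN bN; rewrite /Xop mulr_sumr mulr_suml scaler_sumr.
apply: eq_bigr => c _; rewrite /Mop.
have h1 := Lop_Kp v_neq0 Rel a iN (ltn_ord c).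
have h2 := Nop_Kp b iN (ltn_ord c).
have h3 := qgl_KpKp Rel iN bN; have h4 := qgl_KpKm_comm Rel iN (ltn_ord c).
have := eps_wt_neq0 v_neq0 i c; have := eps_wt_neq0 v_neq0 i b.
move: (eps_wt v i c) (eps_wt v i a) (eps_wt v i b) h1 h2 => x y z h1 h2 x0 z0.
nc_sort K A (h1, (h2, (h3, (h4, tt)))).
Qed.

Lemma kk_swap x (p q : K) k : (k.+1 < n)%N -> p != 0 -> q != 0 ->
  Kp k * x = p *: (x * Kp k) -> Kp k.+1 * x = q *: (x * Kp k.+1) ->
  kk k * x = (p / q) *: (x * kk k).
Proof.
move=> kN p0 q0 h1 /(Km_swap Rel kN q0) h2.
nc_sort K A (h1, (h2, tt)).
Qed.

Definition casimir : A := \sum_(i < n) v ^+ (2 * i) *: Xop i i.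

Lemma casimir_Kp i : (i < n)%N -> Kp i * casimir = casimir * Kp i.
Proof.
move=> iN; rewrite mulr_sumr mulr_suml; apply: eq_bigr => j _.
by rewrite -scalerAr Xop_Kp // divff ?eps_wt_neq0 // scale1r scalerAl.
Qed.

Lemma casimir_E k : (k.+1 < n)%N -> E k * casimir = casimir * E k.
Proof.
move=> kN; have kN' := ltnW kN; rewrite mulr_sumr mulr_suml.
apply: (@addrI _ (v ^+ (2 * k) *: (kk k * Xop k.+1 k))).
transitivity (\sum_(i < n) v ^+ (2 * i) *: ((i == k :> nat)%:R *: (kk k * Xop k.+1 i) + E k * Xop i i)).
  rewrite -(sum_delta (fun i => v ^+ (2 * i) *: (kk k * Xop k.+1 i)) kN') -big_split /=.
  by apply: eq_bigr => i _; rewrite scalerDr scalerA mulrC -scalerA -scalerAr.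
transitivity (\sum_(i < n) v ^+ (2 * i) *: ((i == k.+1 :> nat)%:R *: (Xop i k * kk k) + Xop i i * E k)).
  by apply: eq_bigr => i _; rewrite Xop_E.
(* Moving K_k K_(k+1)^-1 across [Xop k.+1 k] costs v / v^-1 = v^2, the quotient of consecutive
   coefficients of [casimir]. *)
have -> : v ^+ (2 * k) *: (kk k * Xop k.+1 k) = v ^+ (2 * k.+1) *: (Xop k.+1 k * kk k).
  rewrite (@kk_swap _ v v^-1) ?invr_neq0 //.
  - by rewrite scalerA invrK mulnS exprD [in RHS]mulrC expr2.
  - by rewrite Xop_Kp // /eps_wt eqxx ltn_eqF // divr1.
  - by rewrite Xop_Kp // /eps_wt eqxx gtn_eqF // div1r.
rewrite -(sum_delta (fun i => v ^+ (2 * i) *: (Xop i k * kk k)) kN) -big_split /=.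
by apply: eq_bigr => i _; rewrite scalerDr scalerA mulrC -scalerA -scalerAl.
Qed.

Lemma casimir_F k : (k.+1 < n)%N -> F k * casimir = casimir * F k.
Proof.
move=> kN; have kN' := ltnW kN; rewrite mulr_sumr mulr_suml.
have d0 i : root_wt v i k = (if i == k then v else if i == k.+1 then v^-1 else 1).
  have [->|ik] := eqVneq i k; first by rewrite root_wt_same.
  have [->|ik'] := eqVneq i k.+1; first by rewrite root_wt_next.
  by rewrite root_wt_other.
have kk1 : (k == k.+1) = false by rewrite ltn_eqF.
have kk2 : (k.+1 == k) = false by rewrite gtn_eqF.
have FX i : (i < n)%N -> F k * Xop i i = Xop i i * F k + (i == k)%:R *: (v *: Xop k k.+1)
    - (i == k.+1)%:R *: (v^-1 *: Xop k k.+1).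
  move=> iN; have := Xop_F iN iN kN; rewrite d0.
  have [->|ik] := eqVneq i k.
    rewrite kk1 !scale0r !scale1r add0r subr0 => h.
    rewrite -[LHS]scale1r -(divff v_neq0) -scalerA h scalerDr scalerA divff //.
    by rewrite scale1r addrC.
  have [->|ik'] := eqVneq i k.+1; last by rewrite !scale0r invr1 !scale1r !add0r subr0 addr0.
  rewrite !scale0r !scale1r add0r invrK addr0 => h.
  have {h} h : v *: (F k * Xop k.+1 k.+1) = v *: (Xop k.+1 k.+1 * F k) - Xop k k.+1.
    by rewrite -h addrC addKr.
  rewrite -[LHS]scale1r -(mulVf v_neq0) -scalerA h scalerBr scalerA mulVf //.
  by rewrite scale1r.
transitivity (\sum_(i < n) (v ^+ (2 * i) *: Xop i i * F k +
   (i == k :> nat)%:R *: ((v ^+ (2 * i) * v) *: Xop k k.+1) -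
   (i == k.+1 :> nat)%:R *: ((v ^+ (2 * i) * v^-1) *: Xop k k.+1))).
  apply: eq_bigr => i _; rewrite -scalerAr FX //.
  move: (v ^+ (2 * i)) (_ == k)%:R (_ == k.+1)%:R => c p q; nc_ring K A.
rewrite !big_split /= sumrN (sum_delta (fun i => (v ^+ (2 * i) * v) *: Xop k k.+1)) //.
rewrite (sum_delta (fun i => (v ^+ (2 * i) * v^-1) *: Xop k k.+1)) //.
have -> : v ^+ (2 * k.+1) * v^-1 = v ^+ (2 * k) * v.
  by rewrite mulnS exprD [v ^+ 2]expr2 mulrAC mulfK // mulrC.
rewrite addrK; apply: eq_bigr => i _; exact: esym.
Qed.

End Casimir.

(** * Algebras satisfying the relations of the q-Schur algebra *)

Definition lambda_wt n d (l : Lambda n d) (i : nat) : int :=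
  if insub i is Some j then weight l j else 0.

Section Weights.
Variables n d : nat.
Implicit Types l m : Lambda n d.

Lemma weight_inj : injective (@weight n d).
Proof.
move=> l m /ffunP E; apply: val_inj; apply/ffunP => j.
by have := E j; rewrite !ffunE => -[/val_inj].
Qed.

Lemma to_LambdaP w : (forall m, to_Lambda d w = Some m -> weight m = w) /\
  (forall m, weight m = w -> to_Lambda d w = Some m).
Proof.
rewrite /to_Lambda; case: pickP => [l /eqP <-|no]; split=> // m.
- by case=> ->.
- by move/weight_inj ->.
by move/eqP; rewrite no.
Qed.

Lemma to_Lambda_weight w m : to_Lambda d w = Some m -> weight m = w.
Proof. exact: (to_LambdaP w).1. Qed.

Lemma weight_to_Lambda w m : weight m = w -> to_Lambda d w = Some m.
Proof. exact: (to_LambdaP w).2. Qed.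

Lemma lambda_wt_ord l (j : 'I_n) : lambda_wt l j = (val l j : nat)%:Z.
Proof. by rewrite /lambda_wt valK ffunE. Qed.

Lemma lambda_wtD (i : 'I_n.-1) l m k : weight m = weight l + alpha i ->
  lambda_wt m k = lambda_wt l k + ((k == i)%:Z - (k == i.+1)%:Z).
Proof.
move=> E; rewrite /lambda_wt; case: insubP => [j jn jk|kn].
  by rewrite E !ffunE -jk.
have in1 : (i.+1 < n)%N := ltn_ord (nxt i).
by rewrite !gtn_eqF ?subr0 ?addr0 //; lia.
Qed.

(** The pairing with (n, n - 1, ..., 1), chosen such that adding a simple root adds exactly 1. *)
Definition hgt l : nat := \sum_(j < n) (n - j) * val l j.

Lemma hgtD (i : 'I_n.-1) l m : weight m = weight l + alpha i -> hgt m = (hgt l).+1.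
Proof.
move=> E.
have nat_wt j : ((val m j + (j == nxt i)) = val l j + (j == pos i))%N.
  have := congr1 (fun f : {ffun 'I_n -> int} => f j) E; rewrite !ffunE; lia.
have s1 (k : 'I_n) : (\sum_(j < n) (n - j) * (j == k) = n - k)%N.
  rewrite (bigD1 k) //= eqxx muln1 big1 ?addn0 // => j /negPf ->.
  by rewrite muln0.
have : (hgt m + (n - nxt i) = hgt l + (n - pos i))%N.
  rewrite /hgt -(s1 (nxt i)) -(s1 (pos i)) -!big_split /=.
  by apply: eq_bigr => j _; rewrite -!mulnDr nat_wt.
have := ltn_ord (nxt i); rewrite /=; lia.
Qed.

Lemma weight_addA (i : 'I_n.-1) l m : weight m = weight l - alpha i -> weight l = weight m + alpha i.
Proof. by move=> ->; rewrite subrK. Qed.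

Definition dominant l := forall i : 'I_n.-1, (val l (nxt i) <= val l (pos i))%N.

End Weights.

Section SchurAlgebra.
Variables (K : fieldType) (v : K) (A : algType K) (n d : nat).
Hypothesis v_generic : forall k : nat, (0 < k)%N -> v ^+ k != 1.
Hypothesis v_neq0 : v != 0.

Lemma vz_generic (m : int) : m != 0 -> v ^ m != 1.
Proof.
case: m => [m|m] m0; first by apply: v_generic; lia.
by rewrite NegzE -exprnN invr_eq1; exact: v_generic.
Qed.

Lemma qint_neq0 m : m != 0 -> qint v m != 0.
Proof.
move=> m0; rewrite mulf_neq0 ?invr_neq0 // subr_eq0.
  apply/eqP => /(congr1 (fun x => x * v ^ m)).
  rewrite -!expfzDr // addNr expr0z => /eqP; apply/negP/vz_generic; lia.
apply/eqP => /(congr1 (fun x => x * v)); rewrite mulVf // -expr2 => /eqP.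
exact/negP/v_generic.
Qed.

Lemma v_sqr_sub_neq0 : v * v - 1 != 0.
Proof. by rewrite subr_eq0 -expr2 v_generic. Qed.

Lemma v_sqr_add_neq0 : v * v + 1 != 0.
Proof.
apply/eqP => h; have /eqP := @v_generic 4 isT; apply.
have -> : v ^+ 4 = (v * v + 1) * (v * v - 1) + 1 by ring.
by rewrite h mul0r add0r.
Qed.

(** The relations in an arbitrary algebra: they are used both for the quotient of the free algebra
    and for the operators on the tensor power. *)
Record schur_alg (one : Lambda n d -> A) (E F : 'I_n.-1 -> A) : Prop := SchurAlg {
  sa_orth : forall l m, one l * one m = if l == m then one l else 0;
  sa_sum : \sum_l one l = 1;
  sa_E_one : forall i l, E i * one l =
    if to_Lambda d (weight l + alpha i) is Some m then one m * E i else 0;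
  sa_F_one : forall i l, F i * one l =
    if to_Lambda d (weight l - alpha i) is Some m then one m * F i else 0;
  sa_one_E : forall i l, one l * E i =
    if to_Lambda d (weight l - alpha i) is Some m then E i * one m else 0;
  sa_one_F : forall i l, one l * F i =
    if to_Lambda d (weight l + alpha i) is Some m then F i * one m else 0;
  sa_EF : forall i j, E i * F j - F j * E i =
    if i == j then \sum_l qint v (weight l (pos j) - weight l (nxt j)) *: one l
    else 0;
  sa_serreE : forall i j, adjacent i j ->
    E i ^+ 2 * E j - (v + v^-1) *: (E i * E j * E i) + E j * E i ^+ 2 = 0;
  sa_commE : forall i j, ~~ adjacent i j -> E i * E j - E j * E i = 0;
  sa_serreF : forall i j, adjacent i j ->
    F i ^+ 2 * F j - (v + v^-1) *: (F i * F j * F i) + F j * F i ^+ 2 = 0;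
  sa_commF : forall i j, ~~ adjacent i j -> F i * F j - F j * F i = 0
}.

Variables (one : Lambda n d -> A) (E F : 'I_n.-1 -> A).
Hypothesis Rel : schur_alg one E F.

Definition torus (f : Lambda n d -> K) : A := \sum_l f l *: one l.

Lemma torus1 : torus (fun _ => 1) = 1.
Proof. by rewrite -[RHS](sa_sum Rel); apply: eq_bigr => l _; rewrite scale1r. Qed.

Lemma torus_one f l : torus f * one l = f l *: one l.
Proof.
rewrite mulr_suml (bigD1 l) //= big1 ?addr0 => [|m /negPf ml].
  by rewrite -scalerAl (sa_orth Rel) eqxx.
by rewrite -scalerAl (sa_orth Rel) ml scaler0.
Qed.

Lemma one_torus f l : one l * torus f = f l *: one l.
Proof.
rewrite mulr_sumr (bigD1 l) //= big1 ?addr0 => [|m /negPf ml].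
  by rewrite -scalerAr (sa_orth Rel) eqxx.
by rewrite -scalerAr (sa_orth Rel) eq_sym ml scaler0.
Qed.

Lemma torusM f g : torus f * torus g = torus (fun l => f l * g l).
Proof.
rewrite [RHS]/torus /(torus g) mulr_sumr; apply: eq_bigr => l _.
by rewrite -scalerAr torus_one scalerA mulrC.
Qed.

Lemma sum_one_l x : x = \sum_l one l * x.
Proof. by rewrite -mulr_suml (sa_sum Rel) mul1r. Qed.

Lemma sum_one_r x : x = \sum_l x * one l.
Proof. by rewrite -mulr_sumr (sa_sum Rel) mulr1. Qed.

(** The idempotents split [x] into blocks, and only the pairs of weights joined by a nonzero block
    matter. *)
Lemma torus_swap (x : A) f g (c : K) :
  (forall l m, one m * x * one l != 0 -> f m = c * g l) ->
  torus f * x = c *: (x * torus g).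
Proof.
move=> h; rewrite [LHS]sum_one_r [x * torus g]sum_one_l scaler_sumr.
rewrite mulr_sumr; rewrite /torus.
transitivity (\sum_l \sum_m f m *: (one m * x * one l)).
  apply: eq_bigr => l _; rewrite !mulr_suml; apply: eq_bigr => m _.
  by rewrite -!scalerAl.
rewrite exchange_big /=.
transitivity (\sum_m \sum_l (c * g l) *: (one m * x * one l)).
  apply: eq_bigr => m _; apply: eq_bigr => l _.
  have [->|/h -> //] := eqVneq (one m * x * one l) 0; by rewrite !scaler0.
apply: eq_bigr => m _; rewrite !mulr_sumr scaler_sumr; apply: eq_bigr => l _.
by rewrite -!scalerAr scalerA mulrA.
Qed.

Lemma one_E_one i l m : one m * E i * one l != 0 -> weight m = weight l + alpha i.
Proof.
rewrite -mulrA (sa_E_one Rel); case C: to_Lambda => [p|]; last by rewrite mulr0 eqxx.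
rewrite mulrA (sa_orth Rel); have [->|_] := eqVneq m p; last by rewrite mul0r eqxx.
by rewrite (to_Lambda_weight C).
Qed.

Lemma one_F_one i l m : one m * F i * one l != 0 -> weight l = weight m + alpha i.
Proof.
rewrite -mulrA (sa_F_one Rel); case C: to_Lambda => [p|]; last by rewrite mulr0 eqxx.
rewrite mulrA (sa_orth Rel); have [->|_] := eqVneq m p; last by rewrite mul0r eqxx.
by rewrite (to_Lambda_weight C) subrK.
Qed.

Definition nat_ext (f : 'I_n.-1 -> A) (k : nat) : A :=
  if insub k is Some i then f i else 0.

Lemma nat_extE f (i : 'I_n.-1) : nat_ext f i = f i.
Proof. by rewrite /nat_ext valK. Qed.

Lemma nat_ext_ind (P : nat -> Prop) : (forall i : 'I_n.-1, P i) ->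
  forall k, (k.+1 < n)%N -> P k.
Proof.
move=> h k kn; have kn' : (k < n.-1)%N by rewrite ltn_predRL.
exact: (h (Ordinal kn')).
Qed.

Definition Kpos (i : nat) : A := torus (fun l => v ^ lambda_wt l i).
Definition Kneg (i : nat) : A := torus (fun l => v ^ (- lambda_wt l i)).

Lemma root_wt_exp i k : root_wt v i k = v ^ ((i == k)%:Z - (i == k.+1)%:Z).
Proof.
rewrite /root_wt /eps_wt expfzDr //; congr (_ * _); first by case: eqP.
by case: eqP; rewrite ?invr1 ?oppr0.
Qed.

(** With K_i the sum of the v^(l_i) 1_l, the relations of U_v(gl_n) hold, so that the Casimir
    element becomes available. *)
Lemma schur_qgl_rels : qgl_rels v n (nat_ext E) (nat_ext F) Kpos Kneg.
Proof.
have KK f g : torus f * torus g = 1 *: (torus g * torus f).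
  by rewrite scale1r !torusM; congr torus; apply/funext => l; rewrite mulrC.
split.
- move=> i _; rewrite torusM -torus1; congr torus; apply/funext => l.
  by rewrite -expfzDr // subrr.
- move=> i _; rewrite torusM -torus1; congr torus; apply/funext => l.
  by rewrite -expfzDr // addNr.
- by move=> *; exact: KK.
- by move=> *; exact: KK.
- by move=> *; exact: KK.
- move=> i k _; move: k; apply: nat_ext_ind => k; rewrite nat_extE.
  apply: torus_swap => l m /one_E_one /lambda_wtD ->.
  by rewrite root_wt_exp expfzDr // mulrC.
- move=> i k _; move: k; apply: nat_ext_ind => k; rewrite nat_extE.
  apply: torus_swap => l m /one_E_one /lambda_wtD ->.
  by rewrite root_wt_exp invr_expz -expfzDr // opprD addrC.
- move=> i k _; move: k; apply: nat_ext_ind => k; rewrite nat_extE.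
  apply: torus_swap => l m /one_F_one /lambda_wtD ->.
  by rewrite root_wt_exp invr_expz -expfzDr // addrCA addNr addr0.
- move=> i k _; move: k; apply: nat_ext_ind => k; rewrite nat_extE.
  apply: torus_swap => l m /one_F_one /lambda_wtD ->.
  by rewrite root_wt_exp -expfzDr // opprD addrCA subrr addr0.
- move=> j k jN; move: j jN k; apply: nat_ext_ind => j; apply: nat_ext_ind => k.
  rewrite !nat_extE (sa_EF Rel) val_eqE; have [jk|//] := eqVneq j k; subst j.
  rewrite !torusM /torus -sumrB scaler_sumr; apply: eq_bigr => l _.
  rewrite -scalerBl scalerA; congr (_ *: _).
  have -> : lambda_wt l k = weight l (pos k) by rewrite ffunE -lambda_wt_ord.
  have -> : lambda_wt l k.+1 = weight l (nxt k) by rewrite ffunE -lambda_wt_ord.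
  rewrite -!expfzDr // /qint mulrC opprB [- _ + _]addrC; congr (_ * _).
- move=> j k jN; move: j jN k; apply: nat_ext_ind => j; apply: nat_ext_ind => k h.
  rewrite !nat_extE scale1r; apply/eqP; rewrite -subr_eq0; apply/eqP.
  apply: (sa_commE Rel); rewrite /adjacent; lia.
- move=> j k jN; move: j jN k; apply: nat_ext_ind => j; apply: nat_ext_ind => k h.
  rewrite !nat_extE scale1r; apply/eqP; rewrite -subr_eq0; apply/eqP.
  apply: (sa_commF Rel); rewrite /adjacent; lia.
- move=> j k jN; move: j jN k; apply: nat_ext_ind => j; apply: nat_ext_ind => k h.
  by rewrite !nat_extE (sa_serreE Rel).
- move=> j k jN; move: j jN k; apply: nat_ext_ind => j; apply: nat_ext_ind => k h.
  by rewrite !nat_extE (sa_serreF Rel).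
Qed.

End SchurAlgebra.

(** * Injectivity *)

Section Kernel.
Variables (K : fieldType) (v : K) (A : algType K) (n d : nat).
Hypothesis v_generic : forall k : nat, (0 < k)%N -> v ^+ k != 1.
Hypothesis v_neq0 : v != 0.
Variables (one : Lambda n d -> A) (E F : 'I_n.-1 -> A).
Hypothesis Rel : schur_alg v one E F.

(** Generation in the form of an induction over words, whose letters are multiplied from the
    left. *)
Definition alg_generated := forall P : A -> Prop,
  P 1 -> (forall x y, P x -> P y -> P (x + y)) ->
  (forall (c : K) x, P x -> P (c *: x)) ->
  (forall l x, P x -> P (one l * x)) -> (forall i x, P x -> P (E i * x)) ->
  (forall i x, P x -> P (F i * x)) -> forall x, P x.

Hypothesis generated : alg_generated.

Definition left_ideal (N : A -> Prop) :=
  [/\ N 0, forall x y, N x -> N y -> N (x + y) & forall a x, N x -> N (a * x)].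

Lemma left_idealZ N (c : K) x : left_ideal N -> N x -> N (c *: x).
Proof. by case=> _ _ H Nx; rewrite -[x]mul1r scalerAl; apply: H. Qed.

Lemma left_idealB N x y : left_ideal N -> N x -> N y -> N (x - y).
Proof.
move=> HN Nx Ny; have [_ HD _] := HN; apply: HD => //.
by rewrite -scaleN1r; apply: left_idealZ.
Qed.

Lemma left_ideal_sum N (I : finType) (f : I -> A) : left_ideal N ->
  (forall i, N (f i)) -> N (\sum_i f i).
Proof. by case=> N0 ND _ Hf; elim/big_ind: _ => //. Qed.

(* The left module generated by a highest weight vector modulo N. *)
Inductive hw_span (N : A -> Prop) (l : Lambda n d) : A -> Prop :=
| Hw_one : hw_span N l (one l)
| Hw_N x : N x -> hw_span N l x
| Hw_F i x : hw_span N l x -> hw_span N l (F i * x)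
| Hw_add x y : hw_span N l x -> hw_span N l y -> hw_span N l (x + y)
| Hw_scale (c : K) x : hw_span N l x -> hw_span N l (c *: x).

Lemma hw_span_one N l m x : left_ideal N -> hw_span N l x -> hw_span N l (one m * x).
Proof.
move=> HN; have [N0 ND NM] := HN; move=> H; elim: H m => {x} [|x Nx|i x _ IH|x y _ IHx _ IHy|c x _ IH] m.
- rewrite (sa_orth Rel); case: eqP => [->|_]; first exact: Hw_one.
  exact: Hw_N.
- exact/Hw_N/NM.
- rewrite mulrA (sa_one_F Rel); case: to_Lambda => [p|]; last by rewrite mul0r; apply: Hw_N.
  by rewrite -mulrA; apply: Hw_F.
- by rewrite mulrDr; apply: Hw_add.
- by rewrite -scalerAr; apply: Hw_scale.
Qed.

(** As [E_i, F_j] lies in the span of the idempotents, E_i can be moved through the F_j down to 1_l,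
    where it falls into [N]. *)
Lemma hw_span_E N l i x : left_ideal N -> (forall j, N (E j * one l)) ->
  hw_span N l x -> hw_span N l (E i * x).
Proof.
move=> HN HE; have [N0 ND NM] := HN; move=> H; elim: H i => {x} [|x Nx|j x Hx IH|x y _ IHx _ IHy|c x _ IH] i.
- exact/Hw_N.
- exact/Hw_N/NM.
- have -> : E i * (F j * x) = (E i * F j - F j * E i) * x + F j * (E i * x).
    by rewrite mulrBl !mulrA subrK.
  apply: Hw_add; last exact: Hw_F.
  rewrite (sa_EF Rel); case: eqP => _; last by rewrite mul0r; apply: Hw_N.
  rewrite mulr_suml; elim/big_ind: _ => [||m _]; first exact: Hw_N.
    exact: Hw_add.
  by rewrite -scalerAl; apply: Hw_scale; apply: hw_span_one.
- by rewrite mulrDr; apply: Hw_add.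
- by rewrite -scalerAr; apply: Hw_scale.
Qed.

Lemma hw_span_all N l a : left_ideal N -> (forall j, N (E j * one l)) ->
  hw_span N l (a * one l).
Proof.
move=> HN HE; move: a; apply: generated.
- by rewrite mul1r; apply: Hw_one.
- by move=> x y Hx Hy; rewrite mulrDl; apply: Hw_add.
- by move=> c x Hx; rewrite -scalerAl; apply: Hw_scale.
- by move=> m x Hx; rewrite -mulrA; apply: hw_span_one.
- by move=> i x Hx; rewrite -mulrA; apply: hw_span_E.
- by move=> i x Hx; rewrite -mulrA; apply: Hw_F.
Qed.

(** The tie-break by [enum_rank] makes the rank injective, so that each layer of the filtration is
    generated by a single idempotent; [hgt] dominates, so that simple roots still increase the
    rank. *)
Definition rank (l : Lambda n d) : nat := hgt l * #|{: Lambda n d}| + enum_rank l.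

Lemma rank_lt l m : (hgt l < hgt m)%N -> (rank l < rank m)%N.
Proof.
move=> lm; rewrite /rank; apply: leq_trans (_ : hgt m * #|{: Lambda n d}| <= _)%N; last exact: leq_addr.
apply: leq_trans (_ : (hgt l).+1 * #|{: Lambda n d}| <= _)%N; last by rewrite leq_mul2r lm orbT.
by rewrite mulSn addnC ltn_add2r ltn_ord.
Qed.

Lemma rank_inj : injective rank.
Proof.
move=> l m e; apply: enum_rank_inj; apply: val_inj => /=.
have := congr1 (modn^~ #|{: Lambda n d}|) e.
by rewrite /rank /= !modnMDl !modn_small.
Qed.

Inductive rank_ideal (r : nat) : A -> Prop :=
| Rank_gen a l b : (r <= rank l)%N -> rank_ideal r (a * one l * b)
| Rank_0 : rank_ideal r 0
| Rank_add x y : rank_ideal r x -> rank_ideal r y -> rank_ideal r (x + y).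

Lemma rank_ideal_left r : left_ideal (rank_ideal r).
Proof.
split; [exact: Rank_0 | exact: Rank_add |].
move=> c x; elim=> {x} [a l b rl||x y _ Hx _ Hy].
- by rewrite !mulrA; apply: Rank_gen.
- by rewrite mulr0; apply: Rank_0.
- by rewrite mulrDr; apply: Rank_add.
Qed.

Lemma rank_idealM r x c : rank_ideal r x -> rank_ideal r (x * c).
Proof.
elim=> {x} [a l b rl||x y _ Hx _ Hy].
- by rewrite -mulrA; apply: Rank_gen.
- by rewrite mul0r; apply: Rank_0.
- by rewrite mulrDl; apply: Rank_add.
Qed.

Local Notation Kp := (Kpos v one).
Local Notation Km := (Kneg v one).
Local Notation En := (nat_ext E).
Local Notation Fn := (nat_ext F).
Local Notation L := (Lop v En Km).
Local Notation N := (Nop v Fn Km).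
Local Notation M := (Mop v Fn Kp Km).
Local Notation X := (Xop v n En Fn Kp Km).
Local Notation z := (casimir v n En Fn Kp Km).

Let v2m := v_sqr_sub_neq0 v_generic.
Let v2p := v_sqr_add_neq0 v_generic.
Let QRel := schur_qgl_rels v_neq0 Rel.

Definition central_char (l : Lambda n d) : K :=
  \sum_(i < n) v ^+ (2 * i) * v ^ (- ((2 * val l i)%N : int)).

(** The Casimir element commutes with all K_i, and since v is not a root of unity, any two weights
    are told apart by some K_i; so it has no off-diagonal blocks. *)
Lemma casimir_one l : one l * z = z * one l.
Proof.
have off p q : p != q -> one p * z * one q = 0.
  move=> pq; have [i pqi] : exists i : 'I_n, val p i != val q i :> nat.
    apply: contrapT => h; case/eqP: pq; apply: val_inj; apply/ffunP => i.
    by apply: val_inj; apply/eqP; apply: contrapT => ne; apply: h; exists i; apply/negP.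
  have := congr1 (fun x => one p * x * one q) (casimir_Kp v_neq0 QRel (ltn_ord i)).
  rewrite !mulrA (one_torus Rel) // -mulrA -mulrA (torus_one Rel) // -!scalerAr mulrA => /eqP.
  rewrite -subr_eq0 -!scalerAl -scalerBl scaler_eq0 => /orP[|/eqP //].
  rewrite !lambda_wt_ord subr_eq0 => /eqP /(congr1 (fun x => x * v ^ (- ((val q i : nat) : int)))).
  rewrite -!expfzDr // subrr expr0z => /eqP; rewrite (negPf (vz_generic v_generic v_neq0 _)) //.
  by move: pqi; apply: contra_neq => /eqP; rewrite subr_eq0 => /eqP [->].
transitivity (one l * z * one l).
  rewrite [LHS](sum_one_r Rel) (bigD1 l) //= big1 ?addr0 // => m ml.
  by rewrite off // eq_sym.
rewrite [RHS](sum_one_l Rel) (bigD1 l) //= big1 ?addr0 ?mulrA // => m ml.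
by rewrite mulrA off.
Qed.

Lemma casimir_central x : x * z = z * x.
Proof.
move: x; apply: generated.
- by rewrite mul1r mulr1.
- by move=> x y Hx Hy; rewrite mulrDl mulrDr Hx Hy.
- by move=> c x Hx; rewrite -scalerAl -scalerAr Hx.
- by move=> l x Hx; rewrite -mulrA Hx !mulrA casimir_one.
- move=> i x Hx; rewrite -mulrA Hx !mulrA -(nat_extE E i).
  by rewrite (casimir_E v_neq0 v2m v2p QRel) //; have := ltn_ord (nxt i).
- move=> i x Hx; rewrite -mulrA Hx !mulrA -(nat_extE F i).
  by rewrite (casimir_F v_neq0 v2m v2p QRel) //; have := ltn_ord (nxt i).
Qed.

(** * Singular elements and sl_2-strings modulo a two-sided ideal *)

Section Modulo.
Variable J : A -> Prop.
Hypotheses (HJ : left_ideal J) (JM : forall x c, J x -> J (x * c)).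

Let J0 : J 0. Proof. by case: HJ. Qed.
Let JD x y : J x -> J y -> J (x + y). Proof. by case: HJ => _ H _; apply: H. Qed.
Let JL a x : J x -> J (a * x). Proof. by case: HJ => _ _; apply. Qed.
Let JZ (c : K) x : J x -> J (c *: x). Proof. exact: left_idealZ. Qed.
Let JB x y : J x -> J y -> J (x - y). Proof. exact: left_idealB. Qed.
Let JT y x w : J (x - y) -> J (y - w) -> J (x - w).
Proof. by move=> h1 h2; rewrite -[x](subrK y) -addrA; apply: JD. Qed.

(** By induction [Lop a b] maps [y] to a multiple of [y] modulo J, and in the next row both terms
    contain E_a applied to such a multiple. *)
Lemma Lop_singular l y a b : y = one l * y -> (forall i, J (E i * y)) ->
  (a < n)%N -> J (L a b * y - ((a == b)%:R * v ^ (- lambda_wt l b)) *: y).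
Proof.
move=> yl yE; have Ky i : Km i * y = v ^ (- lambda_wt l i) *: y.
  by rewrite yl mulrA (torus_one Rel) // scalerAl.
have yEn k : J (En k * y).
  by rewrite /nat_ext; case: insub => [i|]; rewrite ?mul0r.
elim: a => [|a IHa] an.
  case: b => [|b]; first by rewrite Lop_diag Ky mul1r subrr.
  by rewrite Lop_eq0 // !mul0r scale0r subrr.
have [ab|ba|<-] := ltngtP a.+1 b.
- by rewrite Lop_eq0 // !mul0r scale0r subrr.
- rewrite mul0r scale0r subr0 LopS // mulrBl -mulrA.
  apply: JB; first exact/JL.
  rewrite -scalerAl -mulrA; apply: JZ.
  have := IHa (ltnW an); move/(JL (En a)); rewrite mulrBr => /JD.
  move=> /(_ (En a * (((a == b)%:R * v ^ (- lambda_wt l b)) *: y))).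
  rewrite subrK; apply; rewrite -scalerAr; exact: JZ.
by rewrite Lop_diag Ky mul1r subrr.
Qed.

Lemma Nop_singular l y a b : y = y * one l -> (forall i, J (y * F i)) ->
  (a < n)%N -> J (y * N a b - ((a == b)%:R * v ^ (- lambda_wt l b)) *: y).
Proof.
move=> yl yF; have Ky i : y * Km i = v ^ (- lambda_wt l i) *: y.
  by rewrite yl -mulrA (one_torus Rel) // scalerAr.
have yFn k : J (y * Fn k).
  by rewrite /nat_ext; case: insub => [i|]; rewrite ?mulr0.
elim: a => [|a IHa] an.
  case: b => [|b]; first by rewrite Nop_diag Ky mul1r subrr.
  by rewrite Nop_eq0 // mulr0 mul0r scale0r subrr.
have [ab|ba|<-] := ltngtP a.+1 b.
- by rewrite Nop_eq0 // mulr0 mul0r scale0r subrr.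
- rewrite mul0r scale0r subr0 NopS // mulrBr mulrA.
  apply: JB; first exact/JM.
  rewrite -scalerAr mulrA; apply: JZ.
  have := IHa (ltnW an); move/(JM (Fn a)); rewrite mulrBl => /JD.
  move=> /(_ ((((a == b)%:R * v ^ (- lambda_wt l b)) *: y) * Fn a)).
  rewrite subrK; apply; rewrite -scalerAl; exact: JZ.
by rewrite Nop_diag Ky mul1r subrr.
Qed.

Lemma Jsum_delta (f : nat -> A) i : (i < n)%N ->
  (forall c, (c < n)%N -> c != i -> J (f c)) -> J (\sum_(c < n) f c - f i).
Proof.
move=> iN h; rewrite (bigD1 (Ordinal iN)) //= addrAC subrr add0r.
elim/big_ind: _ => // c; rewrite -val_eqE /= => ci; exact: h.
Qed.

(** Only the products M_ii L_ii survive, and these are K_i K_i^-1 K_i^-1 K_i^-1 = K_i^-2. *)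
Lemma casimir_singular_l l y : y = one l * y -> (forall i, J (E i * y)) ->
  J (z * y - central_char l *: y).
Proof.
move=> yl yE; have sing := Lop_singular _ yl yE.
rewrite /casimir mulr_suml /central_char scaler_suml -sumrB.
apply: left_ideal_sum => // i; rewrite -scalerAl -scalerA -scalerBr; apply: JZ.
rewrite mulr_suml.
apply: (@JT (M i i * L i i * y)).
  apply: (@Jsum_delta (fun c => M i c * L c i * y)) => // c cN ci.
  rewrite -mulrA; apply: JL; have := sing c i cN.
  by rewrite (negPf ci) mul0r scale0r subr0.
have Ky : Km i * y = v ^ (- lambda_wt l i) *: y.
  by rewrite yl mulrA (torus_one Rel) // scalerAl.
have Ky' : Kp i * y = v ^ (lambda_wt l i) *: y.
  by rewrite yl mulrA (torus_one Rel) // scalerAl.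
rewrite /Mop Lop_diag Nop_diag -!mulrA Ky -!scalerAr Ky -!scalerAr Ky -!scalerAr Ky'.
rewrite !scalerA -!expfzDr // lambda_wt_ord.
by rewrite (_ : _ + _ = (- ((2 * val l i)%N : int))) ?subrr //; lia.
Qed.

Lemma casimir_singular_r l y : y = y * one l -> (forall i, J (y * F i)) ->
  J (y * z - central_char l *: y).
Proof.
move=> yl yF; have sing := Nop_singular _ yl yF.
rewrite /casimir mulr_sumr /central_char scaler_suml -sumrB.
apply: left_ideal_sum => // i; rewrite -scalerAr -scalerA -scalerBr; apply: JZ.
rewrite mulr_sumr.
have Ky : y * Km i = v ^ (- lambda_wt l i) *: y.
  by rewrite yl -mulrA (one_torus Rel) // scalerAr.
have Ky' : y * Kp i = v ^ (lambda_wt l i) *: y.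
  by rewrite yl -mulrA (one_torus Rel) // scalerAr.
apply: (@JT (y * (M i i * L i i))).
  apply: (@Jsum_delta (fun c => y * (M i c * L c i))) => // c cN ci.
  rewrite /Mop !mulrA Ky'; do 2 apply: JM; rewrite -scalerAl; apply: JZ.
  by have := sing c i cN; rewrite (negPf ci) mul0r scale0r subr0.
rewrite /Mop Lop_diag Nop_diag !mulrA Ky' -!scalerAl Ky -!scalerAl Ky -!scalerAl Ky.
rewrite !scalerA -!expfzDr // lambda_wt_ord.
by rewrite (_ : _ + _ = (- ((2 * val l i)%N : int))) ?subrr //; lia.
Qed.

Lemma EF_weight m i x : x = one m * x ->
  (E i * F i - F i * E i) * x = qint v (weight m (pos i) - weight m (nxt i)) *: x.
Proof.
move=> xm; rewrite (sa_EF Rel) eqxx {1}xm mulrA.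
by rewrite -[\sum_l _]/(torus one _) (torus_one Rel) -scalerAl -xm.
Qed.

Lemma EF_weight_r m i x : x = x * one m ->
  x * (E i * F i - F i * E i) = qint v (weight m (pos i) - weight m (nxt i)) *: x.
Proof.
move=> xm; rewrite (sa_EF Rel) eqxx {1}xm -mulrA.
by rewrite -[\sum_l _]/(torus one _) (one_torus Rel) -scalerAr -xm.
Qed.

Lemma Fpow_one i l k : F i ^+ k * one l = 0 \/
  exists m, [/\ F i ^+ k * one l = one m * F i ^+ k, (hgt m + k = hgt l)%N &
    weight m (pos i) - weight m (nxt i) = weight l (pos i) - weight l (nxt i) - (k.*2)%:Z].
Proof.
elim: k => [|k [IH|[m [IH hm wm]]]].
- by right; exists l; split; rewrite ?expr0 ?mulr1 ?mul1r ?addn0 ?subr0.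
- by left; rewrite exprS -mulrA IH mulr0.
rewrite exprS -mulrA IH mulrA (sa_F_one Rel).
case C: to_Lambda => [p|]; last by left; rewrite mul0r.
right; exists p; have := to_Lambda_weight C => W; have := weight_addA W => /hgtD H.
split; first by rewrite -mulrA.
  by rewrite -hm H addnS.
rewrite W !ffunE !eqxx pos_neq_nxt eq_sym pos_neq_nxt; move: wm; rewrite !ffunE; lia.
Qed.

Lemma Epow_one i l k : one l * E i ^+ k = 0 \/
  exists m, [/\ one l * E i ^+ k = E i ^+ k * one m, (hgt m + k = hgt l)%N &
    weight m (pos i) - weight m (nxt i) = weight l (pos i) - weight l (nxt i) - (k.*2)%:Z].
Proof.
elim: k => [|k [IH|[m [IH hm wm]]]].
- by right; exists l; split; rewrite ?expr0 ?mulr1 ?mul1r ?addn0 ?subr0.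
- by left; rewrite exprSr mulrA IH mul0r.
rewrite exprSr mulrA IH -mulrA (sa_one_E Rel).
case C: to_Lambda => [p|]; last by left; rewrite mulr0.
right; exists p; have := to_Lambda_weight C => W; have := weight_addA W => /hgtD H.
split; first by rewrite mulrA.
  by rewrite -hm H addnS.
rewrite W !ffunE !eqxx pos_neq_nxt eq_sym pos_neq_nxt; move: wm; rewrite !ffunE; lia.
Qed.

(** The induction step for E F^(k+1) y = [k + 1][h - k] F^k y, where y has weight h and is killed by
    E; [h - 2(k + 1)] is the contribution of [E, F] on F^(k+1) y. *)
Lemma qint_string (h : int) (k : nat) :
  qint v k.+1 * qint v (h - k%:Z) + qint v (h - (k.+1.*2)%:Z) =
  qint v k.+2 * qint v (h - k.+1%:Z).
Proof.
rewrite /qint !opprB.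
have e1 : v ^ k.+1 = v ^ k * v :> K by rewrite -exprSr.
have e2 : v ^ k.+2 = v ^ k * v * v :> K by rewrite -!exprSr.
have e3 : v ^ (k.+1.*2) = (v ^ k * v) * (v ^ k * v) :> K by rewrite -exprSr -exprD addnn.
rewrite !expfzDr // -!invr_expz e1 e2 e3.
have : v ^ k != 0 by rewrite expfz_neq0.
have : v ^ h != 0 by rewrite expfz_neq0.
move: (v ^ k) (v ^ h) => a b b0 a0.
field; repeat (apply/andP; split) => //.
Qed.

Let qint1 : qint v 1 = 1.
Proof. by rewrite /qint expr1z divff // v_sub_inv_neq0. Qed.

(* An sl_2-argument: E F^(k+1) y is a nonzero multiple of F^k y modulo J. *)
Lemma nondominant_l l y i : y = one l * y -> J (E i * y) ->
  (val l (pos i) < val l (nxt i))%N -> J y.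
Proof.
move=> yl yE lt; set h := weight l (pos i) - weight l (nxt i).
have h0 : h < 0 by rewrite /h !ffunE; lia.
have str k : J (E i * (F i ^+ k.+1 * y) - (qint v k.+1 * qint v (h - k%:Z)) *: (F i ^+ k * y)).
  elim: k => [|k IH].
    rewrite expr1 expr0 mul1r subr0 qint1 mul1r.
    have := EF_weight i yl; rewrite -/h => <-; rewrite mulrBl !mulrA opprB addrC subrK.
    by rewrite -mulrA; apply: JL.
  have := JL (F i) IH; rewrite mulrBr -scalerAr [F i * (F i ^+ k * y)]mulrA -exprS.
  set w := F i ^+ k.+1 * y => H.
  have Hw : (E i * F i - F i * E i) * w = qint v (h - (k.+1.*2)%:Z) *: w.
    have ew : w = F i ^+ k.+1 * one l * y by rewrite -mulrA -yl.
    have [w0|[m [wm _ hm]]] := Fpow_one i l k.+1.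
      by rewrite ew w0 !mul0r mulr0 scaler0.
    rewrite (@EF_weight m); first by rewrite hm.
    by rewrite {1}ew wm -mulrA.
  rewrite exprS -mulrA -/w -qint_string scalerDl -Hw.
  move: (_ *: w) H => c H; rewrite (_ : _ - _ = F i * (E i * w) - c) //.
  nc_ring K A.
(* As h < 0, none of the factors [h - k] vanishes, so one can descend from F^(k+1) y to F^k y; the
   descent starts at a power that is 0. *)
have Fk k : J (F i ^+ k * y) -> J y.
  elim: k => [|k IH]; first by rewrite expr0 mul1r.
  move/(JL (E i)) => H; apply: IH; have := JB H (str k); rewrite subKr.
  set c := _ * _; have c0 : c != 0.
    rewrite mulf_neq0 // qint_neq0 //; lia.
  by move/(JZ c^-1); rewrite scalerA mulVf // scale1r.
apply: (Fk (hgt l).+1); have [w0|[m [_ hm _]]] := Fpow_one i l (hgt l).+1.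
  by rewrite yl mulrA w0 mul0r.
by exfalso; lia.
Qed.

(** The mirror image of [nondominant_l]: F_i on the right plays the role of E_i on the left, and the
    string is built from powers of E_i. *)
Lemma nondominant_r l y i : y = y * one l -> J (y * F i) ->
  (val l (pos i) < val l (nxt i))%N -> J y.
Proof.
move=> yl yF lt; set h := weight l (pos i) - weight l (nxt i).
have h0 : h < 0 by rewrite /h !ffunE; lia.
have str k : J (y * E i ^+ k.+1 * F i - (qint v k.+1 * qint v (h - k%:Z)) *: (y * E i ^+ k)).
  elim: k => [|k IH].
    rewrite expr1 expr0 mulr1 subr0 qint1 mul1r.
    have := EF_weight_r i yl; rewrite -/h => <-; rewrite mulrBr !mulrA opprB addrC subrK.
    exact: JM.
  have := JM (E i) IH; rewrite mulrBl -scalerAl -[y * E i ^+ k * E i]mulrA -exprSr.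
  set w := y * E i ^+ k.+1 => H.
  have Hw : w * (E i * F i - F i * E i) = qint v (h - (k.+1.*2)%:Z) *: w.
    have ew : w = y * (one l * E i ^+ k.+1) by rewrite mulrA -yl.
    have [w0|[m [wm _ hm]]] := Epow_one i l k.+1.
      by rewrite ew w0 !mulr0 mul0r scaler0.
    rewrite (@EF_weight_r m); first by rewrite hm.
    by rewrite {1}ew wm mulrA.
  rewrite exprSr mulrA -/w -qint_string scalerDl -Hw.
  move: (_ *: w) H => c H; rewrite (_ : _ - _ = w * F i * E i - c) //.
  nc_ring K A.
have Fk k : J (y * E i ^+ k) -> J y.
  elim: k => [|k IH]; first by rewrite expr0 mulr1.
  move/(JM (F i)) => H; apply: IH; have := JB H (str k); rewrite subKr.
  set c := _ * _; have c0 : c != 0.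
    rewrite mulf_neq0 // qint_neq0 //; lia.
  by move/(JZ c^-1); rewrite scalerA mulVf // scale1r.
apply: (Fk (hgt l).+1); have [w0|[m [_ hm _]]] := Epow_one i l (hgt l).+1.
  by rewrite yl -mulrA w0 mulr0.
by exfalso; lia.
Qed.

End Modulo.

Variables (W : lmodType K) (rho : A -> W -> W).
Hypothesis rhoD : forall a b w, rho (a + b) w = rho a w + rho b w.
Hypothesis rhoZ : forall c a w, rho (c *: a) w = c *: rho a w.
Hypothesis rhoM : forall a b w, rho (a * b) w = rho a (rho b w).
Hypothesis rho0 : forall a, rho a 0 = 0.
(** This separation of dominant weights is kept as a hypothesis, since it is shown later for the
    indeterminate itself. *)
Hypothesis central_char_inj : forall l m, dominant l -> dominant m ->
  central_char l = central_char m -> l = m.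
Hypothesis separated : forall l, dominant l ->
  exists w, [/\ w <> 0, rho (one l) w = w & forall i, rho (E i) w = 0].

Let rho0l w : rho 0 w = 0.
Proof. by rewrite -(scale0r (0 : A)) rhoZ scale0r. Qed.

Lemma nondominant_ex (l : Lambda n d) : ~ dominant l ->
  exists i : 'I_n.-1, (val l (pos i) < val l (nxt i))%N.
Proof.
move=> h; apply: contrapT => h'; apply: h => i; rewrite leqNgt; apply/negP => lt.
by apply: h'; exists i.
Qed.

(** The filtration begins with the whole algebra, as the idempotents sum to 1, and is 0 beyond the
    largest rank. *)
Lemma rank_ideal_sup x : x <> 0 -> exists r, rank_ideal r x /\ ~ rank_ideal r.+1 x.
Proof.
move=> x0; apply: contrapT => h.
have all r : rank_ideal r x.
  elim: r => [|r IH]; last by apply: contrapT => h'; apply: h; exists r.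
  rewrite (sum_one_l Rel x); apply: left_ideal_sum; first exact: rank_ideal_left.
  by move=> l; rewrite -[one l]mul1r; apply: Rank_gen.
apply: x0; elim: (all (\max_l rank l).+1) => [a l b||y y' _ -> _ ->] //.
  by rewrite ltnNge leq_bigmax.
by rewrite addr0.
Qed.

(** * A single layer of the filtration *)

Section Layer.
Variable l : Lambda n d.
Local Notation J := (rank_ideal (rank l).+1).
Hypothesis one_notin : ~ J (one l).

Let HJ := rank_ideal_left (rank l).+1.
Let JM (x c : A) (H : J x) : J (x * c) := rank_idealM c H.

Lemma layer_E i : J (E i * one l).
Proof.
rewrite (sa_E_one Rel); case C: to_Lambda => [m|]; last exact: Rank_0.
rewrite -[one m]mul1r; apply: Rank_gen; apply: rank_lt.
by rewrite (hgtD (to_Lambda_weight C)).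
Qed.

(** Raising l increases the rank, so 1_l itself is singular modulo J and the sl_2-argument applies
    to it. *)
Lemma layer_dominant : dominant l.
Proof.
apply: contrapT => /nondominant_ex [i lt]; apply: one_notin.
apply: (nondominant_l HJ _ _ lt); last exact: layer_E.
by rewrite (sa_orth Rel) eqxx.
Qed.

(** The layer is generated by 1_l as a bimodule and the Casimir element is central, so its action on
    the singular element 1_l decides. *)
Lemma layer_char y : rank_ideal (rank l) y -> J (z * y - central_char l *: y).
Proof.
have [J0 JD JL] := HJ.
elim=> {y} [a m b||x y _ Hx _ Hy].
- have E1 : z * (a * one m * b) - central_char l *: (a * one m * b)
      = a * (z * one m - central_char l *: one m) * b.
    by rewrite !(mulrBr, mulrBl) -!scalerAr -!scalerAl !mulrA casimir_central.
  rewrite E1 leq_eqVlt => /orP[/eqP/rank_inj <-|lm].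
    apply: JM; apply: JL; apply: (casimir_singular_l HJ); last exact: layer_E.
    by rewrite (sa_orth Rel) eqxx.
  rewrite mulrBr mulrBl mulrA; apply: (left_idealB HJ).
    exact: Rank_gen.
  by rewrite -scalerAr -scalerAl; apply: (left_idealZ _ HJ); apply: Rank_gen.
- by rewrite mulr0 scaler0 subr0.
by rewrite mulrDr scalerDr opprD addrACA; apply: JD.
Qed.

(** Modulo J, every element of A 1_l is a combination of words in the F_i times 1_l, and 1_l F_i,
    being F_i 1_m with m of larger rank or 0, kills all nonempty words. *)
Lemma layer_scalar a : exists k, J (one l * a * one l - k *: one l).
Proof.
have [J0 JD JL] := HJ.
have := hw_span_all a HJ layer_E; rewrite -mulrA; move: (a * one l) => y.
elim=> {y} [|x Jx|i x _ _|x y _ [p Hp] _ [q Hq]|c x _ [p Hp]].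
- by exists 1; rewrite (sa_orth Rel) eqxx scale1r subrr.
- by exists 0; rewrite scale0r subr0; apply: JL.
- exists 0; rewrite scale0r subr0 mulrA (sa_one_F Rel); case C: to_Lambda => [m|].
    by apply: JM; rewrite -[_ * one m]mulr1; apply: Rank_gen; apply: rank_lt;
      rewrite (hgtD (to_Lambda_weight C)).
  by rewrite mul0r.
- by exists (p + q); rewrite mulrDr scalerDl opprD addrACA; apply: JD.
by exists (c * p); rewrite -scalerAr -scalerA -scalerBr; apply: left_idealZ.
Qed.

Lemma layer_left x : rank_ideal (rank l) x -> ~ J x -> exists a, ~ J (one l * a * x).
Proof.
have [J0 JD JL] := HJ; move=> xl xJ.
pose P m := `[< exists a, ~ J (one m * a * x) >].
have [m0 Pm0] : exists m, P m.
  apply: contrapT => h; apply: xJ; rewrite (sum_one_l Rel x).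
  apply: left_ideal_sum => // m; apply: contrapT => h'; apply: h; exists m.
  by apply/asboolP; exists 1; rewrite mulr1.
(* Maximal height makes 1_m a x singular: E_i would lead to a higher weight. The Casimir element
   then acts by the scalar of m and, as on the whole layer, by that of l. *)
case: (arg_maxnP (fun m => hgt m) Pm0) => m /asboolP [a ma] max.
pose y := one m * a * x.
have ym : y = one m * y by rewrite /y !mulrA (sa_orth Rel) eqxx.
have yE i : J (E i * y).
  rewrite /y !mulrA (sa_E_one Rel); case C: to_Lambda => [p|]; last by rewrite !mul0r.
  apply: contrapT => h; have /max : P p by apply/asboolP; exists (E i * a); rewrite mulrA.
  by rewrite /= (hgtD (to_Lambda_weight C)) ltnn.
have dm : dominant m.
  apply: contrapT => /nondominant_ex [i lt]; apply: ma.
  exact: (nondominant_l HJ ym (yE i) lt).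
have y1 := casimir_singular_l HJ ym yE.
have y2 : J (z * y - central_char l *: y).
  by apply: layer_char; case: (rank_ideal_left (rank l)) => _ _; apply.
suff lm : l = m by subst m; exists a.
apply: central_char_inj => //; first exact: layer_dominant.
apply: contrapT => /eqP; rewrite -subr_eq0 => c0; apply: ma.
have := left_idealB HJ y1 y2; rewrite opprB addrC addrA subrK -scalerBl.
by move/(left_idealZ (central_char l - central_char m)^-1 HJ); rewrite scalerA mulVf // scale1r.
Qed.

Lemma layer_right x : rank_ideal (rank l) x -> ~ J x -> exists b, ~ J (x * b * one l).
Proof.
have [J0 JD JL] := HJ; move=> xl xJ.
pose P m := `[< exists b, ~ J (x * b * one m) >].
have [m0 Pm0] : exists m, P m.
  apply: contrapT => h; apply: xJ; rewrite (sum_one_r Rel x).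
  apply: left_ideal_sum => // m; apply: contrapT => h'; apply: h; exists m.
  by apply/asboolP; exists 1; rewrite mulr1.
case: (arg_maxnP (fun m => hgt m) Pm0) => m /asboolP [a ma] max.
pose y := x * a * one m.
have ym : y = y * one m by rewrite /y -!mulrA (sa_orth Rel) eqxx.
have yF i : J (y * F i).
  rewrite /y -!mulrA (sa_one_F Rel); case C: to_Lambda => [p|]; last by rewrite !mulr0.
  apply: contrapT => h; have /max : P p by apply/asboolP; exists (a * F i); rewrite -!mulrA.
  by rewrite /= (hgtD (to_Lambda_weight C)) ltnn.
have dm : dominant m.
  apply: contrapT => /nondominant_ex [i lt]; apply: ma.
  exact: (nondominant_r HJ JM ym (yF i) lt).
have y1 := casimir_singular_r HJ JM ym yF.
have y2 : J (z * y - central_char l *: y).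
  by apply: layer_char; do 2 apply: rank_idealM.
suff lm : l = m by subst m; exists a.
apply: central_char_inj => //; first exact: layer_dominant.
apply: contrapT => /eqP; rewrite -subr_eq0 => c0; apply: ma.
rewrite casimir_central in y1.
have := left_idealB HJ y1 y2; rewrite opprB addrC addrA subrK -scalerBl.
by move/(left_idealZ (central_char l - central_char m)^-1 HJ); rewrite scalerA mulVf // scale1r.
Qed.

Lemma layer_kernel x : rank_ideal (rank l) x -> (forall w, rho x w = 0) -> J x.
Proof.
have [J0 JD JL] := HJ; move=> xl x0; apply: contrapT => /(layer_left xl) [a xa].
have [|b xb] := layer_right _ xa.
  by case: (rank_ideal_left (rank l)) => _ _; apply.
have [k yk] := layer_scalar (a * x * b); rewrite !mulrA in yk.
have [w [w0 lw Ew]] := separated layer_dominant.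
(* The annihilator of the singular vector w contains J: A w is spanned by words in the F_i applied
   to w, and no weight of rank above that of l occurs in it. *)
pose N u := rho u w = 0.
have HN : left_ideal N.
  split; rewrite /N; first exact: rho0l.
    by move=> u u' hu hu'; rewrite rhoD hu hu' addr0.
  by move=> u u' hu; rewrite rhoM hu rho0.
have NE i : N (E i * one l) by rewrite /N rhoM lw Ew.
have Nm m u : (rank l < rank m)%N -> N (one m * u).
  have uw : rho (one m * u) w = rho (one m * (u * one l)) w by rewrite mulrA [RHS]rhoM lw.
  rewrite /N uw; move: (hw_span_all u HN NE) => {uw}; move: (u * one l) => {}u H.
  elim: H m => {u} [|u Nu|i u _ IH|u u' _ Hu _ Hu'|c u _ Hu] m lm.
  - rewrite (sa_orth Rel); case: eqP => [e|_]; last exact: rho0l.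
    by move: lm; rewrite e ltnn.
  - by rewrite rhoM Nu rho0.
  - rewrite mulrA (sa_one_F Rel); case C: to_Lambda => [p|]; last by rewrite mul0r rho0l.
    rewrite -mulrA rhoM IH ?rho0 //; apply: ltn_trans lm _; apply: rank_lt.
    by rewrite (hgtD (to_Lambda_weight C)).
  - by rewrite mulrDr rhoD Hu ?Hu' ?addr0.
  - by rewrite -scalerAr rhoZ Hu ?scaler0.
have JN u : J u -> N u.
  elim=> {u} [u m u' lm||u u' _ Hu _ Hu'].
  - by rewrite -mulrA /N rhoM Nm ?rho0.
  - exact: rho0l.
  - by rewrite /N rhoD Hu Hu' addr0.
have k0 : k = 0.
  have := JN _ yk; rewrite /N rhoD -scaleN1r rhoZ rhoZ lw.
  rewrite !rhoM x0 !rho0 add0r scaleN1r => /eqP; rewrite oppr_eq0 scaler_eq0.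
  by case/orP => /eqP.
by apply: xb; move: yk; rewrite k0 scale0r subr0.
Qed.

End Layer.

Theorem kernel_trivial x : (forall w, rho x w = 0) -> x = 0.
Proof.
move=> x0; apply: contrapT => /rank_ideal_sup [r [xr xr']].
(* If no weight has rank r, or if the idempotent of that rank already lies in the next ideal, then
   the two consecutive ideals coincide, contrary to the choice of r. *)
have [[l lr]|no] := pselect (exists l : Lambda n d, rank l = r).
  subst r; apply: (xr'); apply: layer_kernel => // h; apply: xr'.
  have [J0 JD JL] := rank_ideal_left (rank l).+1.
  elim: xr => [a m b||y y' _ Hy _ Hy'] //; last exact: JD.
  rewrite leq_eqVlt => /orP[/eqP/rank_inj <-|lm]; last exact: Rank_gen.
  by apply: rank_idealM; apply: JL.
apply: xr'; elim: xr => [a m b||y y' _ Hy _ Hy'].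
- rewrite leq_eqVlt => /orP[/eqP rm|lm]; last exact: Rank_gen.
  by exfalso; apply: no; exists m.
- exact: Rank_0.
- exact: Rank_add.
Qed.

End Kernel.

(** * Operators on tensor powers *)

Section Tensors.
Variables (K : fieldType) (v : K).

(** A name for the endomorphisms under which composition becomes the multiplication of an algebra;
    having [n.+1] letters makes the tensor power nonzero, hence 1 != 0. *)
Definition op n d : Type := 'End(tpower K n.+1 d).

HB.instance Definition _ n d := GRing.Lmodule.copy (op n d) 'End(tpower K n.+1 d).

Lemma bvec_neq0 (T : finType) (t : T) : bvec K t != 0.
Proof. by apply/eqP => /ffunP /(_ t) /eqP; rewrite !ffunE eqxx oner_eq0. Qed.

Lemma id_op_neq0 n d : \1%VF != 0 :> 'End(tpower K n.+1 d).
Proof.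
apply/eqP => /lfunP /(_ (bvec K (nseq_tuple d ord0))) /eqP.
by rewrite id_lfunE zero_lfunE (negPf (bvec_neq0 _)).
Qed.

HB.instance Definition _ n d := GRing.Zmodule_isNzRing.Build (op n d)
  (fun x y z : 'End(tpower K n.+1 d) => comp_lfunA x y z)
  (fun x : 'End(tpower K n.+1 d) => comp_lfun1l x)
  (fun x : 'End(tpower K n.+1 d) => comp_lfun1r x)
  (fun x y z : 'End(tpower K n.+1 d) => comp_lfunDl x y z)
  (fun x y z : 'End(tpower K n.+1 d) => comp_lfunDr x y z) (id_op_neq0 n d).
HB.instance Definition _ n d := GRing.Lmodule_isLalgebra.Build K (op n d)
  (fun k (x y : 'End(tpower K n.+1 d)) => comp_lfunZl k x y).
HB.instance Definition _ n d := GRing.Lalgebra_isAlgebra.Build K (op n d)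
  (fun k (x y : 'End(tpower K n.+1 d)) => comp_lfunZr k x y).

Lemma span_sum (T : finType) (w : span_on K T) : w = \sum_t w t *: bvec K t.
Proof.
apply/ffunP => r; rewrite sum_ffunE (bigD1 r) //= !ffunE eqxx big1 ?addr0.
  by rewrite [_ *: _]mulr1.
by move=> s /negPf sr; rewrite !ffunE eq_sym sr [_ *: _]mulr0.
Qed.

Section Cons.
Variables n d : nat.
Implicit Types (u : nat_mod K n) (w : tpower K n d) (a : 'I_n) (t : d.-tuple 'I_n).
Implicit Types (f : 'End(nat_mod K n)) (g : 'End(tpower K n d)).

Lemma tensvDl u u' w : tensv (u + u') w = tensv u w + tensv u' w.
Proof. by apply/ffunP => t; rewrite !ffunE mulrDl. Qed.

Lemma tensvDr u w w' : tensv u (w + w') = tensv u w + tensv u w'.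
Proof. by apply/ffunP => t; rewrite !ffunE mulrDr. Qed.

Lemma tensvZl c u w : tensv (c *: u) w = c *: tensv u w.
Proof. by apply/ffunP => t; rewrite !ffunE -mulrA. Qed.

Lemma tensvZr c u w : tensv u (c *: w) = c *: tensv u w.
Proof. by apply/ffunP => t; rewrite !ffunE mulrCA. Qed.

Lemma tensv0l w : tensv (0 : nat_mod K n) w = 0.
Proof. by apply/ffunP => t; rewrite !ffunE mul0r. Qed.

Lemma tensv0r u : tensv u (0 : tpower K n d) = 0.
Proof. by apply/ffunP => t; rewrite !ffunE mulr0. Qed.

Lemma tensv_suml (I : finType) (h : I -> nat_mod K n) w :
  tensv (\sum_i h i) w = \sum_i tensv (h i) w.
Proof. exact: (big_morph (fun u => tensv u w) (fun x y => tensvDl x y w) (tensv0l w)). Qed.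

Lemma tensv_sumr (I : finType) u (h : I -> tpower K n d) :
  tensv u (\sum_i h i) = \sum_i tensv u (h i).
Proof. exact: (big_morph (tensv u) (tensvDr u) (tensv0r u)). Qed.

Lemma bvec_cons a t : bvec K [tuple of a :: t] = tensv (bvec K a) (bvec K t).
Proof.
apply/ffunP => s; rewrite !ffunE (tuple_eta s) theadE.
rewrite -natrM mulnb; congr (_ : bool)%:R.
Qed.

Lemma tensop_bvec f g a t :
  tensop f g (bvec K [tuple of a :: t]) = tensv (f (bvec K a)) (g (bvec K t)).
Proof.
rewrite lin_extE theadE; congr (tensv _ (g (bvec K _))); exact: val_inj.
Qed.

Lemma tensopE f g u w : tensop f g (tensv u w) = tensv (f u) (g w).
Proof.
rewrite (span_sum u) (span_sum w) tensv_suml !linear_sum tensv_suml /=.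
apply: eq_bigr => a _; rewrite !tensv_sumr linear_sum; apply: eq_bigr => t _.
rewrite !(tensvZl, tensvZr, linearZ) /= !(tensvZl, tensvZr, linearZ) /=.
rewrite !scalerA mulrC; congr (_ *: _).
by rewrite -bvec_cons tensop_bvec.
Qed.

Lemma hom_consP (V : vectType K) (f g : 'Hom(tpower K n d.+1, V)) :
  (forall a t, f (tensv (bvec K a) (bvec K t)) = g (tensv (bvec K a) (bvec K t))) -> f = g.
Proof.
move=> fg; apply: hom_bvecP => t; rewrite (tuple_eta t).
by rewrite (_ : [tuple of _] = [tuple of thead t :: [tuple of behead t]]) ?bvec_cons ?fg //; apply: val_inj.
Qed.

Lemma tensop_comp f g f' g' :
  (tensop (n := n) (d := d) f g \o tensop f' g')%VF = tensop (f \o f')%VF (g \o g')%VF.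
Proof. by apply: hom_consP => a t; rewrite comp_lfunE !tensopE !comp_lfunE. Qed.

Lemma tensopDl f f' g : tensop (f + f') g = tensop f g + tensop f' g :> 'End(tpower K n d.+1).
Proof. by apply: hom_consP => a t; rewrite add_lfunE !tensopE add_lfunE tensvDl. Qed.

Lemma tensopDr f g g' : tensop f (g + g') = tensop f g + tensop f g' :> 'End(tpower K n d.+1).
Proof. by apply: hom_consP => a t; rewrite add_lfunE !tensopE add_lfunE tensvDr. Qed.

Lemma tensopZl c f g : tensop (c *: f) g = c *: tensop f g :> 'End(tpower K n d.+1).
Proof. by apply: hom_consP => a t; rewrite scale_lfunE !tensopE scale_lfunE tensvZl. Qed.

Lemma tensopZr c f g : tensop f (c *: g) = c *: tensop f g :> 'End(tpower K n d.+1).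
Proof. by apply: hom_consP => a t; rewrite scale_lfunE !tensopE scale_lfunE tensvZr. Qed.

Lemma tensop0l g : @tensop K n d 0 g = 0 :> 'End(tpower K n d.+1).
Proof. by apply: hom_consP => a t; rewrite !tensopE !zero_lfunE tensv0l. Qed.

Lemma tensop0r f : @tensop K n d f 0 = 0 :> 'End(tpower K n d.+1).
Proof. by apply: hom_consP => a t; rewrite !tensopE !zero_lfunE tensv0r. Qed.

End Cons.

Lemma hom_natP n (V : vectType K) (f g : 'Hom(nat_mod K n, V)) :
  (forall b : 'I_n, f (bvec K b) = g (bvec K b)) -> f = g.
Proof. exact: hom_bvecP. Qed.

Lemma hom_tupleP n d (V : vectType K) (f g : 'Hom(tpower K n d, V)) :
  (forall t : d.-tuple 'I_n, f (bvec K t) = g (bvec K t)) -> f = g.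
Proof. exact: hom_bvecP. Qed.

Hypothesis v_neq0 : v != 0.

Lemma Kv_bvec n (i b : 'I_n) z : Kv v i z (bvec K b) = v ^ (z * (b == i)%:Z) *: bvec K b.
Proof. by rewrite lin_extE; case: eqP => _; rewrite ?mulr1 ?mulr0. Qed.

Lemma Ev_bvec n (i : 'I_n.-1) (b : 'I_n) : Ev K i (bvec K b) = (b == nxt i)%:R *: bvec K (pos i).
Proof. exact: lin_extE. Qed.

Lemma Fv_bvec n (i : 'I_n.-1) (b : 'I_n) : Fv K i (bvec K b) = (b == pos i)%:R *: bvec K (nxt i).
Proof. exact: lin_extE. Qed.

Lemma K_op_bvec n d (i : 'I_n) z (t : d.-tuple 'I_n) :
  K_op v d i z (bvec K t) = v ^ (z * (count_mem i t)%:Z) *: bvec K t.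
Proof.
elim: d t => [|d IHd] t; first by rewrite tuple0 /= mulr0 scale1r id_lfunE.
case/tupleP: t => a t /=.
rewrite bvec_cons tensopE Kv_bvec IHd tensvZl tensvZr scalerA -expfzDr // -mulrDr.
by rewrite PoszD.
Qed.

Definition KK_op n d (i : 'I_n.-1) (z : int) : 'End(tpower K n d) :=
  (K_op v d (pos i) z \o K_op v d (nxt i) (- z))%VF.

Lemma KK_op_bvec n d (i : 'I_n.-1) z (t : d.-tuple 'I_n) : KK_op d i z (bvec K t) =
  v ^ (z * ((count_mem (pos i) t)%:Z - (count_mem (nxt i) t)%:Z)) *: bvec K t.
Proof.
rewrite comp_lfunE K_op_bvec linearZ /= K_op_bvec scalerA -expfzDr //.
by rewrite mulNr mulrBr addrC.
Qed.

Lemma E_op_cons n d (i : 'I_n.-1) (a : 'I_n) (t : d.-tuple 'I_n) :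
  E_op v d.+1 i (bvec K [tuple of a :: t]) =
  ((a == nxt i)%:R * v ^ ((count_mem (pos i) t)%:Z - (count_mem (nxt i) t)%:Z))
     *: bvec K [tuple of pos i :: t] + tensv (bvec K a) (E_op v d i (bvec K t)).
Proof.
rewrite /= bvec_cons add_lfunE !tensopE id_lfunE Ev_bvec; congr (_ + _).
rewrite -[(_ \o _)%VF]/(KK_op d i 1) KK_op_bvec mul1r.
by rewrite tensvZl tensvZr scalerA bvec_cons.
Qed.

Lemma F_op_cons n d (i : 'I_n.-1) (a : 'I_n) (t : d.-tuple 'I_n) :
  F_op v d.+1 i (bvec K [tuple of a :: t]) =
  (a == pos i)%:R *: bvec K [tuple of nxt i :: t] +
  v ^ ((a == nxt i)%:Z - (a == pos i)%:Z) *: tensv (bvec K a) (F_op v d i (bvec K t)).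
Proof.
rewrite /= bvec_cons add_lfunE !tensopE id_lfunE Fv_bvec tensvZl bvec_cons; congr (_ + _).
rewrite comp_lfunE Kv_bvec linearZ /= Kv_bvec scalerA -expfzDr // tensvZl.
by rewrite mul1r mulN1r.
Qed.

End Tensors.

(** * The relations between the K_i, E_i and F_i on tensor powers *)

Section Coproduct.
Variables (K : fieldType) (v : K).
Hypothesis v_neq0 : v != 0.

(** For E, a = E_i (x) K_i K_(i+1)^-1 and b = 1 (x) E_i, with a', b' the same for j, and q = v; for
    F, q = v^-1. The mixed terms cancel by q-commutation, and the terms in a vanish because E_i^2 =
    E_i E_j E_i = 0 on V. *)
Lemma serre_coproduct (A : algType K) (q : K) (a b a' b' : A) : q != 0 ->
  b * a = (q^-1 * q^-1) *: (a * b) -> b * a' = q *: (a' * b) ->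
  b' * a = q *: (a * b') -> a * a = 0 -> a * a' * a = 0 ->
  b ^+ 2 * b' - (q + q^-1) *: (b * b' * b) + b' * b ^+ 2 = 0 ->
  (a + b) ^+ 2 * (a' + b') - (q + q^-1) *: ((a + b) * (a' + b') * (a + b))
    + (a' + b') * (a + b) ^+ 2 = 0.
Proof.
move=> q0 h1 h2 h3 aa aaa S.
have aa' : a * a = 0 *: (a * a) by rewrite scale0r.
transitivity (b ^+ 2 * b' - (q + q^-1) *: (b * b' * b) + b' * b ^+ 2
  - (q + q^-1) *: (a * a' * a)); last by rewrite S aaa scaler0 subr0.
nc_sort K A (h1, (h2, (h3, (aa', tt)))).
Qed.

Lemma comm_coproduct (A : algType K) (a b a' b' : A) :
  a * a' = 0 -> a' * a = 0 -> b * a' = 1 *: (a' * b) -> b' * a = 1 *: (a * b') ->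
  b * b' - b' * b = 0 -> (a + b) * (a' + b') - (a' + b') * (a + b) = 0.
Proof.
move=> aa aa' h1 h2 S; transitivity (a * a' - a' * a + (b * b' - b' * b)).
  nc_sort K A (h1, (h2, tt)).
by rewrite aa aa' S subrr addr0.
Qed.

Section Vectors.
Variable n : nat.
Implicit Types i j : 'I_n.-1.

Definition cartan i j : int :=
  ((pos i == pos j)%:Z - (pos i == nxt j)%:Z) -
  ((nxt i == pos j)%:Z - (nxt i == nxt j)%:Z).

Lemma cartan_diag i : cartan i i = 2.
Proof. by rewrite /cartan !eqxx [nxt i == _]eq_sym pos_neq_nxt. Qed.

Lemma cartan_adjacent i j : adjacent i j -> cartan i j = -1.
Proof. by rewrite /cartan /adjacent -!val_eqE /=; case/orP => /eqP ->; lia. Qed.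

Lemma cartan_far i j : i != j -> ~~ adjacent i j -> cartan i j = 0.
Proof. by rewrite /cartan /adjacent -!val_eqE /= => ij; rewrite negb_or; lia. Qed.

Lemma Ev_sqr i : (Ev K i \o Ev K i = 0)%VF.
Proof.
apply: hom_natP => b; rewrite comp_lfunE Ev_bvec linearZ /= Ev_bvec.
by rewrite pos_neq_nxt scale0r scaler0 zero_lfunE.
Qed.

Lemma Fv_sqr i : (Fv K i \o Fv K i = 0)%VF.
Proof.
apply: hom_natP => b; rewrite comp_lfunE Fv_bvec linearZ /= Fv_bvec.
by rewrite [nxt i == _]eq_sym pos_neq_nxt scale0r scaler0 zero_lfunE.
Qed.

Lemma Ev_triple i j : (Ev K i \o Ev K j \o Ev K i = 0)%VF.
Proof.
apply: hom_natP => b; rewrite !comp_lfunE Ev_bvec !(linearZ, Ev_bvec) /= !(linearZ, Ev_bvec) /= Ev_bvec.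
rewrite -!val_eqE /= zero_lfunE; case: (_ =P j.+1) => [->|_]; last by rewrite !scale0r.
by rewrite (_ : (j == _ :> nat) = false) ?scale0r ?scaler0 //; lia.
Qed.

Lemma Fv_triple i j : (Fv K i \o Fv K j \o Fv K i = 0)%VF.
Proof.
apply: hom_natP => b; rewrite !comp_lfunE Fv_bvec !(linearZ, Fv_bvec) /= !(linearZ, Fv_bvec) /= Fv_bvec.
rewrite -!val_eqE /= zero_lfunE; case: (_ =P (j : nat)) => [<-|_]; last by rewrite !scale0r.
by rewrite (_ : (_.+2 == _ :> nat) = false) ?scale0r ?scaler0 //; lia.
Qed.

Lemma Ev_far i j : i != j -> ~~ adjacent i j -> (Ev K i \o Ev K j = 0)%VF.
Proof.
move=> ij adj; apply: hom_natP => b; rewrite comp_lfunE Ev_bvec linearZ /= Ev_bvec.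
rewrite (_ : (_ == nxt i) = false) ?scale0r ?scaler0 ?zero_lfunE //.
by move: adj; rewrite /adjacent -!val_eqE /=; lia.
Qed.

Lemma Fv_far i j : i != j -> ~~ adjacent i j -> (Fv K i \o Fv K j = 0)%VF.
Proof.
move=> ij adj; apply: hom_natP => b; rewrite comp_lfunE Fv_bvec linearZ /= Fv_bvec.
rewrite (_ : (_ == pos i) = false) ?scale0r ?scaler0 ?zero_lfunE //.
by move: adj; rewrite /adjacent -!val_eqE /=; lia.
Qed.

Definition KKv i (z : int) : 'End(nat_mod K n) := (Kv v (pos i) z \o Kv v (nxt i) (- z))%VF.

Lemma KKv_bvec i z b : KKv i z (bvec K b) =
  v ^ (z * ((b == pos i)%:Z - (b == nxt i)%:Z)) *: bvec K b.
Proof.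
rewrite comp_lfunE Kv_bvec // linearZ /= Kv_bvec // scalerA -expfzDr //.
by rewrite mulNr mulrBr addrC.
Qed.

Lemma Kv_Ev (i : 'I_n) j z : (Kv v i z \o Ev K j)%VF =
  v ^ (z * ((pos j == i)%:Z - (nxt j == i)%:Z)) *: (Ev K j \o Kv v i z)%VF.
Proof.
apply: hom_natP => b; rewrite scale_lfunE !comp_lfunE Kv_bvec // Ev_bvec !linearZ /=.
rewrite Kv_bvec // Ev_bvec; have [->|_] := eqVneq b (nxt j); last first.
  by rewrite !(scale0r, scaler0).
by rewrite !scale1r scalerA -expfzDr // -mulrDr addrCA subrr addr0.
Qed.

Lemma Kv_Fv (i : 'I_n) j z : (Kv v i z \o Fv K j)%VF =
  v ^ (z * ((nxt j == i)%:Z - (pos j == i)%:Z)) *: (Fv K j \o Kv v i z)%VF.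
Proof.
apply: hom_natP => b; rewrite scale_lfunE !comp_lfunE Kv_bvec // Fv_bvec !linearZ /=.
rewrite Kv_bvec // Fv_bvec; have [->|_] := eqVneq b (pos j); last first.
  by rewrite !(scale0r, scaler0).
by rewrite !scale1r scalerA -expfzDr // -mulrDr addrCA subrr addr0.
Qed.

Lemma Kv_KKv (i : 'I_n) j y z : (Kv v i y \o KKv j z = KKv j z \o Kv v i y)%VF.
Proof.
apply: hom_natP => b; rewrite comp_lfunE [RHS]comp_lfunE KKv_bvec Kv_bvec // !linearZ /=.
by rewrite KKv_bvec Kv_bvec // !scalerA mulrC.
Qed.

Lemma KKv_comm i j y z : (KKv i y \o KKv j z = KKv j z \o KKv i y)%VF.
Proof.
apply: hom_natP => b; rewrite comp_lfunE [RHS]comp_lfunE !KKv_bvec !linearZ /=.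
by rewrite !KKv_bvec !scalerA mulrC.
Qed.

Lemma KKv_Ev i j z : (KKv i z \o Ev K j)%VF = v ^ (z * cartan i j) *: (Ev K j \o KKv i z)%VF.
Proof.
rewrite -comp_lfunA Kv_Ev -comp_lfunZr comp_lfunA Kv_Ev -comp_lfunZl scalerA -expfzDr //.
rewrite comp_lfunA; congr (v ^ _ *: _).
by rewrite /cartan ![pos i == _]eq_sym ![nxt i == _]eq_sym; ring.
Qed.

Lemma KKv_Fv i j z : (KKv i z \o Fv K j)%VF = v ^ (- z * cartan i j) *: (Fv K j \o KKv i z)%VF.
Proof.
rewrite -comp_lfunA Kv_Fv -comp_lfunZr comp_lfunA Kv_Fv -comp_lfunZl scalerA -expfzDr //.
rewrite comp_lfunA; congr (v ^ _ *: _).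
by rewrite /cartan ![pos i == _]eq_sym ![nxt i == _]eq_sym; ring.
Qed.

Lemma Ev_Fv i j : v * v - 1 != 0 -> (Ev K i \o Fv K j)%VF - (Fv K j \o Ev K i)%VF =
  if i == j then (v - v^-1)^-1 *: (KKv i 1 - KKv i (-1)) else 0.
Proof.
move=> v2; have [<-|ij] := eqVneq i j; apply: hom_natP => b;
  rewrite add_lfunE opp_lfunE !comp_lfunE Ev_bvec Fv_bvec !linearZ /= Ev_bvec Fv_bvec.
  rewrite scale_lfunE add_lfunE opp_lfunE !KKv_bvec !eqxx !scale1r -scalerBl.
  have [->|bp] := eqVneq b (pos i).
    rewrite pos_neq_nxt scale1r scale0r subr0 scalerA.
    rewrite (_ : v ^ _ - v ^ _ = v - v^-1) //.
    by rewrite mulVf ?v_sub_inv_neq0 // scale1r addr0.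
  have [->|bn] := eqVneq b (nxt i).
    rewrite scale0r add0r scale1r scalerA (_ : v ^ _ - v ^ _ = - (v - v^-1)).
      by rewrite mulrN mulVf ?scaleN1r // v_sub_inv_neq0.
    by rewrite opprB addrC.
  by rewrite !scale0r addr0 (_ : v ^ _ - v ^ _ = 1 - 1) // subrr scale0r scaler0.
have -> : (nxt j == nxt i) = false by rewrite -val_eqE /= eqSS eq_sym val_eqE (negPf ij).
have -> : (pos i == pos j) = false by rewrite -val_eqE /= val_eqE (negPf ij).
by rewrite !scale0r oppr0 !scaler0 addr0 zero_lfunE.
Qed.

End Vectors.

Section Operators.
Variable n : nat.
Hypothesis v2m : v * v - 1 != 0.
Implicit Types i j : 'I_n.+1.-1.

Lemma tensM d f g f' g' : (tensop f g : op K n d.+1) * tensop f' g' =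
  tensop (f \o f')%VF ((g : op K n d) * g').
Proof. exact: tensop_comp. Qed.

Lemma K_op_comm d (i j : 'I_n.+1) y z : (K_op v d i y : op K n d) * K_op v d j z =
  (K_op v d j z : op K n d) * K_op v d i y.
Proof.
apply: hom_tupleP => t; rewrite !comp_lfunE !K_op_bvec // !linearZ /= !K_op_bvec //.
by rewrite !scalerA mulrC.
Qed.

Lemma KK_opE d i z : KK_op v d i z = (K_op v d (pos i) z : op K n d) * K_op v d (nxt i) (- z).
Proof. by []. Qed.

Lemma KK_op0 i z : KK_op v 0 i z = 1 :> op K n 0.
Proof. exact: mul1r. Qed.

Lemma KK_opS d i z : KK_op v d.+1 i z = tensop (KKv i z) (KK_op v d i z) :> op K n d.+1.
Proof. exact: tensM. Qed.

Lemma E_opS d i : E_op v d.+1 i = tensop (Ev K i) (KK_op v d i 1) + tensop \1%VF (E_op v d i) :> op K n d.+1.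
Proof. by []. Qed.

Lemma F_opS d i : F_op v d.+1 i = tensop (Fv K i) (1 : op K n d) + tensop (KKv i (-1)) (F_op v d i) :> op K n d.+1.
Proof. by []. Qed.

Lemma K_op_KK d (i : 'I_n.+1) j y z : (K_op v d i y : op K n d) * KK_op v d j z =
  (KK_op v d j z : op K n d) * K_op v d i y.
Proof. by rewrite !KK_opE mulrA K_op_comm -mulrA K_op_comm mulrA. Qed.

Lemma K_op_E d (i : 'I_n.+1) j z : (K_op v d i z : op K n d) * E_op v d j =
  v ^ (z * ((pos j == i)%:Z - (nxt j == i)%:Z)) *: ((E_op v d j : op K n d) * K_op v d i z).
Proof.
elim: d => [|d IHd]; first by rewrite /= mulr0 mul0r scaler0.
rewrite E_opS [K_op v d.+1 i z]/= mulrDr mulrDl scalerDr !tensM; congr (_ + _).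
  by rewrite Kv_Ev tensopZl K_op_KK.
by rewrite comp_lfun1r comp_lfun1l IHd tensopZr.
Qed.

Lemma K_op_F d (i : 'I_n.+1) j z : (K_op v d i z : op K n d) * F_op v d j =
  v ^ (z * ((nxt j == i)%:Z - (pos j == i)%:Z)) *: ((F_op v d j : op K n d) * K_op v d i z).
Proof.
elim: d => [|d IHd]; first by rewrite /= mulr0 mul0r scaler0.
rewrite F_opS [K_op v d.+1 i z]/= mulrDr mulrDl scalerDr !tensM; congr (_ + _).
  by rewrite Kv_Fv tensopZl mulr1 mul1r.
by rewrite IHd tensopZr Kv_KKv.
Qed.

Lemma KK_op_E d i j z : (KK_op v d i z : op K n d) * E_op v d j =
  v ^ (z * cartan i j) *: ((E_op v d j : op K n d) * KK_op v d i z).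
Proof.
rewrite KK_opE -mulrA K_op_E -scalerAr [X in _ *: X = _]mulrA K_op_E -scalerAl scalerA -expfzDr //.
rewrite mulrA; congr (v ^ _ *: _).
by rewrite /cartan ![pos i == _]eq_sym ![nxt i == _]eq_sym; ring.
Qed.

Lemma KK_op_F d i j z : (KK_op v d i z : op K n d) * F_op v d j =
  v ^ (- z * cartan i j) *: ((F_op v d j : op K n d) * KK_op v d i z).
Proof.
rewrite KK_opE -mulrA K_op_F -scalerAr [X in _ *: X = _]mulrA K_op_F -scalerAl scalerA -expfzDr //.
rewrite mulrA; congr (v ^ _ *: _).
by rewrite /cartan ![pos i == _]eq_sym ![nxt i == _]eq_sym; ring.
Qed.

(** The mixed terms cancel, as the powers of v from the two tensor factors are inverse to each
    other. For i = j, with K = K_i K_(i+1)^-1, the rest is (K - K^-1) (x) K + K^-1 (x) (K - K^-1) =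
    K (x) K - K^-1 (x) K^-1. *)
Lemma op_EF d i j : (E_op v d i : op K n d) * F_op v d j - (F_op v d j : op K n d) * E_op v d i =
  if i == j then (v - v^-1)^-1 *: (KK_op v d i 1 - KK_op v d i (-1)) else 0.
Proof.
elim: d => [|d IHd].
  by rewrite /= mul0r subrr; case: eqP => // _; rewrite !KK_op0 subrr scaler0.
rewrite E_opS F_opS !(mulrDl, mulrDr) !tensM !mulr1 !mul1r !comp_lfun1l !comp_lfun1r.
have -> : tensop (Ev K i \o KKv j (-1))%VF ((KK_op v d i 1 : op K n d) * F_op v d j) =
    tensop (KKv j (-1) \o Ev K i)%VF ((F_op v d j : op K n d) * KK_op v d i 1).
  rewrite KKv_Ev KK_op_F tensopZl tensopZr; congr (v ^ _ *: _).
  by rewrite /cartan ![pos j == _]eq_sym ![nxt j == _]eq_sym; ring.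
set p := tensop (KKv j (-1) \o _)%VF _; set r := tensop (Fv K j) (E_op v d i).
transitivity (tensop ((Ev K i \o Fv K j)%VF - (Fv K j \o Ev K i)%VF) (KK_op v d i 1) +
  tensop (KKv j (-1)) ((E_op v d i : op K n d) * F_op v d j - (F_op v d j : op K n d) * E_op v d i)
  : op K n d.+1).
  rewrite tensopDl tensopDr -!scaleN1r tensopZl tensopZr.
  nc_ring K (op K n d.+1).
rewrite IHd Ev_Fv //; case: eqP => [<-|_]; last by rewrite tensop0l tensop0r addr0.
rewrite !KK_opS tensopZl tensopZr -scalerDr; congr (_ *: _).
rewrite tensopDl tensopDr -!scaleN1r tensopZl tensopZr.
nc_ring K (op K n d.+1).
Qed.

Lemma E_cross d i j : (tensop \1%VF (E_op v d j) : op K n d.+1) * tensop (Ev K i) (KK_op v d i 1) =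
  v ^ (- cartan i j) *: ((tensop (Ev K i) (KK_op v d i 1) : op K n d.+1) * tensop \1%VF (E_op v d j)).
Proof.
rewrite !tensM comp_lfun1l comp_lfun1r KK_op_E tensopZr scalerA -expfzDr // mul1r.
by rewrite addNr scale1r.
Qed.

Lemma F_cross d i j : (tensop (KKv j (-1)) (F_op v d j) : op K n d.+1) * tensop (Fv K i) (1 : op K n d) =
  v ^ (cartan j i) *: ((tensop (Fv K i) (1 : op K n d) : op K n d.+1) * tensop (KKv j (-1)) (F_op v d j)).
Proof. by rewrite !tensM mulr1 mul1r KKv_Fv tensopZl opprK mul1r. Qed.

Lemma adjacent_sym i j : adjacent i j = adjacent j i.
Proof. by rewrite /adjacent orbC. Qed.

Lemma op_serreE d i j : adjacent i j ->
  (E_op v d i : op K n d) ^+ 2 * E_op v d j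
  - (v + v^-1) *: ((E_op v d i : op K n d) * E_op v d j * E_op v d i)
  + (E_op v d j : op K n d) * (E_op v d i : op K n d) ^+ 2 = 0.
Proof.
move=> adj; elim: d => [|d IHd]; first by rewrite /= !mulr0 mul0r scaler0 subr0 addr0.
rewrite !E_opS; apply: serre_coproduct => //.
- by rewrite E_cross cartan_diag -invr_expz -[v ^ 2]/(v ^+ 2) expr2 invfM.
- by rewrite E_cross cartan_adjacent 1?adjacent_sym.
- by rewrite E_cross cartan_adjacent.
- by rewrite tensM Ev_sqr tensop0l.
- by rewrite !tensM Ev_triple tensop0l.
rewrite !expr2 !tensM !comp_lfun1l -tensopZr -[- tensop _ _]scaleN1r -tensopZr -!tensopDr scaleN1r.
by rewrite -!expr2 IHd tensop0r.
Qed.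

Lemma op_serreF d i j : adjacent i j ->
  (F_op v d i : op K n d) ^+ 2 * F_op v d j
  - (v + v^-1) *: ((F_op v d i : op K n d) * F_op v d j * F_op v d i)
  + (F_op v d j : op K n d) * (F_op v d i : op K n d) ^+ 2 = 0.
Proof.
move=> adj; elim: d => [|d IHd]; first by rewrite /= !mulr0 mul0r scaler0 subr0 addr0.
have vv : v + v^-1 = v^-1 + v^-1^-1 by rewrite invrK addrC.
rewrite !F_opS vv; apply: serre_coproduct.
- by rewrite invr_neq0.
- by rewrite F_cross cartan_diag invrK -[v ^ 2]/(v ^+ 2) expr2.
- by rewrite F_cross cartan_adjacent.
- by rewrite F_cross cartan_adjacent 1?adjacent_sym.
- by rewrite tensM Fv_sqr tensop0l.
- by rewrite !tensM Fv_triple tensop0l.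
have kk := KKv_comm i j (-1) (-1).
rewrite -vv !expr2 !tensM; move: (KKv i (-1)) (KKv j (-1)) kk => x y kk.
have -> : (x \o y \o x = x \o x \o y)%VF.
  by rewrite -!comp_lfunA kk.
have -> : (y \o (x \o x) = x \o x \o y)%VF.
  by rewrite comp_lfunA -kk -!comp_lfunA -kk.
rewrite -tensopZr -[- tensop _ _]scaleN1r -tensopZr -!tensopDr scaleN1r.
by rewrite -!expr2 IHd tensop0r.
Qed.

Lemma op_commE d i j : ~~ adjacent i j ->
  (E_op v d i : op K n d) * E_op v d j - (E_op v d j : op K n d) * E_op v d i = 0.
Proof.
move=> adj; have [->|ij] := eqVneq i j; first by rewrite subrr.
have adj' : ~~ adjacent j i by rewrite adjacent_sym.
have ji : j != i by rewrite eq_sym.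
elim: d => [|d IHd]; first by rewrite /= !mulr0 subrr.
rewrite !E_opS; apply: comm_coproduct.
- by rewrite tensM Ev_far // tensop0l.
- by rewrite tensM Ev_far // tensop0l.
- by rewrite E_cross cartan_far // oppr0 expr0z.
- by rewrite E_cross cartan_far // oppr0 expr0z.
rewrite !tensM !comp_lfun1l -[- tensop _ _]scaleN1r -tensopZr -!tensopDr scaleN1r.
by rewrite IHd tensop0r.
Qed.

Lemma op_commF d i j : ~~ adjacent i j ->
  (F_op v d i : op K n d) * F_op v d j - (F_op v d j : op K n d) * F_op v d i = 0.
Proof.
move=> adj; have [->|ij] := eqVneq i j; first by rewrite subrr.
have adj' : ~~ adjacent j i by rewrite adjacent_sym.
have ji : j != i by rewrite eq_sym.
elim: d => [|d IHd]; first by rewrite /= !mulr0 subrr.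
rewrite !F_opS; apply: comm_coproduct.
- by rewrite tensM Fv_far // tensop0l.
- by rewrite tensM Fv_far // tensop0l.
- by rewrite F_cross cartan_far // expr0z.
- by rewrite F_cross cartan_far // expr0z.
rewrite !tensM (KKv_comm j i) -[- tensop _ _]scaleN1r -tensopZr -!tensopDr scaleN1r.
by rewrite IHd tensop0r.
Qed.

End Operators.

End Coproduct.

(** * The operators satisfy the relations *)

Section OperatorRelations.
Variables (K : fieldType) (v : K).
Hypothesis v_generic : forall k : nat, (0 < k)%N -> v ^+ k != 1.
Hypothesis v_neq0 : v != 0.
Variables n d : nat.
Implicit Types (l m : Lambda n.+1 d) (t : d.-tuple 'I_n.+1) (w : tpower K n.+1 d).

Lemma sum_count (s : seq 'I_n.+1) : (\sum_j count_mem j s = size s)%N.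
Proof.
elim: s => [|x s IHs] /=; first by rewrite big1.
rewrite big_split /= IHs (bigD1 x) //= eqxx big1 ?addn0 ?add1n // => j.
by rewrite eq_sym => /negPf ->.
Qed.

Lemma content_subproof t :
  (\sum_j [ffun j => inord (count_mem j t) : 'I_d.+1] j == d)%N.
Proof.
apply/eqP; transitivity (size t); last exact: size_tuple.
rewrite -(sum_count t); apply: eq_bigr => j _.
by rewrite ffunE inordK // ltnS; have := count_size (pred1 j) t; rewrite size_tuple.
Qed.

Definition content t : Lambda n.+1 d :=
  exist (fun l : {ffun 'I_n.+1 -> 'I_d.+1} => (\sum_j l j == d)%N) _ (content_subproof t).

Lemma contentE t j : val (content t) j = count_mem j t :> nat.
Proof.
rewrite /= ffunE inordK // ltnS.
by have := count_size (pred1 j) t; rewrite size_tuple.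
Qed.

Lemma weight_content t j : weight (content t) j = (count_mem j t)%:Z.
Proof. by rewrite ffunE contentE. Qed.

Lemma big_comp_eigen (I : Type) (r : seq I) (f : I -> 'End(tpower K n.+1 d)) (c : I -> K) w :
  (forall i, f i w = c i *: w) ->
  (\big[@comp_lfun _ _ _ _/ \1%VF]_(i <- r) f i) w = (\prod_(i <- r) c i) *: w.
Proof.
move=> h; elim: r => [|i r IHr]; first by rewrite !big_nil id_lfunE scale1r.
by rewrite !big_cons comp_lfunE IHr linearZ /= h scalerA mulrC.
Qed.

(** The Gaussian binomial coefficient of m over k, which is the eigenvalue of [q_binom] where K_j
    acts by v^m. *)
Definition qbin_scalar (m k : nat) : K := \prod_(1 <= s < k.+1)
  ((v ^ s%:Z - v ^ (- s%:Z))^-1 * (v ^ (m.+1%:Z - s%:Z) - v ^ (s%:Z - m.+1%:Z))).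

Lemma qbin_scalar_lt (m k : nat) : (m < k)%N -> qbin_scalar m k = 0.
Proof.
move=> mk; apply/eqP; rewrite /qbin_scalar prodf_seq_eq0; apply/hasP; exists m.+1.
  by rewrite mem_index_iota.
by rewrite /= !subrr mulr0.
Qed.

Lemma qbin_scalar_same (m : nat) : qbin_scalar m m = 1.
Proof.
(* In reverse order the numerators match the denominators. *)
rewrite /qbin_scalar big_split /= [X in _ * X]big_nat_rev /=.
rewrite -big_split big_seq big1 //= => s; rewrite mem_index_iota => /andP[s0 sm].
have -> : m.+1%:Z - (1 + m.+1 - s.+1)%N%:Z = s by lia.
have -> : (1 + m.+1 - s.+1)%N%:Z - m.+1%:Z = - s%:Z by lia.
rewrite mulVf //; apply/eqP => e; have := qint_neq0 v_generic v_neq0 (m := s).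
by rewrite /qint e mul0r eqxx => /(_ ltac:(lia)).
Qed.

Lemma q_binom_bvec t j k :
  q_binom v (K_op v d j 1) (K_op v d j (-1)) k (bvec K t) =
  qbin_scalar (count_mem j t) k *: bvec K t.
Proof.
apply: big_comp_eigen => s; rewrite scale_lfunE add_lfunE opp_lfunE !scale_lfunE.
rewrite !K_op_bvec // !scalerA -scalerBl scalerA -!expfzDr //.
by rewrite mul1r mulN1r; congr (_ * (v ^ _ - v ^ _) *: _); lia.
Qed.

(** Both l and the content of t sum to d. If they differ, some letter occurs in t less often than l
    demands, and its q-binomial vanishes. *)
Lemma idem_op_bvec l t : idem_op v l (bvec K t) = (l == content t)%:R *: bvec K t.
Proof.
rewrite (big_comp_eigen _ (fun j => q_binom_bvec t j (val l j))); congr (_ *: _).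
have [->|lt] := eqVneq l (content t).
  by rewrite big1 // => j _; rewrite contentE qbin_scalar_same.
have [j jlt] : exists j, (count_mem j t < val l j)%N.
  apply: contrapT => no; case/eqP: lt; apply: val_inj; apply/ffunP => j; apply: val_inj.
  have le k : (val l k <= val (content t) k)%N.
    by rewrite contentE leqNgt; apply/negP => h; apply: no; exists k.
  have e : (\sum_i val l i = \sum_i val (content t) i)%N.
    exact: etrans (eqP (valP l)) (esym (eqP (valP (content t)))).
  rewrite (bigD1 j) //= [in RHS](bigD1 j) //= in e.
  apply/eqP; rewrite eqn_leq le /=.
  have : (\sum_(i | i != j) val l i <= \sum_(i | i != j) val (content t) i)%N by apply: leq_sum.
  by move: e => /=; lia.
by apply/eqP; rewrite prodf_seq_eq0; apply/hasP; exists j; rewrite ?mem_index_enum //= qbin_scalar_lt.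
Qed.

Lemma vz_inj (p q : int) : v ^ p = v ^ q -> p = q.
Proof.
move=> e; apply/eqP; rewrite -subr_eq0; apply/negPn/negP => /(vz_generic v_generic v_neq0).
by rewrite expfzDr // e -expfzDr // subrr expr0z eqxx.
Qed.

(** As v is not a root of unity, the exponents can be read off from the eigenvalues of the K_j. *)
Lemma weight_vector_support (c : {ffun 'I_n.+1 -> int}) w :
  (forall j, K_op v d j 1 w = v ^ c j *: w) -> forall t, w t != 0 -> weight (content t) = c.
Proof.
move=> h t wt; apply/ffunP => j; rewrite weight_content.
have := h j; rewrite {1}(span_sum w) linear_sum /= => /ffunP /(_ t).
rewrite sum_ffunE (bigD1 t) //= big1 => [|s /negPf st]; last first.
  by rewrite linearZ /= K_op_bvec // !ffunE eq_sym st !scaler0.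
rewrite addr0 linearZ /= K_op_bvec // !ffunE eqxx mul1r [in RHS]/GRing.scale /=.
by rewrite [in LHS]/GRing.scale /= /GRing.scale /= mulr1 mulrC => /(mulIf wt) /vz_inj.
Qed.

Lemma idem_op_weight (c : {ffun 'I_n.+1 -> int}) w l :
  (forall j, K_op v d j 1 w = v ^ c j *: w) ->
  idem_op v l w = if weight l == c then w else 0.
Proof.
move=> /weight_vector_support h; rewrite {1}(span_sum w) linear_sum /=.
transitivity (\sum_t (weight l == c)%:R *: (w t *: bvec K t)).
  apply: eq_bigr => t _; have [->|/h <-] := eqVneq (w t) 0.
    by rewrite scale0r linear0 scaler0.
  by rewrite linearZ /= idem_op_bvec (inj_eq (@weight_inj _ _)) !scalerA mulrC.
by rewrite -scaler_sumr -span_sum; case: eqP; rewrite ?scale1r ?scale0r.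
Qed.

Lemma weight_vector_eq0 (c : {ffun 'I_n.+1 -> int}) w : to_Lambda d c = None ->
  (forall j, K_op v d j 1 w = v ^ c j *: w) -> w = 0.
Proof.
move=> no /weight_vector_support h; apply/ffunP => t; rewrite ffunE.
by apply/eqP/negPn/negP => /h /weight_to_Lambda; rewrite no.
Qed.

Lemma E_op_weight i t j : K_op v d j 1 (E_op v d i (bvec K t)) =
  v ^ ((weight (content t) + alpha i) j) *: E_op v d i (bvec K t).
Proof.
have /lfunP /(_ (bvec K t)) := K_op_E v_neq0 d j i 1.
rewrite scale_lfunE !comp_lfunE => ->; rewrite K_op_bvec // linearZ /= scalerA -expfzDr //.
congr (v ^ _ *: _); rewrite ffunE weight_content ffunE !mul1r addrC.
by rewrite ![_ == j]eq_sym.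
Qed.

Lemma F_op_weight i t j : K_op v d j 1 (F_op v d i (bvec K t)) =
  v ^ ((weight (content t) - alpha i) j) *: F_op v d i (bvec K t).
Proof.
have /lfunP /(_ (bvec K t)) := K_op_F v_neq0 d j i 1.
rewrite scale_lfunE !comp_lfunE => ->; rewrite K_op_bvec // linearZ /= scalerA -expfzDr //.
congr (v ^ _ *: _); rewrite ffunE weight_content !ffunE !mul1r addrC opprB.
by rewrite ![_ == j]eq_sym.
Qed.

Lemma schur_alg_op : schur_alg v (fun l => idem_op v l : op K n d)
  (fun i => E_op v d i : op K n d) (fun i => F_op v d i : op K n d).
Proof.
have v2 := v_sqr_sub_neq0 v_generic.
have sub_eq (x y c : {ffun 'I_n.+1 -> int}) : (x - y == c) = (x == c + y).
  by apply/eqP/eqP => [<-|->]; rewrite ?subrK ?addrK.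
have inv l m : (l == m) = (weight l == weight m) by rewrite (inj_eq (@weight_inj _ _)).
split.
- move=> l m; apply: hom_tupleP => t; rewrite comp_lfunE idem_op_bvec linearZ /= idem_op_bvec.
  have [<-|lm] := eqVneq l m.
    by rewrite idem_op_bvec; case: eqP; rewrite ?scale1r ?scale0r.
  rewrite zero_lfunE; have [mt|_] := eqVneq m (content t); last by rewrite scale0r.
  by rewrite -mt (negPf lm) scale0r scaler0.
- apply: hom_tupleP => t; rewrite sum_lfunE (bigD1 (content t)) //= big1 => [|l /negPf lt].
    by rewrite addr0 idem_op_bvec eqxx scale1r id_lfunE.
  by rewrite idem_op_bvec lt scale0r.
- move=> i l; apply: hom_tupleP => t; rewrite comp_lfunE idem_op_bvec linearZ /=.
  case C: to_Lambda => [m|].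
    rewrite comp_lfunE (idem_op_weight m (@E_op_weight i t)) (to_Lambda_weight C).
    by rewrite (inj_eq (addIr _)) -inv; case: eqP; rewrite ?scale1r ?scale0r.
  rewrite zero_lfunE; have [e|_] := eqVneq l (content t); last by rewrite scale0r.
  rewrite e in C; by rewrite (weight_vector_eq0 C (@E_op_weight i t)) scaler0.
- move=> i l; apply: hom_tupleP => t; rewrite comp_lfunE idem_op_bvec linearZ /=.
  case C: to_Lambda => [m|].
    rewrite comp_lfunE (idem_op_weight m (@F_op_weight i t)) (to_Lambda_weight C).
    by rewrite (inj_eq (addIr _)) -inv; case: eqP; rewrite ?scale1r ?scale0r.
  rewrite zero_lfunE; have [e|_] := eqVneq l (content t); last by rewrite scale0r.
  rewrite e in C; by rewrite (weight_vector_eq0 C (@F_op_weight i t)) scaler0.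
- move=> i l; apply: hom_tupleP => t; rewrite comp_lfunE.
  rewrite (idem_op_weight l (@E_op_weight i t)); case C: to_Lambda => [m|].
    rewrite comp_lfunE idem_op_bvec linearZ /= inv (to_Lambda_weight C) sub_eq.
    by case: eqP; rewrite ?scale1r ?scale0r.
  rewrite zero_lfunE; case: eqP => // e.
  by move: C; rewrite e addrK (weight_to_Lambda (erefl (weight (content t)))).
- move=> i l; apply: hom_tupleP => t; rewrite comp_lfunE.
  rewrite (idem_op_weight l (@F_op_weight i t)); case C: to_Lambda => [m|].
    rewrite comp_lfunE idem_op_bvec linearZ /= inv (to_Lambda_weight C).
    rewrite [_ + _ == _]eq_sym -(sub_eq (weight (content t))) [_ == weight l]eq_sym.
    by case: eqP; rewrite ?scale1r ?scale0r.
  rewrite zero_lfunE; case: eqP => // e.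
  by move: C; rewrite e subrK (weight_to_Lambda (erefl (weight (content t)))).
- move=> i j; rewrite op_EF //; case: eqP => // <-.
  apply: hom_tupleP => t; rewrite sum_lfunE scale_lfunE add_lfunE opp_lfunE !KK_op_bvec //.
  rewrite (bigD1 (content t)) //= big1 => [|l /negPf lt]; last first.
    by rewrite scale_lfunE idem_op_bvec lt scale0r scaler0.
  rewrite addr0 scale_lfunE idem_op_bvec eqxx scale1r -scalerBl scalerA.
  by rewrite /qint !weight_content mul1r mulN1r mulrC.
- by move=> i j adj; rewrite op_serreE.
- by move=> i j adj; rewrite op_commE.
- by move=> i j adj; rewrite op_serreF.
- by move=> i j adj; rewrite op_commF.
Qed.

Local Notation ev := (eval (@schur_op K v n.+1 d)).

Lemma eval_opM (p q : free_alg K (schur_idx n.+1 d)) :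
  (ev (p * q) : op K n d) = (ev p : op K n d) * ev q.
Proof. exact: evalM. Qed.

Lemma eval_op1 : (ev 1 : op K n d) = 1.
Proof. exact: eval1. Qed.

Lemma rel_ideal_eval (p : free_alg K (schur_idx n.+1 d)) :
  rel_ideal (@schur_rel K v n.+1 d) p -> ev p = 0.
Proof.
have S := schur_alg_op.
have g1 l : (ev (gen_one K l) : op K n d) = idem_op v l by exact: eval_gen.
have gE i : (ev (gen_E K d i) : op K n d) = E_op v d i by exact: eval_gen.
have gF i : (ev (gen_F K d i) : op K n d) = F_op v d i by exact: eval_gen.
have ev0 : (ev 0 : op K n d) = 0 by exact: linear0.
have eM a b x y : (ev a : op K n d) = x -> (ev b : op K n d) = y -> (ev (a * b) : op K n d) = x * y.
  by move=> <- <-; exact: eval_opM.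
have eD a b x y : (ev a : op K n d) = x -> (ev b : op K n d) = y -> (ev (a + b) : op K n d) = x + y.
  by move=> <- <-; exact: linearD.
have eB a b x y : (ev a : op K n d) = x -> (ev b : op K n d) = y -> (ev (a - b) : op K n d) = x - y.
  by move=> <- <-; exact: linearB.
have eZ c a x : (ev a : op K n d) = x -> (ev (c *: a) : op K n d) = c *: x.
  by move=> <-; exact: linearZ.
have eS a b c x y : (ev a : op K n d) = x -> (ev b : op K n d) = y ->
    (ev (a ^+ 2 * b - c *: (a * b * a) + b * a ^+ 2) : op K n d) =
    x ^+ 2 * y - c *: (x * y * x) + y * x ^+ 2.
  move=> ax bx; have ax2 : (ev (a ^+ 2) : op K n d) = x ^+ 2 by exact: (eM _ _ _ _ ax ax).
  exact: (eD _ _ _ _ (eB _ _ _ _ (eM _ _ _ _ ax2 bx) (eZ _ _ _ (eM _ _ _ _ (eM _ _ _ _ ax bx) ax))) (eM _ _ _ _ bx ax2)).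
elim=> {p} [p q pq||p q _ p0 _ q0|p q _ q0|p q _ p0].
- apply: etrans (linearB _ p q) _; apply/eqP; rewrite subr_eq0; apply/eqP.
  case: pq => {p q}.
  + move=> l m; apply: etrans (eM _ _ _ _ (g1 l) (g1 m)) _; rewrite (sa_orth S).
    by case: eqP => _; [exact: (esym (g1 _))|exact: (esym ev0)].
  + apply: etrans _ (esym eval_op1); rewrite -(sa_sum S).
    by apply: etrans (linear_sum _ _ _ _) _; apply: eq_bigr => l _; exact: g1.
  + move=> i l; apply: etrans (eM _ _ _ _ (gE i) (g1 l)) _; rewrite (sa_E_one S).
    by case: to_Lambda => [m|]; [exact: (esym (eM _ _ _ _ (g1 m) (gE i)))|exact: (esym ev0)].
  + move=> i l; apply: etrans (eM _ _ _ _ (gF i) (g1 l)) _; rewrite (sa_F_one S).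
    by case: to_Lambda => [m|]; [exact: (esym (eM _ _ _ _ (g1 m) (gF i)))|exact: (esym ev0)].
  + move=> i l; apply: etrans (eM _ _ _ _ (g1 l) (gE i)) _; rewrite (sa_one_E S).
    by case: to_Lambda => [m|]; [exact: (esym (eM _ _ _ _ (gE i) (g1 m)))|exact: (esym ev0)].
  + move=> i l; apply: etrans (eM _ _ _ _ (g1 l) (gF i)) _; rewrite (sa_one_F S).
    by case: to_Lambda => [m|]; [exact: (esym (eM _ _ _ _ (gF i) (g1 m)))|exact: (esym ev0)].
  + move=> i j; apply: etrans (eB _ _ _ _ (eM _ _ _ _ (gE i) (gF j)) (eM _ _ _ _ (gF j) (gE i))) _.
    rewrite (sa_EF S); case: eqP => _; last exact: (esym ev0).
    apply: esym; apply: etrans (linear_sum _ _ _ _) _.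
    by apply: eq_bigr => l _; exact: (eZ _ _ _ (g1 l)).
  + by move=> i j adj; exact: (etrans (eS _ _ _ _ _ (gE i) (gE j)) (etrans (sa_serreE S adj) (esym ev0))).
  + move=> i j adj; apply: etrans (eB _ _ _ _ (eM _ _ _ _ (gE i) (gE j)) (eM _ _ _ _ (gE j) (gE i))) _.
    exact: (etrans (sa_commE S adj) (esym ev0)).
  + by move=> i j adj; exact: (etrans (eS _ _ _ _ _ (gF i) (gF j)) (etrans (sa_serreF S adj) (esym ev0))).
  + move=> i j adj; apply: etrans (eB _ _ _ _ (eM _ _ _ _ (gF i) (gF j)) (eM _ _ _ _ (gF j) (gF i))) _.
    exact: (etrans (sa_commF S adj) (esym ev0)).
- exact: ev0.
- by apply: etrans (eD _ _ _ _ p0 q0) _; exact: addr0.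
- by apply: etrans (eM _ _ _ _ erefl q0) _; exact: mulr0.
- by apply: etrans (eM _ _ _ _ p0 erefl) _; exact: mul0r.
Qed.

End OperatorRelations.

(** * The commuting action of the Hecke algebra *)

Section HeckeCommutation.
Variables (K : fieldType) (v : K).
Hypothesis v_neq0 : v != 0.

#[local] Arguments K_op : simpl never.
#[local] Arguments E_op : simpl never.
#[local] Arguments F_op : simpl never.

Section Places.
Variable n : nat.
Implicit Types (a b : 'I_n.+1).

Definition tens2 d a b (w : tpower K n.+1 d) : tpower K n.+1 d.+2 :=
  tensv (bvec K a) (tensv (bvec K b) w).

Lemma tens2_sum (I : finType) d a b (c : I -> K) (f : I -> tpower K n.+1 d) :
  tens2 a b (\sum_i c i *: f i) = \sum_i c i *: tens2 a b (f i).
Proof.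
rewrite /tens2 tensv_sumr tensv_sumr; apply: eq_bigr => i _.
by rewrite !tensvZr.
Qed.

Lemma tens2_bvec d a b (t : d.-tuple 'I_n.+1) :
  tens2 a b (bvec K t) = bvec K [tuple of a :: [tuple of b :: t]].
Proof. by rewrite !bvec_cons. Qed.

(** Together with [T_op_head] this reduces commutation with T_r, by induction on d, to the first two
    tensor places. *)
Lemma T_op_tail d (r : 'I_d.-1) :
  @T_op K v n.+1 d.+1 (nxt r) = tensop \1%VF (@T_op K v n.+1 d r).
Proof.
apply: hom_consP => a t; rewrite tensopE id_lfunE -bvec_cons !lin_extE /=.
have tn (s : d.-tuple 'I_n.+1) (i : 'I_d) : tnth [tuple of a :: s] (lift ord0 i) = tnth s i.
  exact: tnthS.
have -> : pos (nxt r : 'I_d.+1.-1) = lift ord0 (pos r) by apply: val_inj.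
have -> : nxt (nxt r : 'I_d.+1.-1) = lift ord0 (nxt r) by apply: val_inj.
rewrite !tn.
have -> : swap_places (nxt r : 'I_d.+1.-1) [tuple of a :: t] = [tuple of a :: swap_places r t].
  apply: eq_from_tnth => k; rewrite tnth_mktuple.
  have -> : pos (nxt r : 'I_d.+1.-1) = lift ord0 (pos r) by apply: val_inj.
  have -> : nxt (nxt r : 'I_d.+1.-1) = lift ord0 (nxt r) by apply: val_inj.
  have [j ->|->] := unliftP ord0 k.
    rewrite -inj_tperm; last exact: lift_inj.
    apply: etrans (tn t _) _; apply: etrans _ (esym (tn _ _)).
    by rewrite tnth_mktuple.
  by rewrite tpermD ?neq_lift // eq_sym neq_lift.
by case: eqP => _; [|case: ltnP => _];
  rewrite ?tensvDr ?tensvZr !bvec_cons.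
Qed.

Lemma T_op_head d a b (w : tpower K n.+1 d) :
  @T_op K v n.+1 d.+2 ord0 (tens2 a b w) =
  if a == b then v *: tens2 a b w
  else if (a < b)%N then tens2 b a w
  else tens2 b a w + (v - v^-1) *: tens2 a b w.
Proof.
rewrite [in LHS](span_sum w) tens2_sum linear_sum /=.
have H t : @T_op K v n.+1 d.+2 ord0 (tens2 a b (bvec K t)) =
    if a == b then v *: tens2 a b (bvec K t)
    else if (a < b)%N then tens2 b a (bvec K t)
    else tens2 b a (bvec K t) + (v - v^-1) *: tens2 a b (bvec K t).
  rewrite !tens2_bvec lin_extE /=.
  have -> : tnth [tuple of a :: [tuple of b :: t]] (pos (ord0 : 'I_d.+2.-1)) = a by [].
  have -> : tnth [tuple of a :: [tuple of b :: t]] (nxt (ord0 : 'I_d.+2.-1)) = b by [].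
  have -> // : swap_places (ord0 : 'I_d.+2.-1) [tuple of a :: [tuple of b :: t]] =
      [tuple of b :: [tuple of a :: t]].
  apply: eq_from_tnth => k; rewrite tnth_mktuple.
  case: tpermP => [->|->|/eqP k0 /eqP k1] //.
  have [j jk|k0'] := unliftP ord0 k; last by rewrite k0' in k0.
  have [j' jj|j0] := unliftP ord0 j; last by rewrite jk j0 in k1.
  by rewrite jk jj !(tnth_nth a).
transitivity (\sum_t w t *: (if a == b then v *: tens2 a b (bvec K t)
    else if (a < b)%N then tens2 b a (bvec K t)
    else tens2 b a (bvec K t) + (v - v^-1) *: tens2 a b (bvec K t))).
  by apply: eq_bigr => t _; rewrite linearZ /= H.
case: eqP => _; [|case: ltnP => _]; rewrite [in RHS](span_sum w) !tens2_sum //.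
  by rewrite scaler_sumr; apply: eq_bigr => t _; rewrite !scalerA mulrC.
rewrite scaler_sumr -big_split; apply: eq_bigr => t _ /=.
by rewrite scalerDr !scalerA mulrC.
Qed.

Lemma hom_tens2P d (V : vectType K) (f g : 'Hom(tpower K n.+1 d.+2, V)) :
  (forall a b (t : d.-tuple 'I_n.+1), f (tens2 a b (bvec K t)) = g (tens2 a b (bvec K t))) -> f = g.
Proof.
move=> h; apply: hom_consP => a t; case/tupleP: t => b t.
by rewrite bvec_cons; exact: h.
Qed.

Lemma K_op_tens2 d j z a b w :
  K_op v d.+2 j z (tens2 a b w) = v ^ (z * ((a == j)%:Z + (b == j)%:Z)) *: tens2 a b (K_op v d j z w).
Proof.
rewrite /tens2 /K_op -/(K_op v d j z) !tensopE !Kv_bvec // tensvZl tensvZl tensvZr scalerA -expfzDr //.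
by rewrite mulrDr.
Qed.

Lemma T_op_K d (r : 'I_d.-1) j z :
  (@T_op K v n.+1 d r \o K_op v d j z = K_op v d j z \o @T_op K v n.+1 d r)%VF.
Proof.
elim: d r => [|[|d] IHd] r; [by case: r | by case: r |].
have [r' ->|->] := unliftP ord0 r.
  have -> : lift ord0 r' = nxt (r' : 'I_d.+1.-1) by apply: val_inj.
  by rewrite T_op_tail /K_op -/(K_op v d.+1 j z) !tensop_comp comp_lfun1l comp_lfun1r (IHd r').
apply: hom_tens2P => a b t; rewrite !comp_lfunE K_op_tens2 linearZ /= !T_op_head.
have [->|_] := eqVneq a b.
  by rewrite [in RHS]linearZ /= K_op_tens2 !scalerA mulrC.
case: ltnP => _; rewrite ?[in RHS]linearD ?[in RHS]linearZ /= !K_op_tens2.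
  by rewrite [(b == j)%:Z + _]addrC.
by rewrite [(b == j)%:Z + _]addrC scalerDr; congr (_ + _); rewrite !scalerA mulrC.
Qed.

Lemma T_op_KK d (r : 'I_d.-1) j z :
  (@T_op K v n.+1 d r \o KK_op v d j z = KK_op v d j z \o @T_op K v n.+1 d r)%VF.
Proof. by rewrite /KK_op comp_lfunA T_op_K -!comp_lfunA T_op_K. Qed.

Lemma E_op_tens2 d i a b (t : d.-tuple 'I_n.+1) :
  E_op v d.+2 i (tens2 a b (bvec K t)) =
  v ^ ((count_mem (pos i) t)%:Z - (count_mem (nxt i) t)%:Z) *:
   (((a == nxt i)%:R * v ^ ((b == pos i)%:Z - (b == nxt i)%:Z)) *: tens2 (pos i) b (bvec K t)
     + (b == nxt i)%:R *: tens2 a (pos i) (bvec K t))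
  + tens2 a b (E_op v d i (bvec K t)).
Proof.
rewrite tens2_bvec E_op_cons // E_op_cons // tensvDr tensvZr -!bvec_cons -!tens2_bvec.
rewrite addrA scalerDr !scalerA -mulrCA; congr (_ + _ + _).
  congr (_ * _ *: _); rewrite -expfzDr //=; congr (v ^ _); lia.
by rewrite mulrC.
Qed.

Lemma F_op_tens2 d i a b (t : d.-tuple 'I_n.+1) :
  F_op v d.+2 i (tens2 a b (bvec K t)) =
  (a == pos i)%:R *: tens2 (nxt i) b (bvec K t) +
  v ^ ((a == nxt i)%:Z - (a == pos i)%:Z) *: ((b == pos i)%:R *: tens2 a (nxt i) (bvec K t) +
   v ^ ((b == nxt i)%:Z - (b == pos i)%:Z) *: tens2 a b (F_op v d i (bvec K t))).
Proof.
rewrite tens2_bvec F_op_cons // F_op_cons // tensvDr !tensvZr -!bvec_cons -!tens2_bvec.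
by [].
Qed.

Section RMatrix.
Variables (I U : finType) (TT : 'I_n.+1 -> 'I_n.+1 -> span_on K U -> span_on K I).
Variables (T X : span_on K I -> span_on K I) (i : 'I_n.+1.-1) (c : K) (u w : span_on K U).
Hypotheses (TD : forall x y, T (x + y) = T x + T y) (TZ : forall k x, T (k *: x) = k *: T x).
Hypotheses (XD : forall x y, X (x + y) = X x + X y) (XZ : forall k x, X (k *: x) = k *: X x).
Hypothesis TE : forall a b x, T (TT a b x) = if a == b then v *: TT a b x
  else if (a < b)%N then TT b a x else TT b a x + (v - v^-1) *: TT a b x.

Let scale_o (x : K) (y : K^o) : x *: y = x * y :> K.
Proof. by []. Qed.

Ltac R_matrix_solve XS OS :=
  rewrite ?XS; repeat (progress rewrite ?(TD, TZ, TE, XD, XZ) ?OS ?XS /=);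
  first [done | apply/ffunP => k; rewrite !ffunE ?scale_o; field; done].

Ltac R_matrix_generic eqs lts g XS :=
  case: (lts _ g) => -[]; let o := fresh in intro o;
  R_matrix_solve XS (eqs _ g, o).

Ltac R_matrix_entry XE hs :=
  by rewrite XE ?hs ?(scale1r, scale0r, scaler0, mul0r, mul1r, add0r, addr0, sub0r, subr0, subrr).

Let generic x := (x != pos i) && (x != nxt i).

Let letters_lt : [/\ (pos i < nxt i)%N, (nxt i < pos i)%N = false,
  (pos i == nxt i) = false & (nxt i == pos i) = false].
Proof. by rewrite [nxt i == _]eq_sym pos_neq_nxt /= ltnSn ltnNge leqnSn. Qed.

Let generic_neq x : generic x -> ((x == pos i) = false) * ((x == nxt i) = false) *
  ((pos i == x) = false) * ((nxt i == x) = false).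
Proof. by rewrite ![_ == x]eq_sym => /andP[/negPf -> /negPf ->]. Qed.

(** The letters i and i + 1 are neighbours, so any third letter lies on the same side of both, and
    one Boolean decides four comparisons. *)
Let generic_lt x : generic x -> {e : bool & ((x < pos i)%N = e) * ((x < nxt i)%N = e) *
  ((pos i < x)%N = ~~ e) * ((nxt i < x)%N = ~~ e)}%type.
Proof.
by move=> H; exists (x < pos i)%N; do !split; move: H; rewrite /generic -!val_eqE /=; lia.
Qed.

Let letter_cases x : [\/ x = pos i, x = nxt i | generic x].
Proof.
rewrite /generic; have [->|_] := eqVneq x (pos i); first by constructor.
by have [->|_] := eqVneq x (nxt i); constructor.
Qed.

(** The remaining tensor places enter only through u, its image w under E_i, and the eigenvalue c of
    K_i K_(i+1)^-1 on u. What is left is a finite check on two places, each holding i, i + 1 or a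
    generic letter. *)
Lemma R_matrix_E (p := pos i) (q := nxt i) :
  (forall a b, X (TT a b u) = c *:
     (((a == q)%:R * v ^ ((b == p)%:Z - (b == q)%:Z)) *: TT p b u
     + (b == q)%:R *: TT a p u) + TT a b w) ->
  forall a b, T (X (TT a b u)) = X (T (TT a b u)).
Proof.
move=> XE a b; move: letters_lt generic_neq generic_lt letter_cases.
rewrite -/p -/q; clearbody p q => -[pq qp npq nqp] genP ord sc.
have Xqq  : X (TT q q u) = c *: (v^-1 *: TT p q u + TT q p u) + TT q q w.
  R_matrix_entry XE (eqxx, npq, nqp).
have Xqp  : X (TT q p u) = c *: (v *: TT p p u) + TT q p w.
  R_matrix_entry XE (eqxx, npq, nqp).
have Xpq  : X (TT p q u) = c *: TT p p u + TT p q w.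
  R_matrix_entry XE (eqxx, npq, nqp).
have Xpp  : X (TT p p u) = TT p p w.
  R_matrix_entry XE (eqxx, npq, nqp).
have Xqx x : generic x -> X (TT q x u) = c *: TT p x u + TT q x w.
  move=> gx; R_matrix_entry XE (eqxx, npq, nqp, genP _ gx).
have Xpx x : generic x -> X (TT p x u) = TT p x w.
  move=> gx; R_matrix_entry XE (eqxx, npq, nqp, genP _ gx).
have Xxq x : generic x -> X (TT x q u) = c *: TT x p u + TT x q w.
  move=> gx; R_matrix_entry XE (eqxx, npq, nqp, genP _ gx).
have Xxp x : generic x -> X (TT x p u) = TT x p w.
  move=> gx; R_matrix_entry XE (eqxx, npq, nqp, genP _ gx).
have Xxy x y : generic x -> generic y -> X (TT x y u) = TT x y w.
  move=> gx gy; R_matrix_entry XE (eqxx, npq, nqp, genP _ gx, genP _ gy).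
have [->|->|ga] := sc a; have [->|->|gb] := sc b.
- R_matrix_solve Xpp (eqxx, npq, pq, nqp, qp).
- R_matrix_solve (Xpp, Xpq, Xqp, Xqq) (eqxx, npq, pq, nqp, qp).
- R_matrix_generic genP ord gb (Xpx _ gb, Xxp _ gb, Xqx _ gb, Xxq _ gb).
- R_matrix_solve (Xpp, Xpq, Xqp, Xqq) (eqxx, npq, pq, nqp, qp).
- R_matrix_solve Xqq (eqxx, npq, pq, nqp, qp).
- R_matrix_generic genP ord gb (Xpx _ gb, Xxp _ gb, Xqx _ gb, Xxq _ gb).
- R_matrix_generic genP ord ga (Xpx _ ga, Xxp _ ga, Xqx _ ga, Xxq _ ga).
- R_matrix_generic genP ord ga (Xpx _ ga, Xxp _ ga, Xqx _ ga, Xxq _ ga).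
rewrite Xxy // !TE; case: ifP => _; first by rewrite XZ Xxy.
by case: ifP => _; rewrite ?XD ?XZ !Xxy.
Qed.

Lemma R_matrix_F (p := pos i) (q := nxt i) :
  (forall a b, X (TT a b u) = (a == p)%:R *: TT q b u +
     v ^ ((a == q)%:Z - (a == p)%:Z) *: ((b == p)%:R *: TT a q u +
       v ^ ((b == q)%:Z - (b == p)%:Z) *: TT a b w)) ->
  forall a b, T (X (TT a b u)) = X (T (TT a b u)).
Proof.
move=> XE a b; move: letters_lt generic_neq generic_lt letter_cases.
rewrite -/p -/q; clearbody p q => -[pq qp npq nqp] genP ord sc.
have Xpp  : X (TT p p u) = TT q p u + v^-1 *: (TT p q u + v^-1 *: TT p p w).
  R_matrix_entry XE (eqxx, npq, nqp).
have Xpq  : X (TT p q u) = TT q q u + v^-1 *: (v *: TT p q w).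
  R_matrix_entry XE (eqxx, npq, nqp).
have Xqp  : X (TT q p u) = v *: (TT q q u + v^-1 *: TT q p w).
  R_matrix_entry XE (eqxx, npq, nqp).
have Xqq  : X (TT q q u) = v *: (v *: TT q q w).
  R_matrix_entry XE (eqxx, npq, nqp).
have Xpx x : generic x -> X (TT p x u) = TT q x u + v^-1 *: TT p x w.
  move=> gx; R_matrix_entry XE (eqxx, npq, nqp, genP _ gx).
have Xqx x : generic x -> X (TT q x u) = v *: TT q x w.
  move=> gx; R_matrix_entry XE (eqxx, npq, nqp, genP _ gx).
have Xxp x : generic x -> X (TT x p u) = TT x q u + v^-1 *: TT x p w.
  move=> gx; R_matrix_entry XE (eqxx, npq, nqp, genP _ gx).
have Xxq x : generic x -> X (TT x q u) = v *: TT x q w.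
  move=> gx; R_matrix_entry XE (eqxx, npq, nqp, genP _ gx).
have Xxy x y : generic x -> generic y -> X (TT x y u) = TT x y w.
  move=> gx gy; R_matrix_entry XE (eqxx, npq, nqp, genP _ gx, genP _ gy).
have [->|->|ga] := sc a; have [->|->|gb] := sc b.
- R_matrix_solve Xpp (eqxx, npq, pq, nqp, qp).
- R_matrix_solve (Xpp, Xpq, Xqp, Xqq) (eqxx, npq, pq, nqp, qp).
- R_matrix_generic genP ord gb (Xpx _ gb, Xxp _ gb, Xqx _ gb, Xxq _ gb).
- R_matrix_solve (Xpp, Xpq, Xqp, Xqq) (eqxx, npq, pq, nqp, qp).
- R_matrix_solve Xqq (eqxx, npq, pq, nqp, qp).
- R_matrix_generic genP ord gb (Xpx _ gb, Xxp _ gb, Xqx _ gb, Xxq _ gb).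
- R_matrix_generic genP ord ga (Xpx _ ga, Xxp _ ga, Xqx _ ga, Xxq _ ga).
- R_matrix_generic genP ord ga (Xpx _ ga, Xxp _ ga, Xqx _ ga, Xxq _ ga).
rewrite Xxy // !TE; case: ifP => _; first by rewrite XZ Xxy.
by case: ifP => _; rewrite ?XD ?XZ !Xxy.
Qed.

End RMatrix.

Lemma T_op_E d (r : 'I_d.-1) i :
  (@T_op K v n.+1 d r \o E_op v d i = E_op v d i \o @T_op K v n.+1 d r)%VF.
Proof.
elim: d r => [|[|d] IHd] r; [by case: r | by case: r |].
have [r' ->|->] := unliftP ord0 r.
  have -> : lift ord0 r' = nxt (r' : 'I_d.+1.-1) by apply: val_inj.
  rewrite T_op_tail (E_opS v d.+1 i) comp_lfunDr comp_lfunDl !tensop_comp.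
  by rewrite !comp_lfun1l !comp_lfun1r T_op_KK (IHd r').
apply: hom_tens2P => a b t; rewrite !comp_lfunE.
move: a b; apply: (@R_matrix_E _ _ (@tens2 d) _ _ i _ _ (E_op v d i (bvec K t))).
- by move=> x y; exact: linearD.
- by move=> k x; exact: linearZ.
- by move=> x y; exact: linearD.
- by move=> k x; exact: linearZ.
- by move=> a b x; exact: T_op_head.
by move=> a b; exact: E_op_tens2.
Qed.

Lemma T_op_F d (r : 'I_d.-1) i :
  (@T_op K v n.+1 d r \o F_op v d i = F_op v d i \o @T_op K v n.+1 d r)%VF.
Proof.
elim: d r => [|[|d] IHd] r; [by case: r | by case: r |].
have [r' ->|->] := unliftP ord0 r.
  have -> : lift ord0 r' = nxt (r' : 'I_d.+1.-1) by apply: val_inj.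
  rewrite T_op_tail /F_op -/(F_op v d.+1 i) comp_lfunDr comp_lfunDl !tensop_comp.
  by rewrite !comp_lfun1l !comp_lfun1r (IHd r').
apply: hom_tens2P => a b t; rewrite !comp_lfunE.
move: a b; apply: (@R_matrix_F _ _ (@tens2 d) _ _ i _ (F_op v d i (bvec K t))).
- by move=> x y; exact: linearD.
- by move=> k x; exact: linearZ.
- by move=> x y; exact: linearD.
- by move=> k x; exact: linearZ.
- by move=> a b x; exact: T_op_head.
by move=> a b; exact: F_op_tens2.
Qed.

(** T_r commutes with the K_j and so preserves weight spaces. *)
Lemma T_op_idem (v_generic : forall k : nat, (0 < k)%N -> v ^+ k != 1) d
    (r : 'I_d.-1) (l : Lambda n.+1 d) :
  (@T_op K v n.+1 d r \o idem_op v l = idem_op v l \o @T_op K v n.+1 d r)%VF.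
Proof.
apply: hom_tupleP => t; rewrite !comp_lfunE idem_op_bvec // linearZ /=.
rewrite (idem_op_weight v_generic v_neq0 (c := weight (content t))); last first.
  move=> j; have /lfunP /(_ (bvec K t)) := T_op_K r j 1.
  rewrite !comp_lfunE => <-; rewrite K_op_bvec // linearZ /= mul1r.
  by rewrite weight_content.
by rewrite (inj_eq (@weight_inj _ _)); case: eqP; rewrite ?scale1r ?scale0r.
Qed.

End Places.

End HeckeCommutation.

(** * The presented algebra *)

Section FreeAlgebra.
Variables (K : fieldType) (X : choiceType).

Lemma free_alg_ind (P : free_alg K X -> Prop) :
  P 1 -> (forall p q, P p -> P q -> P (p + q)) -> (forall (c : K) p, P p -> P (c *: p)) ->
  (forall x p, P p -> P (fgen K x * p)) -> forall p, P p.
Proof.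
move=> P1 PD PZ PM.
have P0 : P 0 by rewrite -(scale0r (1 : free_alg K X)); apply: PZ.
have PU (m : {fmonom X}) : P << m >>.
  case: m => s; elim: s => [|x s IHs].
    by have -> : << FMonom [::] >> = 1 :> free_alg K X by rewrite -(fmoneE X).
  suff -> : (<< FMonom (x :: s) >> : free_alg K X) = fgen K x * << FMonom s >> by apply: PM.
  rewrite [RHS]malgME !msuppU !oner_eq0 big_seq_fset1 big_seq_fset1 !mcoeffUU mulr1.
  by rewrite [mmul _ _]fmmulE fmuE.
move=> p; rewrite (monalgE p); elim/big_ind: _ => // m _.
have -> : << p@_m *g m >> = p@_m *: << m >> :> free_alg K X.
  apply/malgP => k; apply: etrans (mcoeffU _ _ _) _.
  apply: etrans _ (esym (mcoeffZ _ _ _)); rewrite [X in _ = _ * X]mcoeffU.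
  by rewrite mulr_natr.
exact/PZ/PU.
Qed.

(** The constant [c%:MP] commutes with the generators, hence with all words. *)
Lemma free_alg_scalerAr (c : K) (p q : free_alg K X) : c *: (p * q) = p * (c *: q).
Proof.
have comm x : fgen K x * c%:MP = c%:MP * fgen K x :> free_alg K X.
  have [->|c0] := eqVneq c 0; first by rewrite malgC0E mulr0 mul0r.
  rewrite [LHS]malgME [RHS]malgME !msuppU oner_eq0 (negPf c0) !big_seq_fset1.
  by rewrite !mcoeffUU mulr1 mul1r mulm1 mul1m.
have MC z : c%:MP * z = c *: z :> free_alg K X := mul_malgC c z.
have h : forall z : free_alg K X, z * c%:MP = c *: z.
  apply: free_alg_ind.
  - exact: etrans (mul1r _) (etrans (esym (mulr1 _)) (MC 1)).
  - move=> z z' hz hz'; apply: etrans (mulrDl z z' _) _.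
    by rewrite hz hz'; exact: esym (scalerDr c z z').
  - move=> k z hz; apply: etrans (esym (scalerAl k z _)) _; rewrite hz.
    by apply: etrans (scalerA _ _ _) _; rewrite mulrC; exact: esym (scalerA _ _ _).
  - move=> x z hz; apply: etrans (esym (mulrA _ _ _)) _; rewrite hz -(MC z).
    apply: etrans (mulrA _ _ _) _; rewrite comm.
    by apply: etrans (esym (mulrA _ _ _)) _; exact: MC.
apply: etrans (scalerAl c p q) _; rewrite -(h p).
by apply: etrans (esym (mulrA _ _ _)) _; rewrite (MC q).
Qed.

End FreeAlgebra.

(** * The quotient of the free algebra by the ideal of relations *)

Section Presentation.
Variables (K : fieldType) (X : choiceType).
Variable R : free_alg K X -> free_alg K X -> Prop.
Hypothesis nontrivial : ~ rel_ideal R 1.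
Local Notation A := (free_alg K X).
Implicit Types p q r : A.

Lemma rel_idealZ (c : K) p : rel_ideal R p -> rel_ideal R (c *: p).
Proof. by move=> h; rewrite -[p]mul1r scalerAl; apply: Ideal_mull. Qed.

Lemma rel_idealN p : rel_ideal R p -> rel_ideal R (- p).
Proof. by move=> h; rewrite -scaleN1r; apply: rel_idealZ. Qed.

Definition ideal_rel p q : bool := `[< rel_ideal R (p - q) >].

Lemma ideal_rel_refl : reflexive ideal_rel.
Proof. by move=> p; apply/asboolP; rewrite subrr; apply: Ideal_0. Qed.

Lemma ideal_rel_sym : symmetric ideal_rel.
Proof.
by move=> p q; apply/asboolP/asboolP => h; rewrite -opprB; apply: rel_idealN.
Qed.

Lemma ideal_rel_trans : transitive ideal_rel.
Proof.
move=> q p r /asboolP h1 /asboolP h2; apply/asboolP.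
by rewrite -[p](subrK q) -addrA; apply: Ideal_add.
Qed.

Canonical ideal_equiv := EquivRel ideal_rel ideal_rel_refl ideal_rel_sym ideal_rel_trans.

(* The hypothesis only serves to make the quotient a nontrivial ring. *)
Definition presented_alg of ~ rel_ideal R 1 : Type := {eq_quot ideal_equiv}%qT.
Local Notation Q := (presented_alg nontrivial).

HB.instance Definition _ := Choice.on Q.

Definition class_of p : Q := (\pi_({eq_quot ideal_equiv}) p)%qT.
Definition repr_of (x : Q) : A := generic_quotient.repr (x : {eq_quot ideal_equiv}%qT).

Lemma repr_ofK x : class_of (repr_of x) = x.
Proof. exact: generic_quotient.reprK. Qed.

Lemma class_ofP p q : class_of p = class_of q <-> rel_ideal R (p - q).
Proof.
split=> [/(@eqmodP _ ideal_equiv p q) /asboolP //|h].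
exact/(@eqmodP _ ideal_equiv p q)/asboolP.
Qed.

Lemma repr_class p : rel_ideal R (p - repr_of (class_of p)).
Proof. by apply/class_ofP; rewrite repr_ofK. Qed.

Lemma class_ind (P : Q -> Prop) : (forall p, P (class_of p)) -> forall x, P x.
Proof. by move=> h x; rewrite -(repr_ofK x). Qed.

Definition cadd (x y : Q) : Q := class_of (repr_of x + repr_of y).
Definition copp (x : Q) : Q := class_of (- repr_of x).
Definition cmul (x y : Q) : Q := class_of (repr_of x * repr_of y).
Definition cscale (c : K) (x : Q) : Q := class_of (c *: repr_of x).

Lemma caddE p q : cadd (class_of p) (class_of q) = class_of (p + q).
Proof.
apply/esym/class_ofP; rewrite opprD addrACA.
by apply: Ideal_add; exact: repr_class.
Qed.

Lemma coppE p : copp (class_of p) = class_of (- p).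
Proof. by apply/esym/class_ofP; rewrite -opprD; apply: rel_idealN; exact: repr_class. Qed.

Lemma cmulE p q : cmul (class_of p) (class_of q) = class_of (p * q).
Proof.
apply/esym/class_ofP; set p' := repr_of _; set q' := repr_of _.
have -> : p * q - p' * q' = (p - p') * q + p' * (q - q') by rewrite mulrBl mulrBr addrA subrK.
apply: Ideal_add; first by apply: Ideal_mulr; exact: repr_class.
by apply: Ideal_mull; exact: repr_class.
Qed.

Lemma cscaleE c p : cscale c (class_of p) = class_of (c *: p).
Proof. by apply/esym/class_ofP; rewrite -scalerBr; apply: rel_idealZ; exact: repr_class. Qed.

Lemma caddA : associative cadd.
Proof. by elim/class_ind => p; elim/class_ind => q; elim/class_ind => r; rewrite !caddE addrA. Qed.

Lemma caddC : commutative cadd.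
Proof. by elim/class_ind => p; elim/class_ind => q; rewrite !caddE addrC. Qed.

Lemma cadd0 : left_id (class_of 0) cadd.
Proof. by elim/class_ind => p; rewrite !caddE add0r. Qed.

Lemma caddN : left_inverse (class_of 0) copp cadd.
Proof. by elim/class_ind => p; rewrite coppE caddE addNr. Qed.

HB.instance Definition _ := GRing.isZmodule.Build Q caddA caddC cadd0 caddN.

Lemma class_ofD p q : class_of (p + q) = class_of p + class_of q.
Proof. exact: esym (caddE p q). Qed.

Lemma cmulA : associative cmul.
Proof. by elim/class_ind => p; elim/class_ind => q; elim/class_ind => r; rewrite !cmulE mulrA. Qed.

Lemma cmul1 : left_id (class_of 1) cmul.
Proof. by elim/class_ind => p; rewrite cmulE mul1r. Qed.

Lemma cmulr1 : right_id (class_of 1) cmul.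
Proof. by elim/class_ind => p; rewrite cmulE mulr1. Qed.

Lemma cmulDl : left_distributive cmul +%R.
Proof.
elim/class_ind => p; elim/class_ind => q; elim/class_ind => r.
by rewrite -class_ofD !cmulE -class_ofD mulrDl.
Qed.

Lemma cmulDr : right_distributive cmul +%R.
Proof.
elim/class_ind => p; elim/class_ind => q; elim/class_ind => r.
by rewrite -class_ofD !cmulE -class_ofD mulrDr.
Qed.

Lemma class_of1_neq0 : class_of 1 != 0 :> Q.
Proof. by apply/eqP => /class_ofP; rewrite subr0. Qed.

HB.instance Definition _ := GRing.Zmodule_isNzRing.Build Q
  cmulA cmul1 cmulr1 cmulDl cmulDr class_of1_neq0.

Lemma cscaleA a b x : cscale a (cscale b x) = cscale (a * b) x.
Proof. by move: x; elim/class_ind => p; rewrite !cscaleE scalerA. Qed.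

Lemma cscale1 : left_id 1 cscale.
Proof. by elim/class_ind => p; rewrite !cscaleE scale1r. Qed.

Lemma cscaleDr : right_distributive cscale +%R.
Proof.
move=> a; elim/class_ind => p; elim/class_ind => q.
by rewrite -class_ofD !cscaleE -class_ofD scalerDr.
Qed.

Lemma cscaleDl x : {morph cscale^~ x : a b / a + b}.
Proof.
move=> a b; move: x; elim/class_ind => p.
by rewrite !cscaleE -class_ofD scalerDl.
Qed.

HB.instance Definition _ := GRing.Zmodule_isLmodule.Build K Q
  cscaleA cscale1 cscaleDr cscaleDl.

Lemma class_ofZ c p : class_of (c *: p) = c *: class_of p.
Proof. exact: esym (cscaleE c p). Qed.

Lemma class_ofM p q : class_of (p * q) = class_of p * class_of q.
Proof. exact: esym (cmulE p q). Qed.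

Lemma class_of0 : class_of 0 = 0. Proof. by []. Qed.

Lemma class_ofB p q : class_of (p - q) = class_of p - class_of q.
Proof. by rewrite -[- q]scaleN1r class_ofD class_ofZ scaleN1r. Qed.

Lemma cscaleAl (c : K) (x y : Q) : c *: (x * y) = c *: x * y.
Proof.
move: x y; elim/class_ind => p; elim/class_ind => q.
by rewrite -class_ofM -!class_ofZ -class_ofM scalerAl.
Qed.

HB.instance Definition _ := GRing.Lmodule_isLalgebra.Build K Q cscaleAl.

Lemma cscaleAr (c : K) (x y : Q) : c *: (x * y) = x * (c *: y).
Proof.
move: x y; elim/class_ind => p; elim/class_ind => q.
by rewrite -class_ofM -!class_ofZ -class_ofM free_alg_scalerAr.
Qed.

HB.instance Definition _ := GRing.Lalgebra_isAlgebra.Build K Q cscaleAr.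

End Presentation.

Section SchurPresentation.
Variables (K : fieldType) (v : K).
Hypothesis v_generic : forall k : nat, (0 < k)%N -> v ^+ k != 1.
Hypothesis v_neq0 : v != 0.
Variables n d : nat.
Local Notation FA := (free_alg K (schur_idx n.+1 d)).
Local Notation RI := (rel_ideal (@schur_rel K v n.+1 d)).
Local Notation ev := (eval (@schur_op K v n.+1 d)).

(** The ideal evaluates to 0 on the tensor power, whose identity is not 0. *)
Lemma schur_rel_nontrivial : ~ RI 1.
Proof.
move=> h; have := rel_ideal_eval v_generic v_neq0 h.
by rewrite eval1 => /eqP; rewrite (negPf (id_op_neq0 K n d)).
Qed.

Local Notation Q := (presented_alg schur_rel_nontrivial).
Local Notation cl := (@class_of _ _ _ schur_rel_nontrivial).

Lemma schur_alg_presented : schur_alg v (fun l => cl (gen_one K l) : Q)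
  (fun i => cl (gen_E K d i)) (fun i => cl (gen_F K d i)).
Proof.
have rel (p q : FA) : schur_rel v p q -> cl p = cl q.
  by move=> h; apply/class_ofP/Ideal_rel.
have cM (p q : FA) : cl p * cl q = cl (p * q) by exact: esym (class_ofM _ p q).
have cB (p q : FA) : cl p - cl q = cl (p - q) by exact: esym (class_ofB _ p q).
have cD (p q : FA) : cl p + cl q = cl (p + q) by exact: esym (class_ofD _ p q).
have cZ c (p : FA) : c *: cl p = cl (c *: p) by exact: esym (class_ofZ _ c p).
have csum (I : finType) (f : I -> FA) : \sum_i cl (f i) = cl (\sum_i f i).
  by apply: esym; apply: (big_morph cl) => //; exact: class_ofD.
have cserre (c : K) (p q : FA) : cl p ^+ 2 * cl q - c *: (cl p * cl q * cl p) + cl q * cl p ^+ 2 =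
    cl (p ^+ 2 * q - c *: (p * q * p) + q * p ^+ 2).
  have p2 : cl p ^+ 2 = cl (p ^+ 2) := cM p p.
  have t1 : cl p ^+ 2 * cl q = cl (p ^+ 2 * q) by rewrite p2; exact: cM.
  have t2 : c *: (cl p * cl q * cl p) = cl (c *: (p * q * p)).
    exact: (etrans (congr1 (fun x => c *: x) (etrans (congr1 (fun x => x * cl p) (cM p q))
      (cM (p * q) p))) (cZ c (p * q * p))).
  have t3 : cl q * cl p ^+ 2 = cl (q * p ^+ 2) by rewrite p2; exact: cM.
  apply: etrans (congr2 (fun x y => x + y) (congr2 (fun x y => x - y) t1 t2) t3) _.
  exact: (etrans (congr1 (fun x => x + cl (q * p ^+ 2)) (cB (p ^+ 2 * q) (c *: (p * q * p))))
    (cD (p ^+ 2 * q - c *: (p * q * p)) (q * p ^+ 2))).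
split.
- move=> l m; apply: etrans (cM _ _) _; apply: etrans (rel _ _ (Rel_orth v l m)) _.
  by case: eqP.
- by apply: etrans (csum _ _) _; exact: rel (Rel_sum v n.+1 d).
- move=> i l; apply: etrans (cM _ _) _; apply: etrans (rel _ _ (Rel_E_one v i l)) _.
  by case: to_Lambda => [m|]; [exact: esym (cM _ _)|exact: class_of0].
- move=> i l; apply: etrans (cM _ _) _; apply: etrans (rel _ _ (Rel_F_one v i l)) _.
  by case: to_Lambda => [m|]; [exact: esym (cM _ _)|exact: class_of0].
- move=> i l; apply: etrans (cM _ _) _; apply: etrans (rel _ _ (Rel_one_E v i l)) _.
  by case: to_Lambda => [m|]; [exact: esym (cM _ _)|exact: class_of0].
- move=> i l; apply: etrans (cM _ _) _; apply: etrans (rel _ _ (Rel_one_F v i l)) _.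
  by case: to_Lambda => [m|]; [exact: esym (cM _ _)|exact: class_of0].
- move=> i j; rewrite (cM (gen_E K d i)) (cM (gen_F K d j)).
  apply: etrans (cB _ _) _; apply: etrans (rel _ _ (Rel_EF v d i j)) _.
  case: eqP => // _; apply: etrans (esym (csum _ _)) _; apply: eq_bigr => l _.
  exact: esym (cZ _ _).
- by move=> i j adj; apply: etrans (cserre _ _ _) _; exact: rel (Rel_serre_E v d adj).
- move=> i j adj; rewrite (cM (gen_E K d i)) (cM (gen_E K d j)).
  by apply: etrans (cB _ _) _; exact: rel (Rel_comm_E v d adj).
- by move=> i j adj; apply: etrans (cserre _ _ _) _; exact: rel (Rel_serre_F v d adj).
- move=> i j adj; rewrite (cM (gen_F K d i)) (cM (gen_F K d j)).
  by apply: etrans (cB _ _) _; exact: rel (Rel_comm_F v d adj).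
Qed.

Lemma presented_generated : alg_generated (fun l => cl (gen_one K l))
  (fun i => cl (gen_E K d i)) (fun i => cl (gen_F K d i)).
Proof.
move=> P P1 PD PZ Pone PE PF; apply: class_ind; apply: free_alg_ind => //.
- by move=> p q hp hq; rewrite class_ofD; apply: PD.
- by move=> c p hp; rewrite class_ofZ; apply: PZ.
- case=> [l|[i|i]] p hp; rewrite class_ofM.
  + exact: Pone.
  + exact: PE.
  + exact: PF.
Qed.

Hypothesis central_char_inj : forall l m : Lambda n.+1 d, dominant l -> dominant m ->
  central_char v l = central_char v m -> l = m.
Hypothesis singular : forall l : Lambda n.+1 d, dominant l ->
  exists w : tpower K n.+1 d,
    [/\ w <> 0, idem_op v l w = w & forall i, E_op v d i w = 0].

Theorem presentation_faithful (p : FA) : ev p = 0 -> RI p.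
Proof.
(* The action uses a chosen representative; it does not depend on the choice because the ideal
   evaluates to 0. *)
move=> p0; pose rho (x : Q) w := ev (repr_of x) w.
have rhoE q w : rho (cl q) w = ev q w.
  have := rel_ideal_eval v_generic v_neq0 (repr_class schur_rel_nontrivial q).
  rewrite linearB => /lfunP /(_ w); rewrite add_lfunE opp_lfunE zero_lfunE.
  by move/eqP; rewrite subr_eq0 => /eqP ->.
suff e : cl p = 0 by have /class_ofP := etrans e (esym (class_of0 _)); rewrite subr0.
apply: (@kernel_trivial K v _ n.+1 d v_generic v_neq0 _ _ _ schur_alg_presented
  presented_generated (tpower K n.+1 d) rho) => //.
- move=> a b w; move: a b; apply: class_ind => a; apply: class_ind => b.
  by rewrite -class_ofD !rhoE linearD add_lfunE.
- move=> c a w; move: a; apply: class_ind => a.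
  by rewrite -class_ofZ !rhoE linearZ scale_lfunE.
- move=> a b w; move: a b; apply: class_ind => a; apply: class_ind => b.
  by rewrite -class_ofM !rhoE evalM comp_lfunE.
- by move=> a; exact: linear0.
- move=> l /singular [w [w0 lw Ew]]; exists w; split=> //.
    by rewrite rhoE (eval_gen (@schur_op K v n.+1 d)).
  by move=> i; rewrite rhoE (eval_gen (@schur_op K v n.+1 d)) /= Ew.
- by move=> w; rewrite rhoE p0 zero_lfunE.
Qed.

End SchurPresentation.

Section QSchurElements.
Variables (K : fieldType) (v : K).
Hypothesis v_neq0 : v != 0.
Variables n d : nat.

Lemma q_schurP (f : 'End(tpower K n.+1 d)) :
  q_schur v f <-> forall r, (f \o T_op v n.+1 r = T_op v n.+1 r \o f)%VF.
Proof.
split=> [h r|h]; first by have := h (fgen K r); rewrite eval_gen.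
apply: free_alg_ind.
- by rewrite eval1 comp_lfun1l comp_lfun1r.
- by move=> p q hp hq; rewrite linearD comp_lfunDr comp_lfunDl hp hq.
- by move=> c p hp; rewrite linearZ /= -comp_lfunZr -comp_lfunZl hp.
- by move=> r p hp; rewrite evalM eval_gen comp_lfunA h -comp_lfunA hp comp_lfunA.
Qed.

Hypothesis v_generic : forall k : nat, (0 < k)%N -> v ^+ k != 1.

Lemma eval_q_schur p : q_schur v (eval (@schur_op K v n.+1 d) p).
Proof.
apply/q_schurP => r; apply: esym; move: p; apply: free_alg_ind.
- by rewrite eval1 comp_lfun1l comp_lfun1r.
- by move=> p q hp hq; rewrite linearD comp_lfunDr comp_lfunDl hp hq.
- by move=> c p hp; rewrite linearZ /= -comp_lfunZr -comp_lfunZl hp.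
- move=> x p hp; rewrite evalM eval_gen comp_lfunA.
  have -> : (T_op v n.+1 r \o schur_op v x = schur_op v x \o T_op v n.+1 r)%VF.
    by case: x => [l|[i|i]]; [exact: T_op_idem|exact: T_op_E|exact: T_op_F].
  by rewrite -comp_lfunA hp comp_lfunA.
Qed.

End QSchurElements.

(** * Singular vectors *)

Section Singular.
Variables (K : fieldType) (v : K).
Hypothesis v_neq0 : v != 0.
Variable n : nat.
Implicit Types (a b j : 'I_n.+1) (S : {set 'I_n.+1}) (i : 'I_n.+1.-1).

Lemma E_op_tensv d i a (y : tpower K n.+1 d) :
  E_op v d.+1 i (tensv (bvec K a) y) =
  (a == nxt i)%:R *: tensv (bvec K (pos i)) (KK_op v d i 1 y)
  + tensv (bvec K a) (E_op v d i y).
Proof. by rewrite E_opS add_lfunE !tensopE id_lfunE Ev_bvec tensvZl. Qed.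

Lemma F_op_tensv d i a (y : tpower K n.+1 d) :
  F_op v d.+1 i (tensv (bvec K a) y) =
  (a == pos i)%:R *: tensv (bvec K (nxt i)) y
  + v ^ ((a == nxt i)%:Z - (a == pos i)%:Z) *: tensv (bvec K a) (F_op v d i y).
Proof.
rewrite F_opS add_lfunE !tensopE id_lfunE Fv_bvec KKv_bvec // !tensvZl.
by rewrite mulN1r opprB.
Qed.

Lemma K_op_tensv d j z a (y : tpower K n.+1 d) :
  K_op v d.+1 j z (tensv (bvec K a) y) =
  v ^ (z * (a == j)%:Z) *: tensv (bvec K a) (K_op v d j z y).
Proof. by rewrite /= tensopE Kv_bvec // tensvZl. Qed.

(** The number of inversions created by placing a in front of the other letters of S; each
    contributes a factor (-v)^-1 to the quantum exterior product. *)
Definition below S a : nat := #|[set b in S | (b < a)%N]|.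

(* Multiplication by the quantum exterior product of the v_a, a in S, which
   are m in number. *)
Fixpoint wedge d (m : nat) S (w : tpower K n.+1 d) : tpower K n.+1 (m + d) :=
  if m is m'.+1 then
    \sum_(a in S) (- v) ^- below S a *: tensv (bvec K a) (wedge m' (S :\ a) w)
  else w.

Variables (d : nat) (w : tpower K n.+1 d) (c : 'I_n.+1 -> int).
Hypothesis Kw : forall j z, K_op v d j z w = v ^ (z * c j) *: w.
Hypothesis Ew : forall i, E_op v d i w = 0.

Lemma cardD1_eq m S a : #|S| = m.+1 -> a \in S -> #|S :\ a| = m.
Proof. by move=> Sm aS; have := cardsD1 a S; rewrite Sm aS add1n => -[]. Qed.

Lemma wedge_K m S j z : #|S| = m ->
  K_op v (m + d) j z (wedge m S w) = v ^ (z * (c j + (j \in S)%:Z)) *: wedge m S w.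
Proof.
elim: m S => [|m IHm] S Sm; first by rewrite (cards0_eq Sm) inE addr0 Kw.
rewrite [wedge _ _ _]/= linear_sum scaler_sumr; apply: eq_bigr => a aS.
rewrite linearZ /= -/(K_op v (m + d).+1 j z) K_op_tensv IHm ?(cardD1_eq Sm) // tensvZr.
rewrite !scalerA; congr (_ *: _); rewrite -mulrA mulrC; congr (_ * _).
rewrite -expfzDr // -mulrDr; congr (v ^ (z * _)); rewrite !inE addrCA; congr (_ + _).
by have [<-|_] := eqVneq a j; rewrite ?eqxx ?aS //= eq_sym; case: eqP => //; rewrite add0r.
Qed.

Lemma wedge_KK m S i : #|S| = m -> KK_op v (m + d) i 1 (wedge m S w) =
  v ^ ((c (pos i) + (pos i \in S)%:Z) - (c (nxt i) + (nxt i \in S)%:Z)) *: wedge m S w.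
Proof.
move=> Sm; rewrite comp_lfunE wedge_K // linearZ /= wedge_K // scalerA -expfzDr //.
by rewrite mulN1r mul1r addrC.
Qed.

Lemma wedge_neq0 m S : #|S| = m -> w != 0 -> wedge m S w != 0.
Proof.
move=> + w0; elim: m S => [|m IHm] S Sm //.
have [a aS] : exists a, a \in S by apply/card_gt0P; rewrite Sm.
apply: contraNneq (IHm _ (cardD1_eq Sm aS)) => e; apply/eqP/ffunP => t; rewrite ffunE.
have := congr1 (fun f : tpower K n.+1 (m + d).+1 => f [tuple of a :: t]) e.
rewrite sum_ffunE (bigD1 a) //= big1 ?addr0 => [|b /andP[_ ba]]; last first.
  by rewrite !ffunE theadE eq_sym (negPf ba) mul0r scaler0.
rewrite !ffunE theadE eqxx mul1r => /eqP; rewrite scaler_eq0 invr_eq0 expf_eq0 oppr_eq0.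
rewrite (negPf v_neq0) andbF /= => /eqP e'.
by rewrite -[RHS]e'; congr (wedge _ _ _ _); apply: val_inj.
Qed.

Lemma below_other S S' a : (forall b, (b < a)%N -> (b \in S) = (b \in S')) ->
  below S a = below S' a.
Proof.
move=> h; rewrite /below; congr #|pred_of_set _|; apply/setP => b; rewrite !inE.
by case: ltnP => [/h ->|]; rewrite ?andbF.
Qed.

Lemma wedge_E_absent m S i : #|S| = m -> nxt i \notin S -> E_op v (m + d) i (wedge m S w) = 0.
Proof.
elim: m S => [|m IHm] S Sm qS; first exact: Ew.
rewrite [wedge _ _ _]/= linear_sum big1 // => a aS.
have /negPf aq : a != nxt i by apply: contraNneq qS => <-.
rewrite linearZ /= -/(E_op v (m + d).+1 i) E_op_tensv aq scale0r add0r.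
by rewrite IHm ?tensv0r ?scaler0 ?(cardD1_eq Sm) // inE (negPf qS) andbF.
Qed.

(** E_i acts only on the letter i + 1. The power of v is the eigenvalue of K_i K_(i+1)^-1 on w, as
    the other letters of S are neither i nor i + 1; inversions are preserved because i and i + 1 are
    neighbours. *)
Lemma wedge_E_replace m S i : #|S| = m -> nxt i \in S -> pos i \notin S ->
  E_op v (m + d) i (wedge m S w) =
  v ^ (c (pos i) - c (nxt i)) *: wedge m (pos i |: S :\ nxt i) w.
Proof.
set p := pos i; set q := nxt i; have pq : q = p.+1 :> nat by [].
have npq : p != q by rewrite pos_neq_nxt.
elim: m S => [|m IHm] S Sm qS pS; first by move: qS; rewrite (cards0_eq Sm) inE.
set S' := p |: S :\ q.
rewrite [wedge _ _ _]/= linear_sum [wedge _ S' _]/= scaler_sumr.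
rewrite (bigD1 q) //= [in RHS](bigD1 p) /=; last by rewrite !inE eqxx.
congr (_ + _).
  rewrite linearZ /= -/(E_op v (m + d).+1 i) E_op_tensv eqxx scale1r.
  rewrite wedge_E_absent ?tensv0r ?addr0 ?(cardD1_eq Sm) ?inE ?eqxx // wedge_KK ?(cardD1_eq Sm) //.
  rewrite !inE eqxx (negPf pS) andbF !addr0 tensvZr scalerA mulrC -scalerA.
  have -> : S' :\ p = S :\ q.
    by apply/setP => b; rewrite !inE; case: (eqVneq b p) => //= ->; rewrite (negPf pS) andbF.
  congr (_ *: (_ ^- _ *: _)).
  transitivity (below S p); last first.
    apply: below_other => b bp.
    have /negPf b1 : b != p by apply: contraTneq bp => ->; rewrite ltnn.
    have /negPf b2 : b != q by apply: contraTneq bp => ->; rewrite pq; lia.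
    by rewrite !inE b1 b2.
  rewrite /below; congr #|pred_of_set _|; apply/setP => b; rewrite !inE pq ltnS leq_eqVlt.
  by rewrite val_eqE; case: (eqVneq b p) => [->|] //=; rewrite (negPf pS).
apply: eq_big => [a|a /andP[aS aq]].
  rewrite !inE; case: (eqVneq a q) => [->|_]; rewrite ?andbF ?orbF ?andbT //=.
    by rewrite [q == p]eq_sym (negPf npq).
  by case: (eqVneq a p) => [->|] //=; rewrite ?(negPf pS) ?andbT ?andbF.
have ap : a != p by apply: contraNneq pS => <-.
rewrite linearZ /= -/(E_op v (m + d).+1 i) E_op_tensv (negPf aq) scale0r add0r.
rewrite IHm ?(cardD1_eq Sm) ?inE ?qS ?(negPf pS) ?andbF ?andbT // 1?eq_sym //.
rewrite tensvZr scalerA mulrC -scalerA.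
have -> : p |: S :\ a :\ q = S' :\ a.
  apply/setP => b; rewrite !inE; case: (eqVneq b p) => [->|] //=.
    by rewrite eq_sym ap.
  by rewrite andbCA.
congr (_ *: (_ ^- _ *: _)).
have [pa|ap'] := ltnP p a; last first.
  apply: below_other => b ba.
  have /negPf b1 : b != p by apply: contraTneq ba => ->; lia.
  have /negPf b2 : b != q by apply: contraTneq ba => ->; rewrite pq; lia.
  by rewrite !inE b1 b2.
have qa : (q < a)%N by rewrite ltn_neqAle pq pa andbT -pq eq_sym val_eqE.
have B1 : below S a = (below (S :\ q) a).+1.
  rewrite /below (cardsD1 q) inE qS qa add1n; congr _.+1; congr #|pred_of_set _|.
  by apply/setP => b; rewrite !inE andbA.
have B2 : below S' a = (below (S :\ q) a).+1.
  rewrite /below (cardsD1 p) !inE eqxx pa add1n; congr _.+1; congr #|pred_of_set _|.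
  apply/setP => b; rewrite !inE; case: (eqVneq b p) => [->|] //=.
  by rewrite (negPf pS) andbF.
by rewrite B1 B2.
Qed.

(* The terms starting with v_i and with v_(i+1) cancel each other. *)
Lemma wedge_E m S i : #|S| = m -> (nxt i \in S -> pos i \in S) ->
  E_op v (m + d) i (wedge m S w) = 0.
Proof.
set p := pos i; set q := nxt i; have pq : q = p.+1 :> nat by [].
have npq : p != q by rewrite pos_neq_nxt.
elim: m S => [|m IHm] S Sm qpS; first exact: Ew.
have [qS|] := boolP (q \in S); last by apply: wedge_E_absent.
have pS := qpS qS.
rewrite [wedge _ _ _]/= linear_sum (bigD1 q) //= (bigD1 p) /=; last by rewrite pS.
rewrite big1 ?addr0 => [|a /andP[/andP[aS aq] ap]]; last first.
  rewrite linearZ /= -/(E_op v (m + d).+1 i) E_op_tensv (negPf aq) scale0r add0r.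
  rewrite IHm ?tensv0r ?scaler0 ?(cardD1_eq Sm) // !inE -/p -/q.
  by rewrite qS pS [q == a]eq_sym [p == a]eq_sym ap aq.
rewrite !linearZ /= -/(E_op v (m + d).+1 i) !E_op_tensv eqxx (negPf npq) scale1r scale0r add0r.
rewrite wedge_E_absent ?tensv0r ?addr0 ?(cardD1_eq Sm) ?inE ?eqxx // wedge_KK ?(cardD1_eq Sm) //.
rewrite wedge_E_replace ?(cardD1_eq Sm) ?inE ?eqxx ?qS ?andbT -/p -/q // 1?eq_sym //.
have -> : p |: S :\ p :\ q = S :\ q.
  by apply/setP => b; rewrite !inE; case: (eqVneq b p) => [->|] //=; rewrite pS npq.
rewrite !tensvZr !scalerA -scalerDl.
(* The additional inversion gives -v^-1, and the letter i still standing to the right gives v; the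
   product -1 makes the two terms cancel. *)
have -> : below S q = (below S p).+1.
  rewrite /below (cardsD1 p) inE pS pq ltnSn add1n; congr _.+1; congr #|pred_of_set _|.
  apply/setP => b; rewrite !inE ltnS leq_eqVlt val_eqE.
  by case: (eqVneq b p) => [->|] //=; rewrite ltnn andbF.
have -> : c p + ((q != p) && (p \in S))%:Z - (c q + (~~ true)%:Z) = (c p - c q) + 1.
  by rewrite [q == p]eq_sym npq pS addr0 addrAC.
rewrite (_ : _ + _ = 0) ?scale0r // expfzDr // expr1z exprS invfM invrN.
by move: (v ^ _) (_ ^- _) => x y; field.
Qed.

End Singular.

Section SingularExists.
Variables (K : fieldType) (v : K).
Hypothesis v_neq0 : v != 0.
Variable n : nat.

(** Induction over the columns of the Young diagram of f: the letters with f j > 0 form the first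
    column. Dominance makes them an initial segment, as [wedge_E] requires, and survives the removal
    of the column. *)
Lemma singular_exists d (f : 'I_n.+1 -> nat) : (\sum_j f j = d)%N ->
  (forall i : 'I_n.+1.-1, (f (nxt i) <= f (pos i))%N) ->
  exists w : tpower K n.+1 d, [/\ w != 0,
    forall j z, K_op v d j z w = v ^ (z * (f j : int)) *: w &
    forall i, E_op v d i w = 0].
Proof.
move: {2}d.+1 (ltnSn d) => N; elim: N d f => // N IHN d f dN fd fdom.
pose S := [set j | (0 < f j)%N].
have [S0|S0] := posnP #|S|.
  have f0 j : f j = 0%N.
    apply/eqP; rewrite -leqn0 leqNgt; apply/negP => h.
    by have := in_set0 j; rewrite -(cards0_eq S0) inE h.
  have d0 : d = 0%N by rewrite -fd big1.
  subst d; rewrite d0 in dN *; exists (bvec K [tuple]); split.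
  - exact: bvec_neq0.
  - by move=> j z; rewrite f0 mulr0 scale1r /= id_lfunE.
  - by move=> i; rewrite /= zero_lfunE.
have e : d = (#|S| + \sum_j (f j).-1)%N.
  rewrite -fd -sum1_card [X in (X + _)%N]big_mkcond -big_split /=; apply: eq_bigr => j _.
  by rewrite inE; case: (f j).
have dN' : (\sum_j (f j).-1 < N)%N by lia.
have fdom' i : ((f (nxt i)).-1 <= (f (pos i)).-1)%N by have := fdom i; lia.
have [w' [w0 Kw Ew]] := IHN _ (fun j => (f j).-1) dN' erefl fdom'.
move: (\sum_j (f j).-1) e w' w0 Kw Ew => d' e w' w0 Kw Ew.
rewrite e; exists (wedge v #|S| S w'); split.
- exact: wedge_neq0.
- move=> j z; rewrite (wedge_K v_neq0 Kw) //; congr (v ^ (z * _) *: _).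
  by rewrite inE; case: (f j) => [|k] //=; rewrite -PoszD addn1.
move=> i; apply: (wedge_E v_neq0 Kw Ew) => //.
by rewrite !inE => h; apply: leq_trans h (fdom i).
Qed.

End SingularExists.

(** * Surjectivity when there are enough letters *)

Section AdjacentTranspositions.
Variable d : nat.

Lemma adjacent_tperm_ind (P : 'S_d -> Prop) : P 1%g ->
  (forall (r : 'I_d.-1) s, P s -> P (tperm (pos r) (nxt r) * s)%g) -> forall s, P s.
Proof.
move=> P1 Padj; pose C (u : 'S_d) := forall s, P s -> P (u * s)%g.
have CM u u' : C u -> C u' -> C (u * u')%g.
  by move=> hu hu' s hs; rewrite -mulgA; apply/hu/hu'.
have Ct k (x y : 'I_d) : (y = x + k.+1 :> nat)%N -> C (tperm x y).
  elim: k y => [|k IHk] y yx.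
    have r_lt : (x < d.-1)%N by rewrite ltn_predRL; apply: leq_ltn_trans (ltn_ord y); rewrite yx; lia.
    have -> : x = pos (Ordinal r_lt) by apply: val_inj.
    have -> : y = nxt (Ordinal r_lt) by apply: val_inj; rewrite /= yx addn1.
    exact: Padj.
  have y'd : (x + k.+1 < d)%N by apply: leq_ltn_trans (ltn_ord y); rewrite yx; lia.
  pose y' := Ordinal y'd.
  have r_lt : (y' < d.-1)%N by rewrite ltn_predRL /=; apply: leq_ltn_trans (ltn_ord y); rewrite yx; lia.
  have Cs : C (tperm y' y).
    have -> : y' = pos (Ordinal r_lt) by apply: val_inj.
    have -> : y = nxt (Ordinal r_lt) by apply: val_inj; rewrite /= yx addnS.
    exact: Padj.
  (* Conjugation by the transposition of y - 1 and y shortens the distance by one. *)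
  have -> : tperm x y = (tperm y' y * (tperm x y' * tperm y' y))%g.
    rewrite -{1}(tpermV y' y) -/(conjg (tperm x y') (tperm y' y)) tpermJ tpermL tpermD //.
      by rewrite -val_eqE /=; lia.
    by rewrite -val_eqE /= yx; lia.
  by do 2 apply: (CM) => //; apply: IHk.
have Cxy x y : C (tperm x y).
  have [xy|yx|/val_inj ->] := ltngtP x y.
  - by apply: (Ct (y - x).-1); lia.
  - by rewrite tpermC; apply: (Ct (x - y).-1); lia.
  - by rewrite tperm1 => s; rewrite mul1g.
move=> s; have [ts -> _] := prod_tpermP s; rewrite -[X in P X]mulg1.
suff : C (\prod_(t <- ts) tperm t.1 t.2)%g by apply.
elim: ts => [|t ts IHts]; first by rewrite big_nil => u; rewrite mul1g.
by rewrite big_cons; apply: CM.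
Qed.

End AdjacentTranspositions.

Section Image.
Variables (K : fieldType) (v : K).
Hypothesis v_generic : forall k : nat, (0 < k)%N -> v ^+ k != 1.
Hypothesis v_neq0 : v != 0.
Variables n d : nat.

Definition image (f : op K n d) : Prop := exists p, eval (@schur_op K v n.+1 d) p = f.

Lemma image_one l : image (idem_op v l).
Proof. by exists (gen_one K l); rewrite eval_gen. Qed.

Lemma image_E i : image (E_op v d i).
Proof. by exists (gen_E K d i); rewrite eval_gen. Qed.

Lemma image_F i : image (F_op v d i).
Proof. by exists (gen_F K d i); rewrite eval_gen. Qed.

Lemma image1 : image 1.
Proof. by exists 1; rewrite eval1. Qed.

Lemma image0 : image 0.
Proof. by exists 0; rewrite linear0. Qed.

Lemma imageD f g : image f -> image g -> image (f + g).
Proof. by case=> p <- [q <-]; exists (p + q); rewrite linearD. Qed.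

Lemma imageZ c f : image f -> image (c *: f).
Proof. by case=> p <-; exists (c *: p); rewrite linearZ. Qed.

Lemma imageM f g : image f -> image g -> image (f * g).
Proof. by case=> p <- [q <-]; exists (p * q); rewrite evalM. Qed.

Lemma image_sum (I : finType) (P : pred I) (F : I -> op K n d) :
  (forall i, P i -> image (F i)) -> image (\sum_(i | P i) F i).
Proof. by move=> h; elim/big_ind: _ => //; [exact: image0|exact: imageD]. Qed.

Lemma image_T f r w : image f -> f (T_op v n.+1 r w) = T_op v n.+1 r (f w).
Proof.
case=> p <-; have /(q_schurP v) /(_ r) /lfunP /(_ w) := eval_q_schur v_neq0 v_generic p.
by rewrite !comp_lfunE.
Qed.

Lemma E_op_absent e (i : 'I_n.+1.-1) (t : e.-tuple 'I_n.+1) : count_mem (nxt i) t = 0%N ->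
  E_op v e i (bvec K t) = 0.
Proof.
elim: e t => [|e IHe] t; first by rewrite /= zero_lfunE.
case/tupleP: t => a t /= /eqP; rewrite addn_eq0 => /andP[/eqP a0 /eqP t0].
rewrite -/(E_op v e.+1 i) E_op_cons // IHe // tensv0r addr0.
by move: a0; case: eqP => // _ _; rewrite mul0r scale0r.
Qed.

Lemma F_op_absent e (i : 'I_n.+1.-1) (t : e.-tuple 'I_n.+1) : count_mem (pos i) t = 0%N ->
  F_op v e i (bvec K t) = 0.
Proof.
elim: e t => [|e IHe] t; first by rewrite /= zero_lfunE.
case/tupleP: t => a t /= /eqP; rewrite addn_eq0 => /andP[/eqP a0 /eqP t0].
rewrite -/(F_op v e.+1 i) F_op_cons // IHe // tensv0r scaler0 addr0.
by move: a0; case: eqP => // _ _; rewrite scale0r.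
Qed.

(** E_i turns the only letter i + 1 into i, then F_i turns one of the two letters i into i + 1. One
    result is the swapped tensor, which is T_r of the original as i < i + 1; the other is v^-1 times
    the original. *)
Lemma FE_swap e (i : 'I_n.+1.-1) (r : 'I_e.-1) (t : e.-tuple 'I_n.+1) :
  count_mem (pos i) t = 1%N -> count_mem (nxt i) t = 1%N ->
  tnth t (pos r) = pos i -> tnth t (nxt r) = nxt i ->
  F_op v e i (E_op v e i (bvec K t)) = T_op v n.+1 r (bvec K t) + v^-1 *: bvec K t.
Proof.
have npq : (nxt i == pos i) = false by rewrite eq_sym pos_neq_nxt.
elim: e r t => [|[|e] IHe] r; [by case: r | by case: r |].
case/tupleP=> a t; have [r' ->|->] := unliftP ord0 r.
  have -> : lift ord0 r' = nxt (r' : 'I_e.+1.-1) by apply: val_inj.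
  have -> : pos (nxt (r' : 'I_e.+1.-1) : 'I_e.+2.-1) = lift ord0 (pos (r' : 'I_e.+1.-1)) by apply: val_inj.
  have -> : nxt (nxt (r' : 'I_e.+1.-1) : 'I_e.+2.-1) = lift ord0 (nxt (r' : 'I_e.+1.-1)) by apply: val_inj.
  rewrite !tnthS => cp cq tp tq.
  have mp : (0 < count_mem (pos i) t)%N by rewrite -has_count has_pred1 -tp mem_tnth.
  have mq : (0 < count_mem (nxt i) t)%N by rewrite -has_count has_pred1 -tq mem_tnth.
  have ap : (a == pos i) = false by apply/negP => /eqP h; move: cp; rewrite /= h eqxx add1n => -[z]; move: mp; rewrite z.
  have aq : (a == nxt i) = false by apply/negP => /eqP h; move: cq; rewrite /= h eqxx add1n => -[z]; move: mq; rewrite z.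
  rewrite /= ap in cp; rewrite /= aq in cq.
  have EE : E_op v e.+2 i (tensv (bvec K a) (bvec K t)) = tensv (bvec K a) (E_op v e.+1 i (bvec K t)).
    by rewrite (E_op_tensv v i a (bvec K t)) aq scale0r add0r.
  have FF y : F_op v e.+2 i (tensv (bvec K a) y) = tensv (bvec K a) (F_op v e.+1 i y).
    by rewrite (F_op_tensv v_neq0 i a y) ap aq scale0r add0r subrr expr0z scale1r.
  rewrite bvec_cons; apply: etrans (congr1 (F_op v e.+2 i) EE) _; apply: etrans (FF _) _.
  rewrite (IHe r') // (@T_op_tail K v n e.+1 r') tensopE id_lfunE.
  by rewrite tensvDr tensvZr.
case/tupleP: t => b t cp cq.
have -> : tnth [tuple of a :: [tuple of b :: t]] (pos (ord0 : 'I_e.+2.-1)) = a by [].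
have -> : tnth [tuple of a :: [tuple of b :: t]] (nxt (ord0 : 'I_e.+2.-1)) = b by [].
move=> ea eb; move: cp cq; rewrite /= ea eb !eqxx npq pos_neq_nxt => -[cp] [cq].
rewrite !add0n in cp cq.
have EE : E_op v e.+2 i (tens2 (pos i) (nxt i) (bvec K t)) = tens2 (pos i) (pos i) (bvec K t).
  rewrite E_op_tens2 // E_op_absent // !eqxx pos_neq_nxt mul0r scale0r add0r scale1r.
  by rewrite cp cq subrr expr0z scale1r /tens2 !tensv0r addr0.
have FF : F_op v e.+2 i (tens2 (pos i) (pos i) (bvec K t)) =
    tens2 (nxt i) (pos i) (bvec K t) + v^-1 *: tens2 (pos i) (nxt i) (bvec K t).
  rewrite F_op_tens2 // F_op_absent // !eqxx pos_neq_nxt !scale1r.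
  by rewrite /tens2 !tensv0r scaler0 addr0.
rewrite -tens2_bvec; apply: etrans (congr1 (F_op v e.+2 i) EE) _; apply: etrans FF _.
by rewrite T_op_head pos_neq_nxt ltnSn.
Qed.

End Image.

(** * Enough letters: the weight omega and its Hecke module *)

Section Corner.
Variables (K : fieldType) (v : K).
Hypothesis v_generic : forall k : nat, (0 < k)%N -> v ^+ k != 1.
Hypothesis v_neq0 : v != 0.
Variables n d : nat.
Local Notation N := (n + d)%N.
Local Notation L := (Lambda N.+1 d).
Local Notation im := (@image K v N d).

(* The tensor v_(n+1) (x) ... (x) v_(n+d) in the last d letters; its weight
   generates all the weights with entries at most 1 on these letters. *)
Definition top_tuple : d.-tuple 'I_N.+1 := [tuple (rshift n.+1 k : 'I_(n.+1 + d)) | k < d].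
Definition omega : L := content top_tuple.

Lemma count_top_tuple j : count_mem j top_tuple = (n < j)%N.
Proof.
have inj : injective (fun k : 'I_d => rshift n.+1 k : 'I_(n.+1 + d)) by exact: rshift_inj.
rewrite count_uniq_mem; last by rewrite map_inj_uniq ?enum_uniq.
congr nat_of_bool; apply/mapP/idP => [[k _ ->]|nj] /=; first by rewrite ltnS leq_addr.
have kd : (j - n.+1 < d)%N by have := ltn_ord j; lia.
by exists (Ordinal kd); rewrite ?mem_enum //; apply: val_inj; rewrite /= subnKC.
Qed.

(** This class contains all weights supported on the first n + 1 letters and is stable under the
    descent to omega, which fills vacant letters one at a time. *)
Definition small (l : L) := forall j : 'I_N.+1, (n < j)%N -> (val l j <= 1)%N.

Lemma sum_top : (\sum_(j < N.+1) (n < j)%N = d)%N.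
Proof.
have := sum_count top_tuple; rewrite size_tuple => e; rewrite -[RHS]e.
by apply: eq_bigr => j _; rewrite count_top_tuple.
Qed.

Lemma sum_eq_le (I : finType) (f g : I -> nat) : (forall i, f i <= g i)%N ->
  (\sum_i f i = \sum_i g i)%N -> forall i, f i = g i.
Proof.
move=> le e i; rewrite (bigD1 i) //= [in RHS](bigD1 i) //= in e.
have : (\sum_(j | j != i) f j <= \sum_(j | j != i) g j)%N by apply: leq_sum.
by have := le i; lia.
Qed.

(** Otherwise a positive entry among the first letters would force all later entries to be positive,
    which takes more than d units in total; and without such an entry l is bounded by omega, hence
    equal to it. *)
Lemma small_step l : small l -> l <> omega ->
  exists i : 'I_N.+1.-1, (0 < val l (pos i))%N /\ val l (nxt i) = 0%N :> nat.
Proof.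
move=> sl lo; apply: contrapT => no.
have up (i : 'I_N.+1.-1) : (0 < val l (pos i))%N -> (0 < val l (nxt i))%N.
  by move=> h; rewrite lt0n; apply/negP => /eqP h'; apply: no; exists i.
have sl_d : (\sum_j val l j = d)%N by exact: eqP (valP l).
have [[j0 [j0n l0]]|low] := pselect (exists j : 'I_N.+1, (j <= n)%N /\ (0 < val l j)%N).
  have pr k (j : 'I_N.+1) : (j = j0 + k :> nat)%N -> (0 < val l j)%N.
    elim: k j => [|k IHk] j jk; first by have -> : j = j0 by apply: val_inj; rewrite /= jk addn0.
    have iN : (j0 + k < N.+1.-1)%N by have := ltn_ord j; rewrite jk; lia.
    have -> : j = nxt (Ordinal iN) by apply: val_inj; rewrite /= jk addnS.
    by apply: up; apply: IHk.
  have le (j : 'I_N.+1) : ((n < j) + (j == j0) <= val l j)%N.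
    have [->|_] := eqVneq j j0; first by rewrite ltnNge j0n add0n.
    case: ltnP => // nj; rewrite addn0; apply: (pr (j - j0)%N); lia.
  have : (\sum_(j < N.+1) ((n < j) + (j == j0)) <= \sum_j val l j)%N by apply: leq_sum.
  rewrite sl_d big_split /= sum_top (bigD1 j0) //= eqxx; lia.
apply: lo; apply: val_inj; apply/ffunP => j; apply: val_inj; rewrite /= -/(val l j).
have le (k : 'I_N.+1) : (val l k <= (n < k)%N)%N.
  case: ltnP => [|kn]; first exact: sl.
  by rewrite leqn0; apply/negPn/negP; rewrite -lt0n => h; apply: low; exists k.
have e := sum_eq_le le (etrans sl_d (esym sum_top)) j.
by rewrite -[LHS]/(nat_of_ord (val l j)) e -count_top_tuple -contentE.
Qed.

Definition through_omega (l : L) : Prop :=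
  exists a b, [/\ im a, im b & (idem_op v l : op K N d) = a * idem_op v omega * b].

(* If l_(i+1) = 0 < l_i, then E_i F_i 1_l = [l_i] 1_l. *)
Lemma small_through_omega l : small l -> through_omega l.
Proof.
move: {2}(hgt l).+1 (ltnSn (hgt l)) => h; elim: h l => // h IHh l lh sl.
have [->|lo] := eqVneq l omega.
  by exists 1, 1; split; rewrite ?mul1r ?mulr1 //; exact: image1.
have [i [lp lq]] := small_step sl (elimN eqP lo).
have S := schur_alg_op v_generic v_neq0 N d.
have E0 : (E_op v d i : op K N d) * idem_op v l = 0.
  rewrite (sa_E_one S); case C: to_Lambda => [m|] //.
  have := congr1 (fun f : {ffun 'I_N.+1 -> int} => f (nxt i)) (to_Lambda_weight C).
  by rewrite !ffunE eqxx [nxt i == _]eq_sym pos_neq_nxt lq.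
have := congr1 (fun f : op K N d => f * idem_op v l) (sa_EF S i i).
rewrite eqxx -[\sum_l _]/(torus (fun l => idem_op v l : op K N d) _) (torus_one S).
rewrite mulrBl -[(F_op v d i : op K N d) * _ * _]mulrA E0 mulr0 subr0.
set c := qint v _; have c0 : c != 0.
  by rewrite /c qint_neq0 // !ffunE lq subr0; move: lp; case: (nat_of_ord _).
rewrite /through_omega => e; have {e} -> : (idem_op v l : op K N d) =
    c^-1 *: ((E_op v d i : op K N d) * F_op v d i * idem_op v l).
  by rewrite e scalerA mulVf // scale1r.
rewrite -mulrA (sa_F_one S); case C: to_Lambda => [m|]; last first.
  exists 0, 0; split; rewrite ?mulr0 ?scaler0 ?mul0r //; exact: image0.
have W := to_Lambda_weight C.
have [||a [b [ia ib ->]]] := IHh m.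
- by have := hgtD (weight_addA W); lia.
- move=> j nj; have := congr1 (fun f : {ffun 'I_N.+1 -> int} => f j) W; rewrite !ffunE.
  have [->|jq] := eqVneq j (nxt i).
    by rewrite lq [nxt i == _]eq_sym pos_neq_nxt; lia.
  by have := sl j nj; case: (j == pos i); lia.
exists (c^-1 *: ((E_op v d i : op K N d) * a)), (b * F_op v d i); split.
- by apply: imageZ; apply: imageM => //; apply: image_E.
- by apply: imageM => //; apply: image_F.
by rewrite !scalerAl !mulrA.
Qed.

Local Notation top := (bvec K top_tuple).
Local Notation HT := (eval (@T_op K v N.+1 d)).

Lemma top_letters (r : 'I_d.-1) : exists i : 'I_N.+1.-1,
  tnth top_tuple (pos r) = pos i /\ tnth top_tuple (nxt r) = nxt i.
Proof.
have iN : (n.+1 + r < N.+1.-1)%N.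
  by rewrite /= addSnnS ltn_add2l; exact: ltn_ord (nxt r).
by exists (Ordinal iN); split; apply: val_inj; rewrite tnth_mktuple /= ?addnS.
Qed.

Lemma T_top_image r : exists2 x, im x & T_op v N.+1 r top = x top.
Proof.
have [i [ip iq]] := top_letters r.
have np : (n < pos i)%N by rewrite -ip tnth_mktuple /= ltnS leq_addr.
exists ((F_op v d i : op K N d) * E_op v d i + (- v^-1) *: 1).
  apply: imageD; last by apply: imageZ; apply: image1.
  by apply: imageM; [apply: image_F|apply: image_E].
rewrite add_lfunE scale_lfunE comp_lfunE id_lfunE (FE_swap v_neq0 (r := r)) //.
- by rewrite scaleNr addrK.
- by rewrite count_top_tuple np.
- by rewrite count_top_tuple ltnW.
Qed.

Lemma hecke_top_image h : exists2 s, im s & HT h top = s top.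
Proof.
move: h; apply: free_alg_ind.
- by exists 1; [exact: image1|rewrite eval1].
- move=> p q [s si sp] [s' si' sq]; exists (s + s'); first exact: imageD.
  by rewrite linearD !add_lfunE sp sq.
- move=> c p [s si sp]; exists (c *: s); first exact: imageZ.
  by rewrite linearZ !scale_lfunE sp.
- move=> r p [s si sp]; have [x xi xr] := T_top_image r.
  (* T_r commutes with [s], so the factors are collected in the reverse order. *)
  exists (s * x); first exact: imageM.
  by rewrite evalM eval_gen !comp_lfunE sp -(image_T v_generic v_neq0 r top si) xr.
Qed.

(** The letters are distinct, so T_r swaps two of them up to a multiple of the tensor itself, and
    adjacent transpositions reach every arrangement. *)
Lemma omega_hecke t : content t = omega -> exists h, HT h top = bvec K t.
Proof.
move=> e.
have : perm_eq t top_tuple.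
  apply/allP => j _ /=; apply/eqP.
  exact: (etrans (esym (contentE t j)) (etrans (congr1 (fun c : L => nat_of_ord (val c j)) e)
    (contentE top_tuple j))).
case/tuple_permP => s /= es.
have -> : t = [tuple tnth top_tuple (s k) | k < d] by apply: val_inj.
move: s {es}; apply: adjacent_tperm_ind.
  exists 1; rewrite eval1 id_lfunE; congr bvec; apply: eq_from_tnth => k.
  by rewrite [RHS]tnth_mktuple perm1.
move=> r s [h hs]; set ts := [tuple tnth top_tuple (s k) | k < d] in hs.
have sw : swap_places r ts = [tuple tnth top_tuple ((tperm (pos r) (nxt r) * s)%g k) | k < d].
  by apply: eq_from_tnth => k; rewrite !tnth_mktuple permM.
have ne : tnth ts (pos r) != tnth ts (nxt r).
  apply/negP => /eqP /(congr1 val); rewrite !tnth_mktuple /= => /eqP.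
  by rewrite eqn_add2l val_eqE (inj_eq perm_inj) pos_neq_nxt.
have := lin_extE (fun t : d.-tuple 'I_N.+1 =>
    let a := tnth t (pos r) in
    let b := tnth t (nxt r) in
    if a == b then v *: bvec K t
    else if (a < b)%N then bvec K (swap_places r t)
    else bvec K (swap_places r t) + (v - v^-1) *: bvec K t) ts.
rewrite -/(T_op v N.+1 r) /= (negPf ne) sw => T1.
have Th p : HT (fgen K r * p) top = T_op v N.+1 r (HT p top).
  by rewrite evalM eval_gen comp_lfunE.
case: ifP T1 => _ T1; first by exists (fgen K r * h); rewrite Th hs.
exists (fgen K r * h - (v - v^-1) *: h); rewrite linearB linearZ /=.
by rewrite add_lfunE opp_lfunE scale_lfunE Th hs T1 addrK.
Qed.

Lemma omega_image w : exists2 s, im s & idem_op v omega w = s top.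
Proof.
rewrite (span_sum w) linear_sum /=.
suff h t : exists2 s, im s & idem_op v omega (w t *: bvec K t) = s top.
  have [s Hs] := choice (fun t => let: ex_intro2 s i e := h t in ex_intro (fun s => im s /\ _ = s top) s (conj i e)).
  exists (\sum_t s t); first by apply: image_sum => t _; have [] := Hs t.
  by rewrite sum_lfunE; apply: eq_bigr => t _; have [] := Hs t.
rewrite linearZ /= idem_op_bvec //; have [e|_] := eqVneq omega (content t); last first.
  by exists 0; [exact: image0|rewrite scale0r scaler0 zero_lfunE].
have [x xt] := omega_hecke (esym e); have [s si sx] := hecke_top_image x.
exists (w t *: s); first exact: imageZ.
by rewrite scale1r scale_lfunE -sx xt.
Qed.

Theorem corner_surjective (h : op K N d) : q_schur v h ->
  (forall l, ~ small l -> h * idem_op v l = 0 /\ (idem_op v l : op K N d) * h = 0) ->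
  im h.
Proof.
move=> hq hsmall; have S := schur_alg_op v_generic v_neq0 N d.
(* Since 1_l factors through omega, the whole range of h is obtained from the single tensor
   [top]. *)
have range w : exists2 s, im s & h w = s top.
  have -> : h w = \sum_l ((idem_op v l : op K N d) * h) w.
    have {1}-> : h = \sum_l (idem_op v l : op K N d) * h by rewrite -mulr_suml (sa_sum S) mul1r.
    by rewrite sum_lfunE.
  suff H l : exists2 s, im s & ((idem_op v l : op K N d) * h) w = s top.
    have [s Hs] := choice (fun l => let: ex_intro2 s i e := H l in ex_intro (fun s => im s /\ _ = s top) s (conj i e)).
    exists (\sum_l s l); first by apply: image_sum => l _; have [] := Hs l.
    by rewrite sum_lfunE; apply: eq_bigr => l _; have [] := Hs l.
  have [/small_through_omega [a [b [ia ib ->]]]|/hsmall [_ ->]] := pselect (small l); last first.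
    by exists 0; [exact: image0|rewrite !zero_lfunE].
  have [s si sx] := omega_image (b (h w)); exists (a * s); first exact: imageM.
  by rewrite -mulrA !comp_lfunE sx.
(* Both h a and s commute with the Hecke algebra, so on the weight space of omega they agree as soon
   as they agree on [top]. *)
have corner a : im a -> im (h * a * idem_op v omega).
  move=> ia; pose g := h * a.
  have gT (r : 'I_d.-1) w : g (T_op v N.+1 r w) = T_op v N.+1 r (g w).
    rewrite !comp_lfunE image_T //.
    by have /(q_schurP v) /(_ r) /lfunP /(_ (a w)) := hq; rewrite !comp_lfunE.
  have gH p w : g (HT p w) = HT p (g w).
    have /(q_schurP v) gq : forall r, (g \o T_op v N.+1 r = T_op v N.+1 r \o g)%VF.
      by move=> r; apply/lfunP => w'; rewrite [LHS]comp_lfunE [RHS]comp_lfunE gT.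
    by have /lfunP /(_ w) := gq p; rewrite [LHS]comp_lfunE [RHS]comp_lfunE.
  have [s si sx] := range (a top).
  suff -> : h * a * idem_op v omega = s * idem_op v omega by apply: imageM => //; apply: image_one.
  apply: hom_tupleP => t; rewrite comp_lfunE [RHS]comp_lfunE idem_op_bvec //.
  have [e|_] := eqVneq omega (content t); last by rewrite scale0r !linear0.
  have [x <-] := omega_hecke (esym e); rewrite scale1r -/g gH comp_lfunE sx.
  have : q_schur v s by case: si => p <-; apply: eval_q_schur.
  by move=> /(_ x) /lfunP /(_ top); rewrite !comp_lfunE.
have -> : h = \sum_l h * idem_op v l by rewrite -mulr_sumr (sa_sum S) mulr1.
apply: image_sum => l _.
have [/small_through_omega [a [b [ia ib ->]]]|/hsmall [-> _]] := pselect (small l); last exact: image0.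
by rewrite !mulrA; apply: imageM => //; apply: corner.
Qed.

End Corner.

(** * Surjectivity in general *)

Section TriangularSpan.
Variables (K : fieldType) (v : K) (A : algType K) (n d : nat).
Variables (one : Lambda n d -> A) (E F : 'I_n.-1 -> A).
Hypothesis Rel : schur_alg v one E F.

Inductive espan : A -> Prop :=
| Es_0 : espan 0
| Es_one l : espan (one l)
| Es_E i x : espan x -> espan (E i * x).

(** The F_i stand next to the truncation and the E_i next to the embedding, so that [fspan_cut] can
    treat one factor at a time. *)
Inductive fspan : A -> Prop :=
| Fs_e x : espan x -> fspan x
| Fs_F i x : fspan x -> fspan (F i * x)
| Fs_add x y : fspan x -> fspan y -> fspan (x + y)
| Fs_scale (c : K) x : fspan x -> fspan (c *: x).

Lemma espan_one m x : espan x -> espan (one m * x).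
Proof.
move=> H; elim: H m => {x} [|l|i x _ IH] m.
- by rewrite mulr0; apply: Es_0.
- by rewrite (sa_orth Rel); case: eqP => [->|_]; [apply: Es_one|apply: Es_0].
- rewrite mulrA (sa_one_E Rel); case: to_Lambda => [p|]; last by rewrite mul0r; apply: Es_0.
  by rewrite -mulrA; apply: Es_E.
Qed.

Lemma fspan_one m x : fspan x -> fspan (one m * x).
Proof.
move=> H; elim: H m => {x} [x Hx|i x _ IH|x y _ IHx _ IHy|c x _ IH] m.
- exact/Fs_e/espan_one.
- rewrite mulrA (sa_one_F Rel); case: to_Lambda => [p|]; last by rewrite mul0r; apply/Fs_e/Es_0.
  by rewrite -mulrA; apply: Fs_F.
- by rewrite mulrDr; apply: Fs_add.
- by rewrite -scalerAr; apply: Fs_scale.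
Qed.

Lemma fspan_E i x : fspan x -> fspan (E i * x).
Proof.
move=> H; elim: H i => {x} [x Hx|j x Hx IH|x y _ IHx _ IHy|c x _ IH] i.
- exact/Fs_e/Es_E.
- have -> : E i * (F j * x) = (E i * F j - F j * E i) * x + F j * (E i * x).
    by rewrite mulrBl !mulrA subrK.
  apply: Fs_add; last exact: Fs_F.
  rewrite (sa_EF Rel); case: eqP => _; last by rewrite mul0r; apply/Fs_e/Es_0.
  rewrite mulr_suml; elim/big_ind: _ => [||m _]; first exact/Fs_e/Es_0.
    exact: Fs_add.
  by rewrite -scalerAl; apply: Fs_scale; apply: fspan_one.
- by rewrite mulrDr; apply: Fs_add.
- by rewrite -scalerAr; apply: Fs_scale.
Qed.

Lemma fspan1 : fspan 1.
Proof.
rewrite -(sa_sum Rel); elim/big_ind: _ => [||l _]; first exact/Fs_e/Es_0.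
  exact: Fs_add.
exact/Fs_e/Es_one.
Qed.

End TriangularSpan.

(** * Tensors in the first letters: embedding and truncation *)

Section Embedding.
Variables (K : fieldType) (v : K).
Hypothesis v_neq0 : v != 0.
Variables n e : nat.
Local Notation N := (n + e)%N.
Implicit Types (a : 'I_n.+1) (b : 'I_N.+1).

Definition up a : 'I_N.+1 := (lshift e a : 'I_(n.+1 + e)).
Definition down b : 'I_n.+1 := inord b.
Definition upi (i : 'I_n.+1.-1) : 'I_N.+1.-1 := lshift e (i : 'I_n).

Lemma upK : cancel up down.
Proof. by move=> a; apply: val_inj; rewrite /down /= inordK //; exact: ltn_ord a. Qed.

Lemma downK b : (b <= n)%N -> up (down b) = b.
Proof. by move=> bn; apply: val_inj; rewrite /up /down /= inordK. Qed.

Lemma up_inj : injective up. Proof. exact: can_inj upK. Qed.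

Lemma up_le a : (up a <= n)%N. Proof. exact: (ltn_ord a). Qed.

Lemma pos_upi i : pos (upi i) = up (pos i). Proof. exact: val_inj. Qed.
Lemma nxt_upi i : nxt (upi i) = up (nxt i). Proof. exact: val_inj. Qed.

Definition embed d : 'Hom(tpower K n.+1 d, tpower K N.+1 d) :=
  lin_ext (fun t : d.-tuple 'I_n.+1 => bvec K [tuple of map up t]).

(** Its kernel is spanned by the tensors with an additional letter. It is stable under the T_r, as
    these only permute letters; hence [cut_T]. *)
Definition cut d : 'Hom(tpower K N.+1 d, tpower K n.+1 d) :=
  lin_ext (fun t : d.-tuple 'I_N.+1 =>
    if all (fun b => b <= n)%N t then bvec K [tuple of map down t] else 0).

Lemma embed_tensv d a (w : tpower K n.+1 d) :
  embed d.+1 (tensv (bvec K a) w) = tensv (bvec K (up a)) (embed d w).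
Proof.
rewrite (span_sum w) tensv_sumr !linear_sum tensv_sumr; apply: eq_bigr => t _.
rewrite tensvZr !linearZ /= tensvZr; congr (_ *: _).
by rewrite -bvec_cons !lin_extE -bvec_cons; congr bvec; apply: val_inj.
Qed.

Lemma cut_tensv d b (w : tpower K N.+1 d) :
  cut d.+1 (tensv (bvec K b) w) =
  if (b <= n)%N then tensv (bvec K (down b)) (cut d w) else 0.
Proof.
transitivity (\sum_t w t *: (if (b <= n)%N then tensv (bvec K (down b)) (cut d (bvec K t)) else 0)).
  rewrite {1}(span_sum w) tensv_sumr !linear_sum; apply: eq_bigr => t _.
  rewrite tensvZr !linearZ /=; congr (_ *: _).
  rewrite -bvec_cons /cut !lin_extE /=; have [bn|_] := boolP (b <= n)%N => //=.
  case: ifP => _; last by rewrite tensv0r.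
  by rewrite -bvec_cons; congr bvec; apply: val_inj.
case: ifP => _; last by rewrite big1 // => t _; rewrite scaler0.
rewrite [in RHS](span_sum w) linear_sum tensv_sumr; apply: eq_bigr => t _.
by rewrite linearZ /= tensvZr.
Qed.

Lemma embedK d (w : tpower K n.+1 d) : cut d (embed d w) = w.
Proof.
rewrite -[RHS]id_lfunE -comp_lfunE; congr (fun_of_lfun _ w); apply: hom_tupleP => t.
rewrite comp_lfunE !lin_extE id_lfunE ifT.
  congr bvec; apply: val_inj => /=; rewrite -map_comp map_id_in // => a _.
  exact: upK.
by apply/allP => b /mapP [a _ ->]; exact: up_le.
Qed.

Lemma embed_tens2 d a a' (w : tpower K n.+1 d) :
  embed d.+2 (tens2 a a' w) = tens2 (up a) (up a') (embed d w).
Proof. by rewrite /tens2 !embed_tensv. Qed.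

Lemma cut_tens2 d b b' (w : tpower K N.+1 d) :
  cut d.+2 (tens2 b b' w) =
  if (b <= n)%N && (b' <= n)%N then tens2 (down b) (down b') (cut d w) else 0.
Proof.
rewrite /tens2 cut_tensv cut_tensv.
by case: ifP => //= _; case: ifP => // _; rewrite tensv0r.
Qed.

Lemma embed_T d (r : 'I_d.-1) :
  (embed d \o T_op v n.+1 r = T_op v N.+1 r \o embed d)%VF.
Proof.
elim: d r => [|[|d] IHd] r; [by case: r | by case: r |].
have [r' ->|->] := unliftP ord0 r.
  have -> : lift ord0 r' = nxt (r' : 'I_d.+1.-1) by apply: val_inj.
  apply: hom_consP => a t; rewrite !comp_lfunE !(@T_op_tail K v _ d.+1 r').
  rewrite tensopE id_lfunE !embed_tensv tensopE id_lfunE.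
  congr (tensv _ _); have /lfunP /(_ (bvec K t)) := IHd r'.
  by rewrite comp_lfunE [RHS]comp_lfunE.
apply: hom_tens2P => a a' t; rewrite !comp_lfunE embed_tens2 !T_op_head.
rewrite (inj_eq up_inj); case: eqP => _; first by rewrite linearZ /= embed_tens2.
have -> : (up a < up a')%N = (a < a')%N by [].
by case: ifP => _; rewrite ?linearD ?linearZ /= ?embed_tens2.
Qed.

Lemma cut_T d (r : 'I_d.-1) :
  (cut d \o T_op v N.+1 r = T_op v n.+1 r \o cut d)%VF.
Proof.
elim: d r => [|[|d] IHd] r; [by case: r | by case: r |].
have [r' ->|->] := unliftP ord0 r.
  have -> : lift ord0 r' = nxt (r' : 'I_d.+1.-1) by apply: val_inj.
  apply: hom_consP => b t; rewrite !comp_lfunE !(@T_op_tail K v _ d.+1 r').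
  rewrite tensopE id_lfunE !cut_tensv; case: ifP => _; last by rewrite linear0.
  rewrite tensopE id_lfunE.
  congr (tensv _ _); have /lfunP /(_ (bvec K t)) := IHd r'.
  by rewrite comp_lfunE [RHS]comp_lfunE.
apply: hom_tens2P => b b' t; rewrite !comp_lfunE cut_tens2 !T_op_head.
have [bn|bn] := boolP ((b <= n)%N && (b' <= n)%N); last first.
  have bn' : ((b' <= n)%N && (b <= n)%N) = false by rewrite andbC (negPf bn).
  rewrite linear0; case: eqP => _; [|case: ifP => _];
    by rewrite ?linearD ?linearZ /= !cut_tens2 ?bn' ?(negPf bn) ?scaler0 ?addr0.
have bn' : ((b' <= n)%N && (b <= n)%N) by rewrite andbC.
have [b1 b2] := andP bn.
rewrite T_op_head -(inj_eq up_inj) !downK //; have lt : (down b < down b')%N = (b < b')%N.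
  by rewrite /= !inordK.
by rewrite lt; case: eqP => _; [|case: ifP => _];
  rewrite ?linearD ?linearZ /= !cut_tens2 ?bn ?bn'.
Qed.

Lemma embed_K d a z (w : tpower K n.+1 d) :
  K_op v d (up a) z (embed d w) = embed d (K_op v d a z w).
Proof.
rewrite -!comp_lfunE; congr (fun_of_lfun _ w); apply: hom_tupleP => t.
rewrite comp_lfunE [RHS]comp_lfunE lin_extE !K_op_bvec // linearZ /= lin_extE.
congr (v ^ (z * _%:Z) *: _); rewrite count_map; apply: eq_count => x /=.
by rewrite (inj_eq up_inj).
Qed.

Lemma embed_E d i (w : tpower K n.+1 d) :
  E_op v d (upi i) (embed d w) = embed d (E_op v d i w).
Proof.
rewrite -!comp_lfunE; congr (fun_of_lfun _ w); elim: d {w} => [|d IHd].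
  by rewrite /= comp_lfun0l comp_lfun0r.
apply: hom_consP => a t; rewrite comp_lfunE [RHS]comp_lfunE embed_tensv !E_op_tensv //.
rewrite linearD linearZ /= !embed_tensv nxt_upi pos_upi (inj_eq up_inj).
congr (_ *: tensv _ _ + tensv _ _).
  rewrite /KK_op comp_lfunE [in RHS]comp_lfunE pos_upi nxt_upi.
  by rewrite embed_K embed_K.
by have /lfunP /(_ (bvec K t)) := IHd; rewrite !comp_lfunE.
Qed.

(** E_i needs the letter i + 1 > n, which is absent; this includes the boundary case i = n. *)
Lemma embed_E_ge d (i : 'I_N.+1.-1) (w : tpower K n.+1 d) : (n <= i)%N ->
  E_op v d i (embed d w) = 0.
Proof.
move=> ni; rewrite (span_sum w) !linear_sum big1 // => t _.
rewrite !linearZ /= lin_extE E_op_absent ?scaler0 //.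
rewrite count_map; apply/eqP; rewrite -leqn0 leqNgt -has_count; apply/hasPn => x _ /=.
apply/negP => /eqP /(congr1 val) /= h; have := ltn_ord x; rewrite h => /=.
by rewrite !ltnS ltnNge ni.
Qed.

Lemma cut_F d i (w : tpower K N.+1 d) :
  cut d (F_op v d (upi i) w) = F_op v d i (cut d w).
Proof.
rewrite -!comp_lfunE; congr (fun_of_lfun _ w); elim: d {w} => [|d IHd].
  by rewrite /= comp_lfun0l comp_lfun0r.
apply: hom_consP => b t; rewrite comp_lfunE [RHS]comp_lfunE F_op_tensv //.
rewrite linearD !linearZ /= !cut_tensv nxt_upi pos_upi up_le upK.
have -> : cut d (F_op v d (upi i) (bvec K t)) = F_op v d i (cut d (bvec K t)).
  by have /lfunP /(_ (bvec K t)) := IHd; rewrite !comp_lfunE.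
case: ifP => bn.
  by rewrite F_op_tensv // -{1 2 3}(downK bn) !(inj_eq up_inj).
rewrite !linear0 addr0; have [bp|_] := eqVneq b (up (pos i)); last by rewrite scale0r.
by move: bn; rewrite bp up_le.
Qed.

(** Every term produced by F_i contains the letter i + 1 > n, which is truncated. *)
Lemma cut_F_ge d (i : 'I_N.+1.-1) (w : tpower K N.+1 d) : (n <= i)%N ->
  cut d (F_op v d i w) = 0.
Proof.
move=> ni; rewrite -comp_lfunE -[RHS](zero_lfunE _ w); congr (fun_of_lfun _ w).
elim: d {w} => [|d IHd]; first by rewrite /= comp_lfun0r.
apply: hom_consP => b t; rewrite comp_lfunE F_op_tensv // linearD !linearZ /= !cut_tensv.
rewrite zero_lfunE leqNgt ltnS ni /= scaler0 add0r.
have -> : cut d (F_op v d i (bvec K t)) = 0.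
  by have /lfunP /(_ (bvec K t)) := IHd; rewrite !comp_lfunE zero_lfunE.
by case: ifP => _; rewrite ?tensv0r scaler0.
Qed.

End Embedding.

(** * Compression to the first letters *)

Section Compression.
Variables (K : fieldType) (v : K).
Hypothesis v_generic : forall k : nat, (0 < k)%N -> v ^+ k != 1.
Hypothesis v_neq0 : v != 0.
Variables n e d : nat.
Local Notation N := (n + e)%N.
Local Notation emb := (embed K n e d).
Local Notation cutd := (cut K n e d).
Local Notation im := (@image K v n d).
Local Notation one := (fun l => idem_op v l : op K N d).
Local Notation E := (fun i => E_op v d i : op K N d).
Local Notation F := (fun i => F_op v d i : op K N d).
Implicit Types (x : op K N d) (w : tpower K n.+1 d).

Definition up_tuple (t : d.-tuple 'I_n.+1) : d.-tuple 'I_N.+1 := [tuple of map (@up n e) t].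

Lemma content_up_tuple t t' : content t = content t' -> content (up_tuple t) = content (up_tuple t').
Proof.
move=> tt'; have /seq.permP pt : perm_eq t t'.
  by apply/allP => a _ /=; rewrite -!contentE tt'.
by apply: val_inj; apply/ffunP => j; apply: ord_inj; rewrite !contentE !count_map pt.
Qed.

Lemma embed_idem (l : Lambda N.+1 d) :
  exists2 y, im y & forall w, idem_op v l (emb w) = emb (y w).
Proof.
pose P m := [exists t, (content t == m) && (content (up_tuple t) == l)].
(* The sum has at most one term, and none if l involves an additional letter. *)
exists (\sum_(m | P m) idem_op v m); first by apply: image_sum => m _; exact: image_one.
move=> w; rewrite -!comp_lfunE; congr (fun_of_lfun _ w); apply: hom_tupleP => t.
rewrite comp_lfunE [RHS]comp_lfunE lin_extE idem_op_bvec // sum_lfunE.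
have -> : \sum_(m | P m) idem_op v m (bvec K t) = (P (content t))%:R *: bvec K t.
  rewrite big_mkcond (bigD1 (content t)) //= big1 ?addr0 => [|m mt].
    by rewrite idem_op_bvec // eqxx scale1r; case: (P _); rewrite ?scale1r ?scale0r.
  by case: ifP => // _; rewrite idem_op_bvec // (negPf mt) scale0r.
rewrite linearZ /= lin_extE; congr (_%:R *: _); congr nat_of_bool.
apply/eqP/existsP => [->|[t' /andP[/eqP ct /eqP <-]]].
  by exists t; rewrite !eqxx.
exact: content_up_tuple ct.
Qed.

Lemma espan_embed x : espan one E x -> exists2 y, im y & forall w, x (emb w) = emb (y w).
Proof.
elim=> [|l|i {}x _ [y iy xy]].
- by exists 0; [exact: image0 | move=> w; rewrite !zero_lfunE linear0].
- exact: embed_idem.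
- have [ni|i_n] := leqP n i.
    exists 0; [exact: image0 | move=> w; rewrite zero_lfunE linear0 comp_lfunE xy].
    exact: embed_E_ge.
  exists ((E_op v d (Ordinal i_n : 'I_n.+1.-1) : op K n d) * y).
    by apply: imageM => //; exact: image_E.
  move=> w; rewrite comp_lfunE [in RHS]comp_lfunE xy -embed_E //.
  by congr (fun_of_lfun (E_op v d _) _); apply: val_inj.
Qed.

Lemma fspan_cut x : fspan one E F x -> exists2 y, im y & forall w, cutd (x (emb w)) = y w.
Proof.
elim=> {x} [x /espan_embed [y iy xy]|i x _ [y iy xy]|x x' _ [y iy xy] _ [y' iy' xy']|c x _ [y iy xy]].
- by exists y => // w; rewrite xy embedK.
- have [ni|i_n] := leqP n i.
    exists 0; [exact: image0 | move=> w; rewrite zero_lfunE comp_lfunE].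
    exact: cut_F_ge.
  exists ((F_op v d (Ordinal i_n : 'I_n.+1.-1) : op K n d) * y).
    by apply: imageM => //; exact: image_F.
  move=> w; rewrite comp_lfunE [in RHS]comp_lfunE -xy -cut_F //.
  by congr (cutd (fun_of_lfun (F_op v d _) _)); apply: val_inj.
- exists (y + y'); first exact: imageD.
  by move=> w; rewrite !add_lfunE linearD /= xy xy'.
- exists (c *: y); first exact: imageZ.
  by move=> w; rewrite !scale_lfunE linearZ /= xy.
Qed.

Lemma image_fspan x : image v x -> fspan one E F x.
Proof.
have S := schur_alg_op v_generic v_neq0 N d.
case=> p <- {x}; move: p; apply: free_alg_ind.
- rewrite eval1; exact: (fspan1 S).
- by move=> p q hp hq; rewrite linearD; apply: Fs_add.
- by move=> c p hp; rewrite linearZ; apply: Fs_scale.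
- move=> x p hp; rewrite evalM eval_gen.
  by case: x => [l|[i|i]]; [exact: (fspan_one S)|exact: (fspan_E S)|exact: Fs_F].
Qed.

Lemma image_cut x : image v x -> im (cutd \o (x \o emb))%VF.
Proof.
move=> /image_fspan /fspan_cut [y iy xy].
by have -> : (cutd \o (x \o emb))%VF = y by apply/lfunP => w; rewrite !comp_lfunE xy.
Qed.

End Compression.

Theorem q_schur_image (K : fieldType) (v : K) :
  (forall k : nat, (0 < k)%N -> v ^+ k != 1) -> v != 0 ->
  forall n d (f : op K n d), q_schur v f -> image v f.
Proof.
move=> v_generic v_neq0 n d f /(q_schurP v) fT.
(* [top_tuple] needs exactly d additional letters. *)
pose emb := embed K n d d; pose cutd := cut K n d d.
pose h : op K (n + d) d := (emb \o (f \o cutd))%VF.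
have -> : f = (cutd \o (h \o emb))%VF.
  by apply/lfunP => w; rewrite !comp_lfunE !embedK.
apply: image_cut => //; apply: corner_surjective => //.
  apply/q_schurP => r; rewrite /h -comp_lfunA -comp_lfunA cut_T (comp_lfunA f) fT.
  by rewrite -(comp_lfunA _ f) comp_lfunA embed_T -comp_lfunA.
(* Embedded tensors have no additional letter, so their weights are small; h vanishes on all other
   weight spaces and takes no value in them. *)
move=> l nsl; have up_small t : l != content (up_tuple d t).
  apply/eqP => lt; apply: nsl => j nj; rewrite lt contentE count_map.
  rewrite (@eq_count _ _ pred0) ?count_pred0 // => a /=.
  by apply/negbTE; rewrite neq_ltn (leq_ltn_trans (up_le d a) nj).
split; apply: hom_tupleP => t; rewrite comp_lfunE zero_lfunE.
  rewrite idem_op_bvec // linearZ /= /h !comp_lfunE lin_extE.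
  case: ifP => [/allP tn|_]; last by rewrite !linear0.
  have -> : t = up_tuple d [tuple of map (@down n d) t].
    apply: val_inj; rewrite /= -map_comp -[LHS]map_id; apply/eq_in_map => b /tn bn /=.
    by rewrite downK.
  by rewrite (negPf (up_small _)) scale0r.
rewrite /h !comp_lfunE (span_sum (f _)) !linear_sum big1 // => s _.
rewrite !linearZ /=; have -> : emb (bvec K s) = bvec K (up_tuple d s) by exact: lin_extE.
by rewrite idem_op_bvec // (negPf (up_small _)) scale0r scaler0.
Qed.

(** * The field Q(v) *)

Lemma v_ind_neq0 : v_ind != 0.
Proof. by rewrite tofrac_eq0 polyX_eq0. Qed.

Lemma v_ind_generic (k : nat) : (0 < k)%N -> v_ind ^+ k != 1.
Proof.
move=> k0; rewrite -tofracXn -tofrac1 tofrac_eq; apply/eqP => /(congr1 (fun p => size (p : {poly rat}))).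
by rewrite size_polyXn size_poly1; case: k k0.
Qed.

Lemma dominant_le n d (l : Lambda n.+1 d) (i j : 'I_n.+1) : dominant l ->
  (i <= j)%N -> (val l j <= val l i)%N.
Proof.
move=> dl ij; move: {2}(j - i)%N (erefl (j - i)%N) => k; elim: k j ij => [|k IHk] j ij kE.
  by have -> : j = i by apply: ord_inj; lia.
have jn : (i + k < n.+1.-1)%N by have := ltn_ord j; rewrite /=; lia.
have -> : j = nxt (Ordinal jn) by apply: ord_inj; rewrite /=; lia.
by apply: leq_trans (dl _) (IHk _ _ _); rewrite /=; lia.
Qed.

(* Multiplied by v^(2d), the scalar of l is the sum of the v^(2(i + d - l_i));
   for dominant l these exponents increase strictly with i. *)
Lemma central_char_v_ind_inj n d (l m : Lambda n.+1 d) : dominant l -> dominant m ->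
  central_char v_ind l = central_char v_ind m -> l = m.
Proof.
pose a (l : Lambda n.+1 d) (i : 'I_n.+1) := (2 * (i + (d - val l i)))%N.
have le_d (k : Lambda n.+1 d) i : (val k i <= d)%N by rewrite -ltnS; exact: ltn_ord.
have charE k : v_ind ^+ (2 * d) * central_char v_ind k = tofrac (\sum_i 'X^(a k i)).
  rewrite mulr_sumr rmorph_sum /=; apply: eq_bigr => i _; rewrite tofracXn -/v_ind.
  rewrite !exprnP -!expfzDr ?v_ind_neq0 //; congr (_ ^ _).
  rewrite /a; move: (nat_of_ord (val k i)) (le_d k i) => c cd; lia.
have coefE k (j : nat) : (\sum_i 'X^(a k i) : {poly rat})`_j = (\sum_i (j == a k i))%N%:R.
  by rewrite coef_sum natr_sum; apply: eq_bigr => i _; rewrite coefXn.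
have mono k : dominant k -> forall i j : 'I_n.+1, (i < j)%N -> (a k i < a k j)%N.
  by move=> dk i j ij; have := dominant_le dk (ltnW ij); rewrite /a; lia.
(* The coefficient of X^(a k i) counts places; in characteristic 0 it is nonzero for [k], hence also
   for [k']. *)
have hit k k' : central_char v_ind k = central_char v_ind k' ->
    forall i, exists j, a k i = a k' j.
  move=> /(congr1 (fun x => v_ind ^+ (2 * d) * x)); rewrite !charE => /eqP.
  rewrite tofrac_eq => /eqP /(congr1 (fun p : {poly rat} => p`_(_))) kk' i.
  have := kk' (a k i); rewrite !coefE => /eqP; rewrite Num.Theory.eqr_nat => /eqP.
  rewrite (bigD1 i) //= eqxx => e; apply: contrapT => no.
  move: e; rewrite [RHS]big1 // => j _; case: eqP => // ij.
  by case: no; exists j.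
(* If the exponents agree before i, then by strict growth the exponent [a k i] can occur for [k']
   only at a place j >= i. *)
have le k k' : dominant k -> dominant k' -> central_char v_ind k = central_char v_ind k' ->
    forall i : 'I_n.+1, (forall j : 'I_n.+1, (j < i)%N -> a k j = a k' j) -> (a k' i <= a k i)%N.
  move=> dk dk' kk' i IH; have [j ij] := hit _ _ kk' i.
  rewrite ij; have [ji|ji|/ord_inj -> //] := ltngtP j i; last exact: ltnW (mono _ dk' _ _ ji).
  by have := mono _ dk _ _ ji; rewrite (IH j ji) ij ltnn.
move=> dl dm lm; have al (i : 'I_n.+1) : a l i = a m i.
  move: {2}i.+1 (ltnSn i) => b; elim: b i => // b IHb i ib.
  have IH (j : 'I_n.+1) : (j < i)%N -> a l j = a m j by move=> ji; apply: IHb; lia.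
  by apply/eqP; rewrite eqn_leq !le // => j /IH.
apply: val_inj; apply/ffunP => i; apply: ord_inj.
by have := al i; have := le_d l i; have := le_d m i; rewrite /a; lia.
Qed.

Lemma singular_vector (K : fieldType) (v : K) n d (l : Lambda n.+1 d) :
  (forall k : nat, (0 < k)%N -> v ^+ k != 1) -> v != 0 -> dominant l ->
  exists w : tpower K n.+1 d, [/\ w <> 0, idem_op v l w = w & forall i, E_op v d i w = 0].
Proof.
move=> v_generic v_neq0 dl.
have [w [w0 Kw Ew]] := singular_exists v_neq0 (eqP (valP l)) dl.
exists w; split=> //; first exact/eqP.
rewrite (@idem_op_weight _ _ v_generic v_neq0 _ _ (weight l)) ?eqxx // => j.
by rewrite Kw mul1r ffunE.
Qed.

Theorem mainTheorem8 (n d : nat) (hn : (1 <= n)%N) (hd : (1 <= d)%N) :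
  presented_by (@q_schur Qv v_ind n d) (@schur_op Qv v_ind n d)
    (@schur_rel Qv v_ind n d).
Proof.
case: n hn => // n _; split=> [f|p].
  split=> [|[p <-]]; last exact: (eval_q_schur v_ind_neq0 v_ind_generic).
  exact: (q_schur_image v_ind_generic v_ind_neq0).
split=> [|]; last exact: (rel_ideal_eval v_ind_generic v_ind_neq0).
apply: (presentation_faithful v_ind_generic v_ind_neq0).
- exact: central_char_v_ind_inj.
- by move=> l; apply: singular_vector v_ind_neq0; exact: v_ind_generic.
Qed.
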